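(* Let $f\in\mathcal F(\mathbb R^n)$ and let $H$ be an $i$-dimensional linear subspace of $\mathbb R^n$. Then $$\int_{H}P_Hf(x)\,dx\int_{H^{\perp}}f(y)\,dy\le\binom{n}{i}\,\|f\|_\infty\int_{\mathbb R^n}f(z)\,dz .$$ Equality holds if and only if $\frac{f}{\|f\|_\infty}=\chi_K$ for some convex body $K\subset\mathbb R^n$ such that $\mathrm{vol}_i(P_HK)\,\mathrm{vol}_{n-i}(K\cap H^\perp)=\binom{n}{i}\mathrm{vol}_n(K)$, i.e., such that for every $v\in H$ the intersection $K\cap(H^\perp+\mathbb R^+v)$ is the convex hull of $K\cap H^\perp$ and one point.
   Context: $\mathcal F(\mathbb R^n)$ is the set of integrable log-concave functions $f:\mathbb R^n\to[0,\infty)$, i.e. $f((1-\lambda)x+\lambda y)\ge f(x)^{1-\lambda}f(y)^\lambda$ for all $x,y\in\mathbb R^n$, $\lambda\in[0,1]$. $\|f\|_\infty=\sup f$. For a linear subspace $H$, $H^\perp$ is its orthogonal complement, and the projection (shadow) of $f$ onto $H$ is $P_Hf(x)=\max\{f(y):y\in x+H^\perp\}$ for $x\in H$. Integrals over subspaces are with respect to Lebesgue measure of the corresponding dimension. A convex body is a compact convex set with nonempty interior; $P_HK$ is its orthogonal projection onto $H$; $\mathrm{vol}_m$ is $m$-dimensional volume; $\chi_K$ is the characteristic function of $K$ (equal to 1 on $K$, 0 elsewhere). $\mathbb R^+v=\{sv:s\ge0\}$.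
   Formalization: The ''only if'' of the equality case is false as written; it is stated for 0<i<n and ∫f>0, with f/‖f‖_∞=χ_K almost everywhere, and everywhere when f is upper semicontinuous. *)

(* Defs.v *)
From HB Require Import structures.
From mathcomp Require Import all_boot all_order all_algebra.
From mathcomp Require Import all_classical all_reals all_analysis.
Import numFieldNormedType.Exports.

Set Implicit Arguments.
Unset Strict Implicit.
Unset Printing Implicit Defensive.

Import Order.TTheory GRing.Theory Num.Theory.

Local Open Scope classical_set_scope.
Local Open Scope ring_scope.

(* Lebesgue measure on n-tuples, obtained from [lebesgue_measure] by iterating
   the binary product; on 0-tuples it is the unit mass. *)
Section lebesgue_tuple.
Context {R : realType}.
Local Notation mR := (measurableTypeR R).

Definition tcons n (p : mR * n.-tuple mR) : n.+1.-tuple mR :=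
  [the n.+1.-tuple mR of p.1 :: p.2].

Lemma measurable_tcons n : measurable_fun [set: mR * n.-tuple mR] (@tcons n).
Proof. by apply: measurable_cons; [exact: measurable_fst|exact: measurable_snd]. Qed.

Section step.
Variables (n : nat) (mu : {sigma_finite_measure set (n.-tuple mR) -> \bar R}).

Definition lebesgue_step : set (n.+1.-tuple mR) -> \bar R :=
  pushforward (lebesgue_measure \x mu)%E (@tcons n).

Let step0 : lebesgue_step set0 = 0%E.
Proof. by rewrite /lebesgue_step /pushforward preimage_set0 measure0. Qed.

Let step_ge0 A : (0 <= lebesgue_step A)%E.
Proof. by rewrite /lebesgue_step /pushforward; apply: measure_ge0. Qed.

Let step_sigma_additive : semi_sigma_additive lebesgue_step.
Proof.
move=> F mF tF mUF; rewrite /lebesgue_step /pushforward preimage_bigcup.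
have mp X : measurable X -> measurable (@tcons n @^-1` X).
  by move=> mX; rewrite -[X in measurable X]setTI; exact: measurable_tcons.
apply: measure_semi_sigma_additive.
- by move=> k; exact: mp.
- apply/trivIsetP => /= i j _ _ ij; rewrite -preimage_setI.
  by move/trivIsetP : tF => /(_ _ _ _ _ ij) ->//; rewrite preimage_set0.
- by rewrite -preimage_bigcup; exact: mp.
Qed.

HB.instance Definition _ := isMeasure.Build _ _ _ lebesgue_step
  step0 step_ge0 step_sigma_additive.

Let step_sigma_finite : sigma_finite setT lebesgue_step.
Proof.
have /sigma_finiteP[F [TF ndF Ffin]] := sigma_finiteT (@lebesgue_measure R).
have /sigma_finiteP[G [TG ndG Gfin]] := sigma_finiteT mu.
pose u (t : n.+1.-tuple mR) : mR * n.-tuple mR :=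
  (thead t, [tuple of behead t]).
have uK p : u (tcons p) = p.
  by case: p => x t; congr pair; exact: val_inj.
have mu_ : measurable_fun [set: n.+1.-tuple mR] u.
  apply: measurable_fun_pair; first exact: measurable_tnth.
  exact: measurable_behead.
exists (fun k => u @^-1` (F k `*` G k)).
  rewrite -preimage_bigcup (_ : \bigcup_k _ = setT) ?preimage_setT//.
  apply/esym; rewrite -setXTT TF TG predeqE => -[x y]; split.
    move=> [/= [j _ Fjx] [k _ Gky]]; exists (maxn j k) => //; split.
    - by move: x Fjx; exact/subsetPset/ndF/leq_maxl.
    - by move: y Gky; exact/subsetPset/ndG/leq_maxr.
  by move=> [k _ []/= ? ?]; split; exists k.
move=> k; have [mFk Fk] := Ffin k; have [mGk Gk] := Gfin k; split.
  by rewrite -[X in measurable X]setTI; apply: mu_ => //; exact: measurableX.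
rewrite /lebesgue_step /pushforward -comp_preimage.
rewrite (_ : u \o @tcons n = idfun); last by apply/funext => p; exact: uK.
by rewrite preimage_id product_measure1E// lte_mul_pinfty// ge0_fin_numE.
Qed.

HB.instance Definition _ := Measure_isSigmaFinite.Build _ _ _ lebesgue_step
  step_sigma_finite.

End step.

Fixpoint lebesgue_tuple n : {sigma_finite_measure set (n.-tuple mR) -> \bar R} :=
  match n return {sigma_finite_measure set (n.-tuple mR) -> \bar R} with
  | 0 => (\d_ ([tuple] : 0.-tuple mR) : {sigma_finite_measure set _ -> \bar R})
  | n'.+1 => (lebesgue_step (lebesgue_tuple n') :
      {sigma_finite_measure set (n'.+1.-tuple mR) -> \bar R})
  end.

Lemma lebesgue_tuple_box n (A : 'I_n -> set mR) :
  (forall k, measurable (A k)) ->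
  (lebesgue_tuple n [set t | forall k, A k (tnth t k)] =
   \prod_(k < n) lebesgue_measure (A k))%E.
Proof.
elim: n => [|n IHn] in A *.
  move=> _; rewrite big_ord0 /= diracE mem_set//.
  by case.
move=> mA; rewrite big_ord_recl /= -IHn; last by move=> k; exact: mA.
rewrite /lebesgue_step /pushforward -product_measure1E//; last first.
  rewrite [X in measurable X](_ : _ =
      \bigcap_(k in [set: 'I_n]) (@tnth n mR ^~ k @^-1` A (lift ord0 k))); last first.
    by apply/seteqP; split => t /=; [move=> h k _|move=> h k]; exact: h.
  apply: fin_bigcap_measurable => // k _.
  by rewrite -[X in measurable X]setTI; apply: measurable_tnth.
congr product_measure1; apply/seteqP; split => -[x t] /=.
  move=> h; split; first exact: (h ord0).
  by move=> k; have := h (lift ord0 k); rewrite /tcons tnthS.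
move=> [x0 h] k; case: (unliftP ord0 k) => [j|] ->; last exact: x0.
by rewrite /tcons tnthS; exact: h.
Qed.

End lebesgue_tuple.


(* R^n is 'rV[R]_n. A log-concave function (and its restriction or projection to
   a subspace) is Lebesgue measurable, hence a.e. equal to a Borel minorant, so
   [\int], the supremum over Borel simple minorants, is its Lebesgue integral
   with no measurability assumption. *)
Section euclidean.
Context {R : realType} {n : nat}.
Implicit Types (A : set 'rV[R]_n) (g : 'rV[R]_n -> \bar R).

Definition rv_of_tuple (t : n.-tuple (measurableTypeR R)) : 'rV[R]_n :=
  \row_k tnth t k.

Definition integral_rV g : \bar R :=
  (\int[lebesgue_tuple n]_t g (rv_of_tuple t))%E.

Definition vol A : \bar R := lebesgue_tuple n (rv_of_tuple @^-1` A).

Definition convex_body (K : set 'rV[R]_n) :=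
  [/\ compact K, convex_set K & K° !=set0].

Definition convex_hull A : set 'rV[R]_n := smallest (@convex_set R 'rV[R]_n) A.

Definition upper_semicontinuous (f : 'rV[R]_n -> R) :=
  lower_semicontinuous (fun x => (- f x)%:E).

Definition log_concave (f : 'rV[R]_n -> R) :=
  forall (x y : 'rV[R]_n) (l : R), 0 <= l <= 1 ->
    f x `^ (1 - l) * f y `^ l <= f ((1 - l) *: x + l *: y).

Definition int_log_concave (f : 'rV[R]_n -> R) :=
  [/\ forall x, 0 <= f x, log_concave f & (integral_rV (EFin \o f) < +oo)%E].

Definition supnorm (f : 'rV[R]_n -> R) : \bar R :=
  ereal_sup [set (f x)%:E | x in [set: 'rV[R]_n]].

End euclidean.

(* A linear subspace is the row space of a matrix H : 'M[R]_n. *)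
Section subspaces.
Context {R : realType} {n : nat}.
Implicit Types (H : 'M[R]_n) (A : set 'rV[R]_n) (g : 'rV[R]_n -> \bar R).

Definition subspace_set H : set 'rV[R]_n := [set x | (x <= H)%MS].

Definition orthc H : 'M[R]_n := kermx H^T.

Lemma orthcP H (y : 'rV[R]_n) :
  subspace_set (orthc H) y <-> forall x, subspace_set H x -> x *m y^T = 0.
Proof.
rewrite /subspace_set /orthc /=; split => [/sub_kermxP yH x /submxP[a ->]|yH].
  by rewrite -mulmxA -[H]trmxK -trmx_mul yH trmx0 mulmx0.
apply/sub_kermxP; apply: trmx_inj; rewrite trmx_mul trmxK trmx0.
by apply/row_matrixP => k; rewrite row0 row_mul yH//= row_sub.
Qed.

Lemma rank_orthc H : \rank (orthc H) = (n - \rank H)%N.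
Proof. by rewrite /orthc mxrank_ker mxrank_tr. Qed.

Definition is_onb k H (E : 'M[R]_(k, n)) := E *m E^T = 1%:M /\ (E == H)%MS.

Definition onb H : 'M[R]_(\rank H, n) := xget 0 [set E | is_onb H E].

(* Lebesgue measure on a subspace, in the coordinates of an orthonormal basis *)
Definition subspace_integral H g : \bar R :=
  integral_rV (fun t : 'rV[R]_(\rank H) => g (t *m onb H)).

Definition subspace_vol H A : \bar R :=
  vol [set t : 'rV[R]_(\rank H) | A (t *m onb H)].

(* supremum over x + H^perp; it is a maximum when f is upper semicontinuous and
   its integral is positive and finite *)
Definition proj_fun H (f : 'rV[R]_n -> R) (x : 'rV[R]_n) : \bar R :=
  ereal_sup [set (f (x + w))%:E | w in subspace_set (orthc H)].

Definition proj_set H A : set 'rV[R]_n :=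
  [set x | subspace_set H x /\ exists2 w, subspace_set (orthc H) w & A (x + w)].

Definition halfspace_along H (v : 'rV[R]_n) : set 'rV[R]_n :=
  [set z | exists w s, [/\ subspace_set (orthc H) w, 0 <= s & z = w + s *: v]].

End subspaces.

Lemma onb_exists (R : realType) n k (B : 'M[R]_(k, n)) :
  row_free B -> exists E : 'M[R]_(k, n), E *m E^T = 1%:M /\ (E == B)%MS.
Proof.
elim: k => [|k IHk] in B *.
  by move=> _; exists 0; split; [apply/matrixP => -[]|rewrite [B]flatmx0 submx_refl].
rewrite -[k.+1]/(1 + k)%N in B *; rewrite -[B]vsubmxK.
set b := usubmx B; set B' := dsubmx B => fB.
have fB' : row_free B'.
  apply/row_freeP; have /row_freeP[C BC] := fB.
  exists (rsubmx C).
  move: BC; rewrite -{1}[C]hsubmxK mul_col_row.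
  by rewrite (scalar_mx_block 1 k) => /eq_block_mx[].
have [E' [E'1 /andP[E'B B'E]]] := IHk _ fB'.
pose u := b - b *m E'^T *m E'.
have uE' : u *m E'^T = 0.
  by rewrite mulmxBl -(mulmxA (b *m _)) E'1 mulmx1 subrr.
have u0 : u != 0.
  apply/eqP => /eqP; rewrite subr_eq0 => /eqP bE.
  have bB' : (b <= B')%MS by rewrite bE (submx_trans _ E'B)// submxMl.
  move: fB; rewrite /row_free => /eqP.
  have : (\rank (col_mx b B') <= k)%N.
    by rewrite (leq_trans (mxrankS (_ : _ <= B')%MS)) ?rank_leq_row// col_mx_sub bB' submx_refl.
  by move=> + e; rewrite e ltnn.
pose q := (u *m u^T) 0 0.
have qE : q = \sum_j u 0 j ^+ 2.
  by rewrite /q [LHS]mxE; apply: eq_bigr => j _; rewrite expr2; congr (_ * _); rewrite mxE.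
have q_gt0 : 0 < q.
  rewrite lt_def qE sumr_ge0 ?andbT; last by move=> j _; rewrite sqr_ge0.
  apply: contra u0 => /eqP s0; apply/eqP/rowP => j; rewrite [RHS]mxE.
  apply/eqP; rewrite -sqrf_eq0; apply/eqP.
  by apply: (psumr_eq0P _ s0) => // l _; rewrite sqr_ge0.
pose e := (Num.sqrt q)^-1 *: u.
have E1 : col_mx e E' *m (col_mx e E')^T = 1%:M.
  rewrite tr_col_mx mul_col_row (scalar_mx_block 1 k) E'1; congr block_mx.
  - rewrite /e linearZ /= -scalemxAl -scalemxAr scalerA -invfM -expr2.
    rewrite sqr_sqrtr ?ltW// [u *m _]mx11_scalar -/q scale_scalar_mx.
    by rewrite mulVf ?gt_eqF.
  - by rewrite /e -scalemxAl uE' scaler0.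
  - by apply: trmx_inj; rewrite trmx_mul trmxK /e -scalemxAl uE' scaler0 !trmx0.
exists (col_mx e E'); split => //.
have EB : (col_mx e E' <= col_mx b B')%MS.
  have B'B : (B' <= col_mx b B')%MS by rewrite -addsmxE addsmxSr.
  rewrite col_mx_sub (submx_trans E'B)// andbT scalemx_sub//.
  rewrite addmx_sub//; first by rewrite -addsmxE addsmxSl.
  by rewrite eqmx_opp (submx_trans (submxMl _ _))// (submx_trans E'B).
rewrite EB /=; have /mxrank_leqif_sup/geq_leqif <- := EB.
have /eqP-> : row_free (col_mx e E').
  by apply/row_freeP; exists (col_mx e E')^T.
by rewrite rank_leq_row.
Qed.

Lemma onbP (R : realType) n (H : 'M[R]_n) : is_onb H (onb H).
Proof.
have [|E [E1 /andP[EB BE]]] := @onb_exists R n _ (row_base H).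
  exact: row_base_free.
rewrite /onb; case: xgetP => [? -> //|/(_ E)]; case; split => //.
by rewrite (submx_trans EB) ?(submx_trans _ BE) ?eq_row_base.
Qed.

Section equality_case.
Context {R : realType} {n : nat}.
Implicit Types (H : 'M[R]_n) (K : set 'rV[R]_n).

Definition extremal_body (i : nat) H K :=
 (subspace_vol H (proj_set H K) *
     subspace_vol (orthc H) (K `&` subspace_set (orthc H)) =
   'C(n, i)%:R%:E * vol K)%E.

Definition conical_sections H K :=
  forall v, subspace_set H v ->
    exists p, K `&` halfspace_along H v =
              convex_hull (K `&` subspace_set (orthc H) `|` [set p]).

End equality_case.

(* Main.v *)
(* Let K_s be the closure of {f > s}, m = n - i, and let a(s), b(s), v(s) be the
   volumes of its projection onto H, of its section by H^perp and of K_s itself.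
   If x lies in t times the projection, with 0 <= t < 1, convexity puts a copy of the
   central section scaled by 1 - t into the section over x, whose volume is thus at
   least (1 - t)^m b(s); a beta integral then gives a(s) b(s) <= C(n, i) v(s).  Since
   a and b are nonincreasing, Chebyshev's integral inequality bounds (int a)(int b) by
   |f|_oo (int a b), and layer cakes conclude.
   If equality holds, then a or b is constant, and K_r is conical for almost every r.
   By log-concavity (1 - l) K_s + l K_t is contained in K_r for r = s^(1-l) t^l; with
   K_r conical and s < r < t this forces the other quantity to be constant too, so all
   the K_s coincide and f is a multiple of an indicator. *)

Require Import Defs.
From HB Require Import structures.
From mathcomp Require Import all_boot all_order all_algebra.
From mathcomp Require Import all_classical all_reals all_analysis.
From mathcomp Require Import measurable_realfun ring lra unstable.
Import numFieldNormedType.Exports.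
Import Order.TTheory GRing.Theory Num.Theory.

Set Implicit Arguments.
Unset Strict Implicit.
Unset Printing Implicit Defensive.

Local Open Scope classical_set_scope.
Local Open Scope ring_scope.

(** * Borel sets and Lebesgue measure on row vectors *)

(** Nothing about [f] is assumed measurable, and this shapes the argument. The strict level sets are
    convex but perhaps not Borel, so volumes are taken of their closures and interiors, which at
    positive heights differ by a null set. Upper bounds for the integrals of the shadow and of the
    central restriction only use that an integral is a supremum over simple minorants. The lower
    bound for the integral of [f] needs a Borel minorant: [f] set to 0 on the null union of the
    boundaries of its positive rational levels. Splitting R^n along H and its complement needs
    invariance of Lebesgue measure under orthonormal changes of coordinates. It is drawn from the
    uniqueness of translation-invariant measures, calibrated on the Euclidean ball, without
    determinants. The constant is a beta value: 1 / C(n, i) is the integral over [0, 1] of th^i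
    times m (1 - th)^(m - 1), the second factor being the density whose tail on [t, 1] is (1 - t)^m.
    For m = 0 this density vanishes, which is why that case is argued apart each time. *)

Section borel.
Context {R : realType}.
Local Notation mR := (measurableTypeR R).

Definition tuple_of_rv n (x : 'rV[R]_n) : n.-tuple mR := [tuple x ord0 k | k < n].

Lemma rv_of_tupleK n : cancel (@rv_of_tuple R n) (@tuple_of_rv n).
Proof. by move=> t; apply/eq_from_tnth => k; rewrite tnth_mktuple mxE. Qed.

Lemma tuple_of_rvK n : cancel (@tuple_of_rv n) (@rv_of_tuple R n).
Proof. by move=> x; apply/rowP => k; rewrite mxE tnth_mktuple. Qed.

Definition borel_rV n (A : set 'rV[R]_n) := measurable (@rv_of_tuple R n @^-1` A).

Lemma borel_ball n (x : 'rV[R]_n) (e : R) : borel_rV (ball x e).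
Proof.
have [e0|e0] := leP e 0.
  rewrite /borel_rV (_ : _ @^-1` _ = set0); first exact: measurable0.
  by apply/seteqP; split => // t [+ _]; rewrite ltNge e0.
rewrite /borel_rV (_ : _ @^-1` _ =
  \bigcap_(k in [set: 'I_n]) (@tnth n mR ^~ k @^-1` (ball (x ord0 k) e))).
  apply: fin_bigcap_measurable => // k _; rewrite -[X in measurable X]setTI.
  apply: measurable_tnth => //; apply: open_measurable; exact: ball_open.
apply/seteqP; split => t /=.
  by move=> [_ h] k _; have := h ord0 k; rewrite mxE.
by move=> h; split => // i k; rewrite ord1 mxE; exact: h.
Qed.

(** The balls of rational centre and radius [k.+1%:R^-1] that lie in [U] are countably many and
    cover it. *)
Lemma borel_open n (U : set 'rV[R]_n) : open U -> borel_rV U.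
Proof.
move=> oU; pose I := ('rV[rat]_n * nat)%type.
pose B (p : I) := ball (map_mx ratr p.1 : 'rV[R]_n) p.2.+1%:R^-1.
pose F (p : I) : set 'rV[R]_n := if pselect (B p `<=` U) then B p else set0.
have -> : U = \bigcup_(p in [set: I]) F p.
  apply/seteqP; split => [x Ux|x [p _]]; last first.
    by rewrite /F; case: pselect => /= [h|_] px; [exact: h|exfalso].
  have /nbhs_ballP[e /= e0 xU] : nbhs x U by rewrite nbhsE; exists U.
  have [k ke] : exists k, k.+1%:R^-1 < e / 2 :> R.
    have := near_infty_natSinv_lt (PosNum (divr_gt0 e0 (ltr0Sn _ 1))).
    by case=> k _ /(_ k (leqnn _)) /= ?; exists k.
  have hq j : exists q : rat, `|x ord0 j - ratr q| < k.+1%:R^-1.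
    have := @dense_rat R (ball (x ord0 j) k.+1%:R^-1).
    case; first by exists (x ord0 j); exact: ballxx.
      exact: ball_open.
    by move=> y [+ [q _ qy]]; rewrite -qy => h; exists q.
  pose q := \row_j sval (cid (hq j)).
  have xq : B (q, k) x.
    split => // i j; rewrite ord1 !mxE /ball /= distrC.
    by case: cid.
  exists (q, k) => //; rewrite /F; case: pselect => //= -[] y qy.
  apply: xU; rewrite [e]splitr; apply: (@ball_triangle _ _ (map_mx ratr q : 'rV[R]_n)).
    by apply: ball_sym; apply: le_ball xq; exact: ltW.
  by apply: le_ball qy; exact: ltW.
rewrite /borel_rV preimage_bigcup; apply: countable_bigcupT_measurable.
  exact: countableP.
move=> p; rewrite /F; case: pselect => /= _; last by rewrite preimage_set0; exact: measurable0.
exact: borel_ball.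
Qed.

Lemma borel_closed n (U : set 'rV[R]_n) : closed U -> borel_rV U.
Proof.
move=> /closed_openC/borel_open/measurableC.
by rewrite /borel_rV -preimage_setC setCK.
Qed.

Lemma vol_box n (a b : R) : a <= b ->
  vol [set x : 'rV[R]_n | forall k, a <= x ord0 k <= b] = ((b - a) ^+ n)%:E.
Proof.
move=> ab; rewrite /vol.
rewrite (_ : _ @^-1` _ = [set t | forall k, `[a, b]%classic (tnth t k)]); last first.
  by apply/seteqP; split => t /= h k; have := h k; rewrite mxE /= in_itv.
rewrite (@lebesgue_tuple_box R n (fun=> `[a, b]%classic)); last first.
  by move=> k; exact: measurable_itv.
rewrite (eq_bigr (fun=> (b - a)%:E)); last first.
  move=> k _; rewrite lebesgue_measure_itv/= lte_fin.
  case: ltP => // ba; have -> : a = b by lra.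
  by rewrite subrr.
by rewrite prodEFin prodr_const card_ord.
Qed.

End borel.


Section measurable_rV.
Context {R : realType} d (T : measurableType d).
Local Notation mR := (measurableTypeR R).

Definition measurable_rV n (f : T -> 'rV[R]_n) :=
  forall k, measurable_fun setT (fun t => f t ord0 k : mR).

Lemma measurable_tuple_of_rv n (f : T -> 'rV[R]_n) :
  measurable_rV f -> measurable_fun setT (fun t => tuple_of_rv (f t)).
Proof.
move=> mf; apply/measurable_fun_tnthP => k.
by rewrite (_ : _ \o _ = fun t => f t ord0 k)//; apply/funext => t /=; rewrite tnth_mktuple.
Qed.

Lemma measurable_rV_preimage n (f : T -> 'rV[R]_n) A :
  measurable_rV f -> borel_rV A -> measurable (f @^-1` A).
Proof.
move=> mf mA; rewrite -[X in measurable X]setTI.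
have := measurable_tuple_of_rv mf measurableT mA.
rewrite (_ : _ @^-1` _ = f @^-1` A)//.
by apply/seteqP; split => t /=; rewrite tuple_of_rvK.
Qed.

Lemma measurable_rV_cst n (c : 'rV[R]_n) : measurable_rV (fun=> c).
Proof. by move=> k; exact: measurable_cst. Qed.

Lemma measurable_rVD n (f g : T -> 'rV[R]_n) :
  measurable_rV f -> measurable_rV g -> measurable_rV (fun t => f t + g t).
Proof.
move=> mf mg k; rewrite (_ : (fun t => _) = (fun t => f t ord0 k + g t ord0 k)).
  by apply: measurable_funD; [exact: mf|exact: mg].
by apply/funext => t; rewrite mxE.
Qed.

Lemma measurable_rVZ n (a : T -> R) (f : T -> 'rV[R]_n) :
  measurable_fun setT (a : T -> mR) -> measurable_rV f ->
  measurable_rV (fun t => a t *: f t).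
Proof.
move=> ma mf k; rewrite (_ : (fun t => _) = (fun t => a t * f t ord0 k)).
  by apply: measurable_funM => //; exact: mf.
by apply/funext => t; rewrite mxE.
Qed.

Lemma measurable_rVN n (f : T -> 'rV[R]_n) :
  measurable_rV f -> measurable_rV (fun t => - f t).
Proof.
move=> mf; rewrite (_ : (fun t => _) = (fun t => -1 *: f t)).
  by apply: measurable_rVZ => //; exact: measurable_cst.
by apply/funext => t; rewrite scaleN1r.
Qed.

Lemma measurable_rVM m n (f : T -> 'rV[R]_m) (M : 'M[R]_(m, n)) :
  measurable_rV f -> measurable_rV (fun t => f t *m M).
Proof.
move=> mf k; rewrite (_ : (fun t => _) = (fun t => \sum_j f t ord0 j * M j k)).
  by apply: measurable_sum => j; apply: measurable_funM => //; exact: mf.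
by apply/funext => t; rewrite mxE.
Qed.

Lemma measurable_rV_tuple n (f : T -> n.-tuple mR) :
  measurable_fun setT f -> measurable_rV (fun t => rv_of_tuple (f t)).
Proof.
move=> /measurable_fun_tnthP mf k.
rewrite (_ : (fun t => _) = (fun t => tnth (f t) k)); first exact: mf.
by apply/funext => t; rewrite mxE.
Qed.

End measurable_rV.

Section translation.
Context {R : realType}.
Local Notation mR := (measurableTypeR R).

Lemma borel_preimage m n (f : 'rV[R]_m -> 'rV[R]_n) A :
  measurable_rV (fun t : m.-tuple mR => f (rv_of_tuple t)) ->
  borel_rV A -> borel_rV (f @^-1` A).
Proof. exact: measurable_rV_preimage. Qed.

Lemma lebesgue_measure_shift (c : R) (A : set mR) : measurable A ->
  lebesgue_measure ((fun x => x + c) @^-1` A) = lebesgue_measure A.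
Proof.
move=> mA; have mf : measurable_fun setT (fun x : mR => x + c : mR).
  exact: measurable_funD.
apply/esym; pose mu' := pushforward (@lebesgue_measure R) (fun x : mR => x + c : mR).
apply: (lebesgue_measure_unique (mu := mu')) => //= X [[a b] /= ab <-].
rewrite /mu' /pushforward (_ : _ @^-1` _ = `]a - c, b - c]%classic); last first.
  apply/seteqP; split => x /=; rewrite !in_itv/=; lra.
rewrite [LHS]lebesgue_measure_itv [RHS]lebesgue_measure_itv/= !lte_fin.
rewrite (_ : (a - c < b - c) = (a < b)); last by apply/idP/idP; lra.
by case: ifP => // _; rewrite -!EFinB; congr EFin; lra.
Qed.

Lemma vol0E (A : set 'rV[R]_0) : vol A = (\1_A (0 : 'rV[R]_0))%:E.
Proof.
rewrite /vol /= diracE indicE; congr (_%:R%:E); congr nat_of_bool.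
apply/idP/idP; rewrite !inE /=; by rewrite (_ : rv_of_tuple _ = 0)//; apply/rowP => -[].
Qed.

(** Induction on the dimension: through [tcons] a translation acts on each factor separately, so the
    translated measure agrees with the product measure on rectangles, and these determine it. *)
Lemma vol_translate n (c : 'rV[R]_n) A : borel_rV A ->
  vol [set x | A (x + c)] = vol A.
Proof.
elim: n => [|n IHn] in c A *.
  by move=> _; rewrite !vol0E !indicE (_ : c = 0)//; [congr (_ \in _)%:R%:E; apply/funext => x /=; rewrite addr0|apply/rowP => -[]].
move=> mA.
pose c' : 'rV[R]_n := \row_k c ord0 (lift ord0 k).
pose sh (p : mR * n.-tuple mR) : mR * n.-tuple mR :=
  (p.1 + c ord0 ord0 : mR, tuple_of_rv (rv_of_tuple p.2 + c')).
have msh : measurable_fun setT sh.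
  apply: measurable_fun_pair; first exact: measurable_funD.
  apply: measurable_tuple_of_rv; apply: measurable_rVD.
    by apply: measurable_rV_tuple; exact: measurable_snd.
  exact: measurable_rV_cst.
have mt : measurable ((@tcons R n) @^-1` (@rv_of_tuple R n.+1 @^-1` A)).
  by rewrite -[X in measurable X]setTI; apply: measurable_tcons.
rewrite /vol /= /lebesgue_step /pushforward.
transitivity (pushforward (lebesgue_measure \x lebesgue_tuple n)%E sh
   (@tcons R n @^-1` (@rv_of_tuple R n.+1 @^-1` A))).
  rewrite /pushforward; congr product_measure1; apply/seteqP; split => -[x t] /=;
  congr A; apply/rowP => k; rewrite !mxE; case: (unliftP ord0 k) => [j|] ->;
  by rewrite /tcons ?tnthS ?tnth0 /= ?tnth_mktuple ?mxE.
apply/esym/product_measure_unique => // A1 A2 mA1 mA2.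
rewrite [LHS]/= /pushforward.
rewrite (_ : sh @^-1` _ = ((fun x => x + c ord0 ord0) @^-1` A1) `*`
   ((fun t => tuple_of_rv (rv_of_tuple t + c')) @^-1` A2)); last first.
  by apply/seteqP; split => -[x t].
have mA2' : borel_rV ((@tuple_of_rv R n) @^-1` A2).
  by rewrite /borel_rV (_ : _ @^-1` _ = A2)//; apply/seteqP; split => t /=; rewrite rv_of_tupleK.
rewrite product_measure1E; first last.
- rewrite -[X in measurable X]setTI; apply: measurable_tuple_of_rv => //.
  apply: measurable_rVD; last exact: measurable_rV_cst.
  by apply: measurable_rV_tuple; exact: measurable_id.
- by rewrite -[X in measurable X]setTI; apply: measurable_funD.
congr (_ * _)%E; first exact: lebesgue_measure_shift.
have := IHn c' _ mA2'; rewrite /vol => e; rewrite [LHS]e.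
by congr (lebesgue_tuple n _); apply/seteqP; split => t /=; rewrite rv_of_tupleK.
Qed.

End translation.

Section product_measure_swap.
Context {R : realType} d1 d2 (T1 : measurableType d1) (T2 : measurableType d2).

(** Tonelli for sets: both orders of integration give measures with the same values on
    rectangles. *)
Lemma product_measure1_ysection (m1 : {sigma_finite_measure set T1 -> \bar R})
    (m2 : {sigma_finite_measure set T2 -> \bar R}) (X : set (T1 * T2)) : measurable X ->
  ((m1 \x m2) X = \int[m2]_z (m1 \o ysection X) z)%E.
Proof.
move=> mX; rewrite -[RHS]/((m1 \x^ m2) X)%E.
by apply: product_measure_unique => //= A1 A2 mA1 mA2; exact: product_measure2E.
Qed.

End product_measure_swap.

Section product_sigma_finite.
Context {R : realType} d1 d2 (T1 : measurableType d1) (T2 : measurableType d2).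
Variables (m1 : {sigma_finite_measure set T1 -> \bar R})
  (m2 : {sigma_finite_measure set T2 -> \bar R}).

(* The library's sigma-finite instance on [m1 \x m2] is shadowed by the one for
   probability measures; the alias gives it a key of its own. *)
Definition product_sigma_finite : set (T1 * T2) -> \bar R := (m1 \x m2)%E.

HB.instance Definition _ := Measure.on product_sigma_finite.
HB.instance Definition _ :=
  lebesgue_integral_fubini.measure_function_Measure_isSigmaFinite__to__measure_function_isSFinite m1 m2
  : isSFinite _ _ _ product_sigma_finite.
HB.instance Definition _ :=
  lebesgue_integral_fubini.measure_function_Measure_isSigmaFinite__to__measure_function_isSigmaFinite m1 m2
  : isSigmaFinite _ _ _ product_sigma_finite.

End product_sigma_finite.

Lemma mule_pcancel {R : realType} (r : R) (a b : \bar R) : 0 < r ->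
  (r%:E * a = r%:E * b)%E -> a = b.
Proof.
move=> r0 e; rewrite -[a]mul1e -[b]mul1e -(mulVf (lt0r_neq0 r0)) EFinM -!muleA.
by rewrite e.
Qed.

(** * Uniqueness of translation-invariant measures *)

Section haar.
Context {R : realType} d (Z : measurableType d) (nu : {sigma_finite_measure set Z -> \bar R}).
Local Notation mR := (measurableTypeR R).
Variables (n : nat) (Q : Z -> 'rV[R]_n).
Hypothesis mQ : measurable_rV Q.
(** The image of [nu] under [Q] is translation invariant. With [Z] abstract, [Q] can be a dilation
    of tuples in [vol_scale] and a map from a product of tuple spaces in [vol_split_up_to_scale]. *)
Hypothesis nuQ : forall c B, borel_rV B ->
  nu [set z | B (Q z + c)] = nu [set z | B (Q z)].

(* Evaluate the measure of {(x, z) | x in A, x + Q z in B} in both orders. *)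
Lemma haar_unique (A B : set 'rV[R]_n) : borel_rV A -> borel_rV B ->
  (forall x, A x -> A (- x)) ->
  (vol A * nu (Q @^-1` B) = vol B * nu (Q @^-1` A))%E.
Proof.
move=> mA mB sA.
pose T := (n.-tuple mR)%type.
pose S : set (T * Z) := [set p | A (rv_of_tuple p.1) /\ B (rv_of_tuple p.1 + Q p.2)].
have mfst : measurable_rV (fun p : T * Z => rv_of_tuple p.1).
  by apply: measurable_rV_tuple; exact: measurable_fst.
have mQs : measurable_rV (fun p : T * Z => Q p.2).
  move=> k; rewrite (_ : (fun t => _) = (fun z => Q z ord0 k) \o snd)//.
  by apply: measurableT_comp => //; exact: mQ.
have mS : measurable S.
  rewrite (_ : S = [set p | A (rv_of_tuple p.1)] `&` [set p | B (rv_of_tuple p.1 + Q p.2)]); last by apply/seteqP; split.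
  apply: measurableI; first exact: (measurable_rV_preimage mfst mA).
  exact: (measurable_rV_preimage (measurable_rVD mfst mQs) mB).
pose S' : set (T * Z) := [set p | B (rv_of_tuple p.1) /\ A (rv_of_tuple p.1 - Q p.2)].
have mS' : measurable S'.
  rewrite (_ : S' = [set p | B (rv_of_tuple p.1)] `&` [set p | A (rv_of_tuple p.1 - Q p.2)]); last by apply/seteqP; split.
  apply: measurableI; first exact: (measurable_rV_preimage mfst mB).
  exact: (measurable_rV_preimage (measurable_rVD mfst (measurable_rVN mQs)) mA).
have cst (E : set T) (v : \bar R) : measurable E -> (0 <= v)%E ->
    (\int[lebesgue_tuple n]_x (v * (\1_E x)%:E) = v * lebesgue_tuple n E)%E.
  move=> mE v0; rewrite ge0_integralZl//; last by apply/measurable_EFinP.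
  by rewrite integral_indic// setIT.
have e1 : ((lebesgue_tuple n \x nu) S = vol A * nu (Q @^-1` B))%E.
  rewrite muleC -cst//; apply: eq_integral => x _ /=.
  rewrite indicE; have [Ax|Ax] := pselect (A (rv_of_tuple x)).
    rewrite mem_set// mule1 -(nuQ (rv_of_tuple x) mB); congr (nu _).
    apply/seteqP; split => z; rewrite /xsection /= inE /= addrC; first by case.
    by [].
  rewrite memNset// mule0 (_ : xsection _ _ = set0) ?measure0//.
  by apply/seteqP; split => z; rewrite /xsection /= inE /= => -[].
have e2 : ((lebesgue_tuple n \x nu) S' = vol B * nu (Q @^-1` A))%E.
  rewrite muleC -cst//; apply: eq_integral => x _ /=.
  rewrite indicE; have [Bx|Bx] := pselect (B (rv_of_tuple x)).
    rewrite mem_set// mule1 -(nuQ (- rv_of_tuple x) mA); congr (nu _).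
    apply/seteqP; split => z; rewrite /xsection /= inE /=.
      by move=> [_ /sA]; rewrite opprB.
    by move=> /sA; rewrite opprB => ?; split => //; rewrite addrC -opprB opprK addrC.
  rewrite memNset// mule0 (_ : xsection _ _ = set0) ?measure0//.
  by apply/seteqP; split => z; rewrite /xsection /= inE /= => -[].
rewrite -e1 -e2.
rewrite (product_measure1_ysection _ _ mS) (product_measure1_ysection _ _ mS').
apply: eq_integral => z _ /=.
transitivity (vol [set x | A x /\ B (x + Q z)]).
  by congr (lebesgue_tuple n _); apply/seteqP; split => x; rewrite /ysection /= inE.
rewrite -(@vol_translate R n (- Q z)); last first.
  rewrite /borel_rV (_ : _ @^-1` _ = ysection S z); first exact: measurable_ysection.
  by apply/seteqP; split => x; rewrite /ysection /= inE.
congr (lebesgue_tuple n _); apply/seteqP; split => x; rewrite /ysection /= inE /=.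
  by rewrite subrK => -[].
by rewrite subrK => -[].
Qed.

End haar.

Section scaling.
Context {R : realType}.
Local Notation mR := (measurableTypeR R).

Lemma borel_box n (a b : R) : borel_rV [set x : 'rV[R]_n | forall k, a <= x ord0 k <= b].
Proof.
rewrite /borel_rV (_ : _ @^-1` _ =
  \bigcap_(k in [set: 'I_n]) (@tnth n mR ^~ k @^-1` `[a, b]%classic)).
  apply: fin_bigcap_measurable => // k _; rewrite -[X in measurable X]setTI.
  by apply: measurable_tnth.
apply/seteqP; split => t /=.
  by move=> h k _ /=; have := h k; rewrite mxE in_itv.
by move=> h k; have := h k I; rewrite mxE /= in_itv.
Qed.

Lemma measurable_rV_id n : measurable_rV (@rv_of_tuple R n).
Proof. by apply: measurable_rV_tuple; exact: measurable_id. Qed.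

Lemma borel_scale n (th : R) (A : set 'rV[R]_n) : borel_rV A -> borel_rV [set x | A (th *: x)].
Proof.
by apply: borel_preimage; apply: measurable_rVZ; [exact: measurable_cst|exact: measurable_rV_id].
Qed.

Lemma borel_translate n c (A : set 'rV[R]_n) : borel_rV A -> borel_rV [set x | A (x + c)].
Proof.
by apply: borel_preimage; apply: measurable_rVD; [exact: measurable_rV_id|exact: measurable_rV_cst].
Qed.

(** The volume of the dilated set is translation invariant in [A], hence proportional to [vol A] by
    [haar_unique]; the symmetric cube [B] of side 2 fixes the factor. *)
Lemma vol_scale n (th : R) (A : set 'rV[R]_n) : 0 < th -> borel_rV A ->
  vol [set x | A (th^-1 *: x)] = ((th ^+ n)%:E * vol A)%E.
Proof.
move=> th0 mA.
pose B := [set x : 'rV[R]_n | forall k, - 1 <= x ord0 k <= 1].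
pose Q (t : n.-tuple mR) := th^-1 *: rv_of_tuple t.
have mQ : measurable_rV Q.
  by apply: measurable_rVZ; [exact: measurable_cst|exact: measurable_rV_id].
have := @haar_unique R _ _ (lebesgue_tuple n) n Q mQ _ B A (borel_box _ _) mA.
rewrite /B vol_box; last lra.
rewrite (_ : lebesgue_tuple n (Q @^-1` B) = ((th - - th) ^+ n)%:E); last first.
  rewrite -vol_box; last lra.
  congr (lebesgue_tuple n _); apply/seteqP; split => t /= h k; have := h k; rewrite !mxE.
    by rewrite mulrC ler_pdivlMr// mulN1r ler_pdivrMr// mul1r.
  by rewrite mulrC ler_pdivlMr// mulN1r ler_pdivrMr// mul1r.
move=> e; have {}e := e _ _.
rewrite (_ : th - - th = (1 - -1) * th) in e; last lra.
rewrite exprMn EFinM muleCA in e.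
apply: (@mule_pcancel _ ((1 - -1) ^+ n)); first by rewrite exprn_gt0//; lra.
- rewrite [LHS]e.
  + by rewrite (muleC (vol A)).
  + move=> c C mC; have := @vol_translate R n (th *: c) [set x | C (th^-1 *: x)].
    rewrite /vol => <-; last exact: borel_scale.
    congr (lebesgue_tuple n _); apply/seteqP; split => t /=;
      by rewrite scalerDr scalerA mulVf ?scale1r// gt_eqF.
  + move=> x h k; have := h k; rewrite mxE; lra.
Qed.

End scaling.


(** * Splitting the volume along orthonormal bases *)

Section split.
Context {R : realType}.
Local Notation mR := (measurableTypeR R).

Lemma measurable_rV_pair i m n (E1 : 'M[R]_(i, n)) (E2 : 'M[R]_(m, n)) :
  measurable_rV (fun p : i.-tuple mR * m.-tuple mR =>
    rv_of_tuple p.1 *m E1 + rv_of_tuple p.2 *m E2).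
Proof.
apply: measurable_rVD; apply: measurable_rVM; apply: measurable_rV_tuple.
  exact: measurable_fst.
exact: measurable_snd.
Qed.

(** Translate by [c2] inside the sections over the first factor, then exchange the order of
    integration and translate by [c1]. *)
Lemma product_translate i m n (E1 : 'M[R]_(i, n)) (E2 : 'M[R]_(m, n)) c1 c2
    (B : set 'rV[R]_n) : borel_rV B ->
  (lebesgue_tuple i \x lebesgue_tuple m)%E
    [set p | B (rv_of_tuple p.1 *m E1 + rv_of_tuple p.2 *m E2 + (c1 *m E1 + c2 *m E2))] =
  (lebesgue_tuple i \x lebesgue_tuple m)%E
    [set p | B (rv_of_tuple p.1 *m E1 + rv_of_tuple p.2 *m E2)].
Proof.
move=> mB; pose Q (p : i.-tuple mR * m.-tuple mR) :=
  rv_of_tuple p.1 *m E1 + rv_of_tuple p.2 *m E2.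
have mQ : measurable_rV Q by exact: measurable_rV_pair.
have mQc c : measurable [set p | B (Q p + c)].
  apply: (measurable_rV_preimage (f := fun p => Q p + c)) => //.
  by apply: measurable_rVD => //; exact: measurable_rV_cst.
have mQ0 : measurable [set p | B (Q p)] by exact: (measurable_rV_preimage (f := Q)).
transitivity ((lebesgue_tuple i \x lebesgue_tuple m)%E [set p | B (Q p + c1 *m E1)]).
  apply: eq_integral => t _ /=.
  have := @vol_translate R m c2
    [set u | B (rv_of_tuple t *m E1 + u *m E2 + c1 *m E1)].
  rewrite /vol => h; rewrite [RHS](_ : _ = lebesgue_tuple m (rv_of_tuple @^-1`
    [set u | B (rv_of_tuple t *m E1 + u *m E2 + c1 *m E1)])).
    rewrite -h; last first.
      rewrite /borel_rV (_ : _ @^-1` _ = xsection [set p | B (Q p + c1 *m E1)] t).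
        exact: measurable_xsection.
      by apply/seteqP; split => x; rewrite /xsection /= inE.
    congr (lebesgue_tuple m _); apply/seteqP; split => x; rewrite /xsection /= inE /=;
      by rewrite mulmxDl (addrC (c1 *m E1)) !addrA.
  by congr (lebesgue_tuple m _); apply/seteqP; split => x; rewrite /xsection /= inE.
rewrite (product_measure1_ysection _ _ (mQc _)) (product_measure1_ysection _ _ mQ0).
apply: eq_integral => u _ /=.
have := @vol_translate R i c1 [set t | B (t *m E1 + rv_of_tuple u *m E2)].
rewrite /vol => h; rewrite [RHS](_ : _ = lebesgue_tuple i (rv_of_tuple @^-1`
    [set t | B (t *m E1 + rv_of_tuple u *m E2)])).
  rewrite -h; last first.
    rewrite /borel_rV (_ : _ @^-1` _ = ysection [set p | B (Q p)] u).
      exact: measurable_ysection.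
    by apply/seteqP; split => x; rewrite /ysection /= inE.
  congr (lebesgue_tuple i _); apply/seteqP; split => x; rewrite /ysection /= inE /= /Q /=;
    by rewrite mulmxDl addrAC.
by congr (lebesgue_tuple i _); apply/seteqP; split => x; rewrite /ysection /= inE.
Qed.

(** Since the rows of [E1] and [E2] span, every translation of R^n comes from one of the
    coordinates, and [haar_unique] applies. The set [A] is left free so that it can be chosen to
    reveal the factor. *)
Lemma vol_split_up_to_scale i m n (E1 : 'M[R]_(i, n)) (E2 : 'M[R]_(m, n))
    (A B : set 'rV[R]_n) : (col_mx E1 E2 :=: 1%:M)%MS ->
  borel_rV A -> borel_rV B -> (forall x, A x -> A (- x)) ->
  let nu C := (lebesgue_tuple i \x lebesgue_tuple m)%E
    [set p | C (rv_of_tuple p.1 *m E1 + rv_of_tuple p.2 *m E2)] in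
  (vol A * nu B = vol B * nu A)%E.
Proof.
move=> EE mA mB sA.
move=> nu; have := @haar_unique R _ (i.-tuple mR * m.-tuple mR)%type
  (product_sigma_finite (lebesgue_tuple i) (lebesgue_tuple m)) n (fun p => rv_of_tuple p.1 *m E1 + rv_of_tuple p.2 *m E2).
apply => //; first exact: measurable_rV_pair.
move=> c C mC.
have /submxP[D cD] : (c <= col_mx E1 E2)%MS by rewrite EE submx1.
rewrite cD -[D]hsubmxK mul_row_col; exact: product_translate.
Qed.

(** The coordinate splitting, where a cube is again a product of cubes and shows the factor to be 1.
    It is used in [vol_split] to recognise the ball in block coordinates. *)
Lemma vol_row_mx i m (A : set 'rV[R]_(i + m)) : borel_rV A ->
  vol A = (lebesgue_tuple i \x lebesgue_tuple m)%E
     [set p | A (row_mx (rv_of_tuple p.1) (rv_of_tuple p.2))].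
Proof.
move=> mA.
pose E1 : 'M[R]_(i, i + m) := row_mx 1%:M 0.
pose E2 : 'M[R]_(m, i + m) := row_mx 0 1%:M.
have EE : (col_mx E1 E2 :=: 1%:M)%MS.
  by rewrite /E1 /E2 -block_mxEv -scalar_mx_block.
have QE t u : t *m E1 + u *m E2 = row_mx t u.
  by rewrite /E1 /E2 !mul_mx_row !mulmx1 !mulmx0 add_row_mx addr0 add0r.
pose B := [set x : 'rV[R]_(i + m) | forall k, - 1 <= x ord0 k <= 1].
have := vol_split_up_to_scale EE (@borel_box R _ (-1) 1) mA.
rewrite /= vol_box; last lra.
rewrite [X in (vol A * X)%E](_ : _ = ((1 - -1) ^+ (i + m))%:E); last first.
  rewrite (_ : [set p | _] = (rv_of_tuple @^-1` [set x : 'rV[R]_i | forall k, - 1 <= x ord0 k <= 1]) `*`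
    (rv_of_tuple @^-1` [set x : 'rV[R]_m | forall k, - 1 <= x ord0 k <= 1])).
    rewrite product_measure1E; [|exact: borel_box|exact: borel_box].
    rewrite exprD EFinM; congr (_ * _)%E; apply: (@vol_box R _ (-1) 1); lra.
  apply/seteqP; split => -[t u] /=; rewrite QE.
    by move=> h; split => k; [have := h (lshift m k)|have := h (rshift i k)];
      rewrite ?row_mxEl ?row_mxEr.
  by move=> [h1 h2] k; case: (split_ordP k) => j ->; rewrite ?row_mxEl ?row_mxEr.
rewrite (_ : [set p | A _] = [set p | A (row_mx (rv_of_tuple p.1) (rv_of_tuple p.2))]); last first.
  by apply/seteqP; split => p /=; rewrite QE.
move=> e; apply: (@mule_pcancel _ ((1 - -1) ^+ (i + m))); first by rewrite exprn_gt0//; lra.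
rewrite e; first by rewrite muleC.
by move=> x h k; have := h k; rewrite mxE; lra.
Qed.

(** The calibrating set for [vol_split]: orthonormal coordinates preserve it. It only has to have
    positive finite volume, so its volume is not computed. *)
Definition euclid_ball (n : nat) : set 'rV[R]_n := [set x | (x *m x^T) ord0 ord0 <= 1].

Arguments euclid_ball : clear implicits.

Lemma borel_euclid_ball n : borel_rV (euclid_ball n).
Proof.
have mf : measurable_fun setT (fun t : n.-tuple mR => \sum_k tnth t k * tnth t k : mR).
  by apply: measurable_sum => j; apply: measurable_funM => //; exact: measurable_tnth.
rewrite /borel_rV (_ : _ @^-1` _ = (fun t : n.-tuple mR => \sum_k tnth t k * tnth t k) @^-1` `]-oo, 1]%classic).
  by rewrite -[X in measurable X]setTI; apply: mf => //; exact: measurable_itv.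
apply/seteqP; split => t /=; rewrite in_itv /= /euclid_ball /= mxE.
    by rewrite [leLHS](_ : _ = \sum_k tnth t k * tnth t k)//; apply: eq_bigr => k _; rewrite !mxE.
by apply: le_trans; apply: ler_sum => k _; rewrite !mxE.
Qed.

(** The ball lies between the cubes of half-side [n.+1%:R^-1] and 1; in the inner cube each squared
    coordinate is at most [n.+1%:R^-1], so the [n] of them sum to at most 1. *)
Lemma vol_euclid_ball n : exists2 r : R, 0 < r & vol (euclid_ball n) = r%:E.
Proof.
have bE (x : 'rV[R]_n) : (x *m x^T) ord0 ord0 = \sum_k x ord0 k ^+ 2.
  by rewrite mxE; apply: eq_bigr => k _; rewrite mxE expr2.
have up : (vol (euclid_ball n) <= ((1 - -1) ^+ n)%:E)%E.
  rewrite -vol_box; last lra.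
  apply: le_measure; rewrite ?inE; [exact: borel_euclid_ball|exact: borel_box|].
  move=> t; rewrite /euclid_ball /= bE => h k; rewrite -ler_norml -(@expr_le1 _ 2)// real_normK ?num_real//.
  by apply: le_trans h; rewrite (bigD1 k)//= lerDl sumr_ge0// => j _; rewrite sqr_ge0.
have lo : (((n.+1%:R^-1 - - n.+1%:R^-1) ^+ n)%:E <= vol (euclid_ball n))%E.
  rewrite -vol_box; last by rewrite (@le_trans _ _ 0)// oppr_le0 invr_ge0.
  apply: le_measure; rewrite ?inE; [exact: borel_box|exact: borel_euclid_ball|].
  move=> t h; rewrite /euclid_ball /= bE.
  apply: (@le_trans _ _ (\sum_(k < n) n.+1%:R^-1)).
    apply: ler_sum => k _; have := h k; rewrite -ler_norml => hk.
    rewrite -real_normK ?num_real// expr2.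
    apply: (@le_trans _ _ (n.+1%:R^-1 * 1)); last by rewrite mulr1.
    apply: ler_pM => //; apply: (le_trans hk).
    by rewrite invf_le1// ler1n.
  rewrite sumr_const card_ord -[leLHS]mulr_natr ler_pdivrMl// mulr1 ler_nat//.
have fin : vol (euclid_ball n) \is a fin_num.
  by rewrite ge0_fin_numE ?measure_ge0//; apply: le_lt_trans up _; rewrite ltry.
exists (fine (vol (euclid_ball n))); last by rewrite fineK.
rewrite -lte_fin fineK//; apply: lt_le_trans lo.
by rewrite lte_fin exprn_gt0// opprK addr_gt0// invr_gt0.
Qed.

(** The unit ball is carried to itself, so the factor left open by [vol_split_up_to_scale] equals
    1. *)
Lemma vol_split i m n (E1 : 'M[R]_(i, n)) (E2 : 'M[R]_(m, n)) (A : set 'rV[R]_n) :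
  (i + m)%N = n -> E1 *m E1^T = 1%:M -> E2 *m E2^T = 1%:M -> E1 *m E2^T = 0 ->
  borel_rV A ->
  vol A = (lebesgue_tuple i \x lebesgue_tuple m)%E
    [set p | A (rv_of_tuple p.1 *m E1 + rv_of_tuple p.2 *m E2)].
Proof.
move=> nE; case: n / nE in E1 E2 A * => E11 E22 E12 mA.
have E21 : E2 *m E1^T = 0 by apply: trmx_inj; rewrite trmx_mul trmxK E12 trmx0.
have CC : col_mx E1 E2 *m (col_mx E1 E2)^T = 1%:M.
  by rewrite tr_col_mx mul_col_row E11 E22 E12 E21 -scalar_mx_block.
have EE : (col_mx E1 E2 :=: 1%:M)%MS.
  apply/eqmxP; rewrite submx1 /=; apply/submxP.
  by exists (col_mx E1 E2)^T; rewrite (mulmx1C CC).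
have /= := vol_split_up_to_scale EE (@borel_euclid_ball _) mA.
rewrite [X in (vol A * X)%E](_ : _ = vol (euclid_ball (i + m))); last first.
  rewrite vol_row_mx; last exact: borel_euclid_ball.
  congr product_measure1; apply/seteqP; split => -[t u] /=; rewrite /euclid_ball /= -mul_row_col trmx_mul;
  by rewrite mulmxA -(mulmxA (row_mx _ _)) CC mulmx1.
have [r r0 ->] := vol_euclid_ball (i + m).
move=> e; apply: (mule_pcancel r0); rewrite e; first by rewrite muleC.
by move=> x; rewrite /euclid_ball /= linearN /= mulmxN mulNmx opprK.
Qed.

End split.

(** * Convex sets *)

Section convex_topology.
Context {R : realType} {n : nat}.
Local Notation V := 'rV[R]_n.
Implicit Types (A B : set V) (x y z : V) (l r e : R).

Lemma interior_normP A x :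
  A° x <-> exists2 r, 0 < r & forall y, `|x - y| < r -> A y.
Proof.
split.
  move=> /nbhs_ballP[r /= r0 h]; exists r => // y xy; apply: h.
  by rewrite -ball_normE.
by move=> [r r0 h]; apply/nbhs_ballP; exists r => // y; rewrite -ball_normE; exact: h.
Qed.

Lemma closure_normP A x :
  closure A x <-> forall e, 0 < e -> exists2 y, A y & `|x - y| < e.
Proof.
split.
  move=> h e e0; have [y []] := h (ball x e) (nbhsx_ballx x e e0).
  by rewrite -ball_normE /= => Ay xy; exists y.
move=> h U /nbhs_ballP[r /= r0 rU]; have [y Ay xy] := h _ r0.
by exists y; split => //; apply: rU; rewrite -ball_normE.
Qed.

Definition segment_closed A :=
  forall x y l, 0 <= l <= 1 -> A x -> A y -> A ((1 - l) *: x + l *: y).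

Lemma convex_setP A : convex_set A <-> segment_closed A.
Proof.
split.
  move=> cA x y l l01 Ax Ay.
  have := cA y x (Itv01 (proj1 (andP l01)) (proj2 (andP l01))).
  by rewrite !inE addrC; apply.
move=> cA x y l; rewrite !inE => Ax Ay.
have := cA y x l%:num; rewrite addrC; apply => //.
by rewrite ge0 le1.
Qed.

Lemma segment_closedI A B : segment_closed A -> segment_closed B -> segment_closed (A `&` B).
Proof.
by move=> cA cB x y l l01 [Ax Bx] [Ay By]; split; [exact: cA|exact: cB].
Qed.

Lemma segment_closed_closure A : segment_closed A -> segment_closed (closure A).
Proof.
move=> cA x y l /andP[l0 l1] /closure_normP Ax /closure_normP Ay.
apply/closure_normP => e e0.
have [x' Ax' xx'] := Ax _ e0; have [y' Ay' yy'] := Ay _ e0.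
exists ((1 - l) *: x' + l *: y'); first by apply: cA => //; rewrite l0.
rewrite opprD addrACA -!scalerBr (le_lt_trans (ler_normD _ _))//.
rewrite !normrZ ger0_norm ?subr_ge0// ger0_norm//.
rewrite (_ : e = (1 - l) * e + l * e); last ring.
have [->|l'0] := eqVneq l 0; first by rewrite subr0 !mul1r !mul0r !addr0.
apply: ler_ltD; last by rewrite ltr_pM2l// lt_neqAle eq_sym l'0.
by apply: ler_wpM2l; [lra|exact: ltW].
Qed.

(** Replace [y] by a nearby [y'] in [A] and solve for the other endpoint of a segment through a
    given [w] near the combination. The errors from [w] and [y'] are each at most [e] and are
    magnified by [(1 - l)^-1]; the value of [e] keeps that endpoint in the ball about [x]. *)
Lemma interior_closure_segment A x y l : segment_closed A ->
  A° x -> closure A y -> 0 <= l < 1 -> A° ((1 - l) *: x + l *: y).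
Proof.
move=> cA /interior_normP[r r0 rA] /closure_normP yA /andP[l0 l1].
pose e := r * (1 - l) / 2.
have l10 : 0 < 1 - l by rewrite subr_gt0.
have e0 : 0 < e by rewrite divr_gt0// mulr_gt0.
have [y' Ay' yy'] := yA _ e0.
apply/interior_normP; exists e => // w wE.
rewrite (_ : w = (1 - l) *: ((1 - l)^-1 *: (w - l *: y')) + l *: y'); last first.
  by rewrite scalerA mulfV ?gt_eqF// scale1r subrK.
apply: cA => //; first by rewrite l0 ltW.
apply: rA.
rewrite (_ : x - _ = (1 - l)^-1 *: (((1 - l) *: x + l *: y - w) - l *: (y - y'))); last first.
  by apply/rowP => k; rewrite !mxE; field; rewrite gt_eqF.
rewrite normrZ ger0_norm ?invr_ge0 ?ltW// ltr_pdivrMl//.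
apply: (le_lt_trans (ler_normB _ _)); rewrite normrZ (ger0_norm l0).
have : l * `|y - y'| <= e.
  apply: le_trans (_ : 1 * `|y - y'| <= _); last by rewrite mul1r ltW.
  by apply: ler_wpM2r => //; exact: ltW.
rewrite /e in wE e0 *; lra.
Qed.

Lemma closure_interior_convex A : segment_closed A -> A° !=set0 ->
  closure A = closure A°.
Proof.
move=> cA [x Ax]; apply/seteqP; split => [y Ay|]; last first.
  by apply: closureS; exact: interior_subset.
apply/closure_normP => e e0.
pose t := Num.min (1 / 2) (e / (1 + `|y - x|)).
have d0 : 0 < 1 + `|y - x| by rewrite ltr_wpDr.
have t0 : 0 < t by rewrite lt_min divr_gt0//= divr_gt0.
have t1 : t <= 1 / 2 by rewrite /t ge_min lexx.
exists ((1 - (1 - t)) *: x + (1 - t) *: y).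
  by apply: interior_closure_segment => //; lra.
rewrite (_ : y - _ = t *: (y - x)); last first.
  by apply/rowP => k; rewrite !mxE; ring.
rewrite normrZ gtr0_norm//.
have : t <= e / (1 + `|y - x|) by rewrite /t ge_min lexx orbT.
rewrite ler_pdivlMr// => h; apply: lt_le_trans h.
by rewrite ltr_pM2l// ltrDr.
Qed.

(** From an interior point [x] of [A], continue the segment to [z] slightly beyond [z] while staying
    in the closure; then [z] is strictly between [x] and a point of the closure. *)
Lemma interior_closure_convex A : segment_closed A -> A° !=set0 ->
  (closure A)° = A°.
Proof.
move=> cA [x Ax]; apply/seteqP; split => [z|]; last first.
  by apply: interiorS; exact: subset_closure.
move=> /interior_normP[r r0 rA].
have d0 : 0 < 1 + `|z - x| by rewrite ltr_wpDr.
pose t := r / (1 + `|z - x|) / 2.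
have t0 : 0 < t by rewrite !divr_gt0.
have yA : closure A (z + t *: (z - x)).
  apply: rA; rewrite (_ : z - _ = - (t *: (z - x))); last first.
    by apply/rowP => k; rewrite !mxE; ring.
  rewrite normrN normrZ gtr0_norm// /t mulrAC ltr_pdivrMr// mulrAC ltr_pdivrMr//.
  by have := normr_ge0 (z - x); nra.
rewrite (_ : z = (1 - (1 + t)^-1) *: x + (1 + t)^-1 *: (z + t *: (z - x))).
  apply: interior_closure_segment => //.
  by rewrite invr_ge0 ltW ?addr_gt0//= invf_lt1 ?addr_gt0// ltrDl.
by apply/rowP => k; rewrite !mxE; field; rewrite gt_eqF// addr_gt0.
Qed.

End convex_topology.

Section rV_norm.
Context {R : realType} {n : nat}.
Implicit Types (x : 'rV[R]_n).

Lemma rV_normE x : `|x| = \big[Num.max/0]_ij `|x ij.1 ij.2|.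
Proof. exact: mx_normrE. Qed.

Lemma rV_norm_le x (M : R) : 0 <= M -> (forall k, `|x ord0 k| <= M) -> `|x| <= M.
Proof.
move=> M0 h; rewrite rV_normE; apply/bigmax_leP; split => // -[i k] _.
by rewrite ord1; exact: h.
Qed.

Lemma coord_le_norm x k : `|x ord0 k| <= `|x|.
Proof.
rewrite rV_normE.
exact: (le_bigmax _ (fun ij : 'I_1 * 'I_n => `|x ij.1 ij.2|) (ord0, k)).
Qed.

Lemma norm_eq_coord x : 0 < `|x| -> exists k, `|x| = `|x ord0 k|.
Proof.
move=> x0; have [|[i k] /= h] := @mx_norm_neq0 _ _ _ x; first by rewrite gt_eqF.
by exists k; rewrite ord1 in h.
Qed.

End rV_norm.

Lemma norm_mulmx {R : realType} m n (x : 'rV[R]_m) (M : 'M[R]_(m, n)) :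
  `|x *m M| <= `|x| * \sum_j \sum_k `|M j k|.
Proof.
apply: rV_norm_le => [|k].
  by rewrite mulr_ge0// sumr_ge0// => j _; rewrite sumr_ge0.
rewrite mxE (le_trans (ler_norm_sum _ _ _))// mulr_sumr; apply: ler_sum => j _.
rewrite normrM; apply: ler_pM => //; first exact: coord_le_norm.
by rewrite (bigD1 k)//= lerDl sumr_ge0.
Qed.

(** * Volumes of convex sets *)

Section convex_measure.
Context {R : realType} {n : nat}.
Local Notation V := 'rV[R]_n.
Implicit Types (A B : set V) (x y z : V) (l r e : R).

Lemma vol_open_gt0 A : open A -> A !=set0 -> (0 < vol A)%E.
Proof.
move=> oA [x Ax].
have /nbhs_ballP[r /= r0 rA] : nbhs x A by rewrite nbhsE; exists A.
pose B : set V := [set y | forall k, - (r / 2) <= y ord0 k <= r / 2].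
apply: (@lt_le_trans _ _ (vol [set y | B (y + (- x))])).
  rewrite vol_translate; last exact: borel_box.
  rewrite vol_box; last lra.
  by rewrite lte_fin exprn_gt0//; lra.
apply: le_measure; rewrite ?inE.
- by apply: borel_translate; exact: borel_box.
- exact: borel_open.
- move=> t /= h; apply: rA; split => // i k; rewrite ord1 /ball /=.
  by have := h k; rewrite !mxE -ler_norml distrC => /le_lt_trans; apply; lra.
Qed.

Lemma vol_le A B : borel_rV A -> borel_rV B -> A `<=` B -> (vol A <= vol B)%E.
Proof.
move=> mA mB AB; apply: le_measure; rewrite ?inE//.
by move=> t; exact: AB.
Qed.

Lemma exprn_near1 m (a b : R) : 0 < b -> a < b ->
  exists2 t0, 0 < t0 <= 1 & forall t, 0 <= t < t0 -> a < (1 - t) ^+ m * b.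
Proof.
move=> b0 ab.
have bern (t : R) : 0 <= t <= 1 -> 1 - m%:R * t <= (1 - t) ^+ m.
  move=> /andP[t0 t1]; elim: m => [|m IH]; first by rewrite mul0r subr0 expr0.
  rewrite exprS; apply: le_trans (_ : (1 - t) * (1 - m%:R * t) <= _); last first.
    by apply: ler_wpM2l => //; lra.
  rewrite -natr1; have : 0 <= m%:R :> R by []; nra.
(* Bernoulli's bound turns the goal into [m%:R * t * b < b - a]; [m.+1] in place of [m] keeps the
   denominator positive when [m] is 0. *)
pose t0 : R := Num.min 1 ((b - a) / (m.+1%:R * b)).
have d0 : 0 < m.+1%:R * b by rewrite mulr_gt0.
exists t0; first by rewrite lt_min ltr01 divr_gt0//= ?subr_gt0// ge_min lexx.
move=> t /andP[tge]; rewrite lt_min => /andP[t1]; rewrite ltr_pdivlMr// => tb.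
apply: (@lt_le_trans _ _ ((1 - m%:R * t) * b)).
  move: tb; rewrite -natr1; have : 0 <= m%:R :> R by []; nra.
by apply: ler_wpM2r; [exact: ltW|apply: bern; rewrite tge ltW].
Qed.

(** Lets [t] tend to 1; used wherever convexity compares only copies shrunk by a factor [t < 1]. *)
Lemma le_of_exprn_le m (a b : \bar R) : (0 <= a)%E -> (b < +oo)%E -> 
  (forall t : R, 0 < t < 1 -> ((t ^+ m)%:E * a <= b)%E) -> (a <= b)%E.
Proof.
move=> a0 boo h.
have b0 : (0 <= b)%E.
  apply: le_trans (h (1 / 2) _); last lra.
  by apply: mule_ge0 => //; rewrite lee_fin exprn_ge0.
case: a a0 h => [a| |] //= a0 h; last first.
  have := h (1 / 2) ltac:(lra); rewrite gt0_muley; last by rewrite lte_fin exprn_gt0.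
  by rewrite leye_eq => /eqP bE; rewrite bE in boo.
case: b boo b0 h => [b| |] //= _ b0 h.
rewrite lee_fin leNgt; apply/negP => ba; rewrite !lee_fin in a0 b0.
have [t0 /andP[t00 t01] ht] := @exprn_near1 m b a (le_lt_trans b0 ba) ba.
have := h (1 - t0 / 2) ltac:(lra); rewrite -EFinM lee_fin leNgt ht//; lra.
Qed.

Lemma borel_closure A : borel_rV (closure A).
Proof. by apply: borel_closed; exact: closed_closure. Qed.

Lemma borel_interior A : borel_rV A°.
Proof. by apply: borel_open; exact: open_interior. Qed.

(** Shrinking the closure by [t < 1] towards an interior point puts it inside the interior, so the
    volumes compare up to the factor [t ^+ n]. *)
Lemma vol_closure_fat A : segment_closed A -> A° !=set0 -> (vol A° < +oo)%E ->
  vol (closure A) = vol A°.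
Proof.
move=> cA [x Ax] foo; apply/eqP; rewrite eq_le; apply/andP; split; last first.
  apply: vol_le; [exact: borel_interior|exact: borel_closure|].
  by apply: subset_trans (@subset_closure _ A); exact: interior_subset.
apply: (@le_of_exprn_le n) => // t /andP[t0 t1].
rewrite -vol_scale//; last exact: borel_closure.
rewrite -(@vol_translate _ _ (- ((1 - t) *: x))); last first.
  by apply: borel_scale; exact: borel_closure.
apply: vol_le; last 1 first.
- move=> y /= hy.
  rewrite (_ : y = (1 - t) *: x + t *: (t^-1 *: (y + - ((1 - t) *: x)))).
    by apply: interior_closure_segment => //; rewrite ltW.
  by apply/rowP => k; rewrite !mxE; field; rewrite gt_eqF.
- by apply: borel_translate; apply: borel_scale; exact: borel_closure.
- exact: borel_interior.
Qed.

(** A point of [B] outside [A] is a limit of interior points of [B], so the interior of [B] minus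
    [A] is open and nonempty; its positive volume would come on top of that of [A]. *)
Lemma eq_closed_convex_vol A B : closed A -> closed B -> segment_closed B -> B° !=set0 ->
  A `<=` B -> (vol B <= vol A)%E -> (vol A < +oo)%E -> A = B.
Proof.
move=> clA clB cB B0 AB BA Aoo; apply/seteqP; split => // y By.
apply: contrapT => Ay.
have oU : open (B° `&` ~` A) by apply: openI; [exact: open_interior|exact: closed_openC].
have U0 : (B° `&` ~` A) !=set0.
  have /(_ (~` A)) : closure B° y by rewrite -closure_interior_convex//; exact: subset_closure.
  have oA : open (~` A) by exact: closed_openC.
  by move=> []; [apply: open_nbhs_nbhs; split|move=> z [? ?]; exists z].
have := vol_open_gt0 oU U0.
rewrite ltNge => /negP; apply.
have h : (vol A + vol (B° `&` ~` A) <= vol A)%E.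
  apply: le_trans BA.
  rewrite -measureU; [| exact: borel_closed | exact: borel_open | ].
    apply: le_measure; rewrite ?inE; [|exact: borel_closed|].
      by apply: measurableU; [exact: borel_closed|exact: borel_open].
    move=> t [/AB//|[+ _]]; exact: interior_subset.
  by apply/seteqP; split => // t [? [_]].
have Af : vol A \is a fin_num by rewrite ge0_fin_numE// measure_ge0.
by rewrite -(leeD2lE _ _ Af) adde0.
Qed.

Lemma nat_dist_ge1 (a b : nat) : a != b -> 1 <= `|a%:R - b%:R : R|.
Proof.
rewrite neq_ltn => /orP[ab|ab]; first rewrite distrC.
  by rewrite -natrB ?(ltnW ab)// normr_nat ler1n subn_gt0.
by rewrite -natrB ?(ltnW ab)// normr_nat ler1n subn_gt0.
Qed.

(** If [y] in [A] is farther than [N%:R * r] from [x0], the first half of the segment from [x0] to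
    [y] carries [N] disjoint cubes of side [r / 2] inside [A]: there the ball about [x0], shrunk
    towards [y], still has radius at least [r / 2]. With [N] large their total volume exceeds that
    of [A]. *)
Lemma segment_closed_bounded A : borel_rV A -> segment_closed A -> A° !=set0 ->
  (vol A < +oo)%E -> exists M : R, forall x, A x -> `|x| <= M.
Proof.
move=> mA cA [x0 /interior_normP[r r0 rA]] Aoo.
pose box (rho : R) : set V := [set z | forall k, - rho <= z ord0 k <= rho].
have w0 : 0 < (r / 4 - - (r / 4)) ^+ n by rewrite exprn_gt0//; lra.
have Af : vol A \is a fin_num by rewrite ge0_fin_numE// measure_ge0.
have [N Nw] : exists N : nat, fine (vol A) < N%:R * (r / 4 - - (r / 4)) ^+ n.
  exists (Num.truncn (fine (vol A) / (r / 4 - - (r / 4)) ^+ n)).+1.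
  by rewrite -ltr_pdivrMr// truncnS_gt.
exists (`|x0| + N%:R * r) => y Ay; rewrite leNgt; apply/negP => My.
have N0 : (0 < N)%N.
  case: N Nw {My} => // ; rewrite mul0r ltNge fine_ge0//; exact: measure_ge0.
have NR : 0 < N%:R :> R by rewrite ltr0n.
have yx : N%:R * r < `|y - x0|.
  by have := ler_normD (y - x0) x0; rewrite subrK; lra.
(* The norm is the maximum norm; the cubes are separated along a coordinate that attains it. *)
have [k kE] : exists k, `|y - x0| = `|(y - x0) ord0 k|.
  by apply: norm_eq_coord; apply: lt_trans yx; rewrite mulr_gt0.
pose c j : V := x0 + (j%:R / (2 * N%:R)) *: (y - x0).
pose B j := [set z | box (r / 4) (z + - c j)].
have mB j : measurable (@rv_of_tuple R n @^-1` B j).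
  by apply: borel_translate; exact: borel_box.
have volB j : vol (B j) = ((r / 4 - - (r / 4)) ^+ n)%:E.
  rewrite vol_translate; last exact: borel_box.
  by rewrite vol_box//; lra.
have BA j : (j < N)%N -> B j `<=` A.
  move=> jN z zB; pose l : R := j%:R / (2 * N%:R).
  have l0 : 0 <= l by rewrite divr_ge0 ?mulr_ge0.
  have l12 : l <= 1 / 2.
    by rewrite ler_pdivrMr ?mulr_gt0// mulrA divfK// mul1r ler_nat ltnW.
  have l1 : 0 < 1 - l by lra.
  rewrite (_ : z = (1 - l) *: (x0 + (1 - l)^-1 *: (z - c j)) + l *: y); last first.
    by apply/rowP => i; rewrite !mxE -/l; field; rewrite gt_eqF.
  apply: cA => //; first lra.
  apply: rA; rewrite opprD addrA subrr add0r normrN normrZ.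
  rewrite gtr0_norm ?invr_gt0// ltr_pdivrMl//.
  have : `|z - c j| <= r / 4.
    by apply: rV_norm_le => [|q]; [lra|rewrite ler_norml; exact: zB].
  nra.
have tB : trivIset setT B.
  apply/trivIsetP => a b _ _ ab; apply/seteqP; split => // z [/(_ k) + /(_ k)].
  rewrite /B /c !mxE -!ler_norml => za zb.
  have h : `|(a%:R - b%:R) / (2 * N%:R) * (y ord0 k - x0 ord0 k)| <= r / 2.
    rewrite (_ : _ * _ = (z ord0 k + - (x0 ord0 k + b%:R / (2 * N%:R) * (y ord0 k - x0 ord0 k)))
      - (z ord0 k + - (x0 ord0 k + a%:R / (2 * N%:R) * (y ord0 k - x0 ord0 k)))); last by ring.
    by apply: le_trans (ler_normB _ _) _; lra.
  have ab1 := nat_dist_ge1 ab.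
  move: h; rewrite normrM normrM normfV (ger0_norm (_ : 0 <= 2 * N%:R)) ?mulr_ge0//.
  rewrite -[X in _ * `|X|](_ : (y - x0) ord0 k = _) -?kE; last by rewrite !mxE.
  rewrite leNgt => /negP; apply.
  apply: (@lt_le_trans _ _ (1 / (2 * N%:R) * `|y - x0|)); last first.
    by do 2 apply: ler_wpM2r => //; rewrite invr_ge0 mulr_ge0.
  rewrite div1r [ltRHS]mulrC ltr_pdivlMr ?mulr_gt0//.
  by rewrite (_ : r / 2 * _ = N%:R * r)//; field.
have : (vol (\big[setU/set0]_(j < N) B j) <= vol A)%E.
  apply: vol_le => //.
    rewrite /borel_rV -bigcup_mkord preimage_bigcup; apply: bigcup_measurable => j _; exact: mB.
  by rewrite -bigcup_mkord => z [j /= jN]; exact: BA.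
rewrite [leLHS](_ : _ = (N%:R * (r / 4 - - (r / 4)) ^+ n)%:E).
  by rewrite -[vol A]fineK// lee_fin leNgt Nw.
elim: (N) => [|p IH].
  by rewrite big_ord0 mul0r /vol preimage_set0 measure0.
rewrite big_ord_recr /= /vol preimage_setU measureU.
- rewrite -natr1 mulrDl mul1r EFinD; congr (_ + _)%E; [exact: IH|exact: volB].
- rewrite -bigcup_mkord preimage_bigcup; apply: bigcup_measurable => j _; exact: mB.
- exact: mB.
- rewrite -preimage_setI setIC -bigcup_mkord setI_bigcupr bigcup0 ?preimage_set0// => j /= jp.
  by move/trivIsetP : tB => -> //; rewrite gt_eqF.
Qed.

Lemma segment_closed_sum k (B : set V) (a : 'rV[R]_k) (M : 'M[R]_(k, n)) :
  segment_closed B -> B 0 -> (forall j, B (row j M)) -> (forall j, 0 <= a ord0 j) ->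
  \sum_j a ord0 j <= 1 -> B (a *m M).
Proof.
move=> cB B0 BM a0.
(* Partial sums are kept in the form total weight times a point of [B]; the missing weight is
   finally given to 0. *)
have [b Bb [s0 bE]] : exists2 b, B b &
    0 <= \sum_j a ord0 j /\ a *m M = (\sum_j a ord0 j) *: b.
  rewrite mulmx_sum_row.
  elim/big_rec2: _ => [|j v x _ [b Bb [x0 ->]]]; first by exists 0; rewrite ?scaler0.
  have := a0 j; rewrite le_eqVlt => /orP[/eqP aj|aj].
    by exists b => //; rewrite -aj scale0r !add0r.
  have ax : 0 < a ord0 j + x by rewrite ltr_wpDr.
  exists ((1 - x / (a ord0 j + x)) *: row j M + (x / (a ord0 j + x)) *: b).
    apply: cB => //; apply/andP; split; first by apply: divr_ge0 => //; exact: ltW.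
    by rewrite ler_pdivrMr// mul1r lerDr ltW.
  split; first exact: ltW.
  by apply/rowP => q; rewrite !mxE; field; rewrite gt_eqF.
rewrite bE => s1.
rewrite (_ : _ *: b = (1 - \sum_j a ord0 j) *: 0 + (\sum_j a ord0 j) *: b).
  by apply: cB => //; rewrite s0.
by rewrite scaler0 add0r.
Qed.

(* A maximal free family of differences [x - x0] either spans, and then [A]
   contains a simplex, or is orthogonal to some [c != 0]. *)
Lemma thin_convex_hyperplane A x0 : segment_closed A -> A x0 -> A° = set0 ->
  exists2 c : V, c != 0 & forall x, A x -> ((x - x0) *m c^T) ord0 ord0 = 0.
Proof.
move=> cA Ax0 Ai.
pose P k := `[< exists M : 'M[R]_(k, n), row_free M /\ forall j, A (x0 + row j M) >].
have P0 : exists k, P k.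
  exists 0%N; apply/asboolP; exists 0; split => [|[]//].
  by rewrite /row_free mxrank0.
have Pn k : P k -> (k <= n)%N.
  by move=> /asboolP[M [fM _]]; rewrite -(eqP fM) rank_leq_col.
have [k /asboolP[M [fM AM]] kmax] := ex_maxnP P0 Pn.
have [kn|kn] := eqVneq k n.
  subst k.
  have uM : M \in unitmx by rewrite -row_free_unit.
  exfalso; pose B := [set y | A (x0 + y)].
  have cB : segment_closed B.
    move=> x y l l01 Bx By; rewrite /B /=.
    rewrite (_ : x0 + _ = (1 - l) *: (x0 + x) + l *: (x0 + y)); first exact: cA.
    by apply/rowP => q; rewrite !mxE; ring.
  pose S : R := \sum_j \sum_q `|invmx M j q|.
  have S0 : 0 <= S by apply: sumr_ge0 => j _; rewrite sumr_ge0.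
  (* The barycentre of the simplex spanned by 0 and the rows of [M]. Moving each coordinate by at
     most (n+1)^-2 keeps it nonnegative and the sum at most n/(n+1) + n/(n+1)^2 = 1 - 1/(n+1)^2, so
     a ball about it lies in [A]. *)
  pose a0 : 'rV[R]_n := const_mx n.+1%:R^-1.
  have k0 : 0 < n.+1%:R^-1 :> R by rewrite invr_gt0.
  have : A° (x0 + a0 *m M).
    apply/interior_normP; exists (n.+1%:R^-1 ^+ 2 / (1 + S)).
      by rewrite divr_gt0 ?exprn_gt0// ltr_wpDr.
    move=> y yE.
    pose a := (y - x0) *m invmx M.
    have aa0 j : `|n.+1%:R^-1 - a ord0 j| <= n.+1%:R^-1 ^+ 2.
      rewrite (_ : _ - _ = ((x0 + a0 *m M - y) *m invmx M) ord0 j); last first.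
        rewrite (_ : x0 + _ - y = a0 *m M - (y - x0)); last first.
          by apply/rowP => q; rewrite !mxE; ring.
        rewrite mulmxBl mulmxK// [RHS]mxE [X in _ = X + _]mxE; congr (_ + _).
        by rewrite [RHS]mxE.
      apply: le_trans (coord_le_norm _ _) _; apply: le_trans (norm_mulmx _ _) _.
      rewrite -/S; move: yE; rewrite ltr_pdivlMr; last by rewrite ltr_wpDr.
      by move=> /ltW; apply: le_trans; rewrite mulrDr lerDr mulr1 normr_ge0.
    rewrite (_ : y = x0 + a *m M); last by rewrite mulmxKV// addrC subrK.
    have k1 : n.+1%:R^-1 <= 1 :> R by rewrite invf_le1// ler1n.
    have k2 : n.+1%:R^-1 ^+ 2 <= n.+1%:R^-1 :> R by rewrite expr2 ler_piMr// ltW.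
    apply: (@segment_closed_sum _ B) => //.
    - by rewrite /B /= addr0.
    - by move=> j; have := aa0 j; rewrite ler_norml => /andP[_ /le_trans/(_ k2)]; rewrite gerBl.
    - apply: (@le_trans _ _ (\sum_(j < n) (n.+1%:R^-1 + n.+1%:R^-1 ^+ 2))).
        by apply: ler_sum => j _; have := aa0 j; rewrite ler_norml => /andP[+ _]; rewrite lerNl opprB lerBlDl.
      rewrite sumr_const card_ord -[leLHS]mulr_natl.
      have -> : n%:R = n.+1%:R - 1 :> R by rewrite -natr1 addrK.
      rewrite (_ : _ * _ = 1 - n.+1%:R^-1 ^+ 2); first by rewrite gerBl sqr_ge0.
      have : n.+1%:R != 0 :> R by rewrite pnatr_eq0.
      by move: (n.+1%:R) => N N0; field.
  by rewrite Ai.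
have {}kn : (k < n)%N by rewrite ltn_neqAle kn Pn//; apply/asboolP; exists M.
have span x : A x -> (x - x0 <= M)%MS.
  move=> Ax; apply: contraT => xM.
  have : P k.+1; last by move=> /kmax; rewrite ltnn.
  apply/asboolP; exists (col_mx (x - x0) M : 'M[R]_(1 + k, n)); split.
    have : (M < (x - x0)%R + M)%MS.
      by rewrite /ltmx addsmxSr addsmx_sub negb_and xM.
    move=> /rank_ltmx; rewrite (eqP fM) => kr.
    rewrite /row_free eqn_leq rank_leq_row andTb.
    by apply: leq_trans kr _; rewrite (addsmxE (x - x0) M).1.
  suff rA (j : 'I_(1 + k)) : A (x0 + row j (col_mx (x - x0) M)) by exact: rA.
  case: (split_ordP j) => q ->; last by rewrite rowKd.
  rewrite rowKu (_ : row q _ = x - x0); first by rewrite addrC subrK.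
  by apply/rowP => p; rewrite mxE ord1.
have cn : nz_row (kermx M^T) != 0.
  rewrite nz_row_eq0 -mxrank_eq0 mxrank_ker mxrank_tr (eqP fM).
  by rewrite subn_eq0 -ltnNge.
exists (nz_row (kermx M^T)) => // x /span/submxP[D ->].
have /sub_kermxP h : (nz_row (kermx M^T) <= kermx M^T)%MS by exact: nz_row_sub.
rewrite -mulmxA (_ : M *m _ = 0) ?mulmx0 ?mxE//.
by apply: trmx_inj; rewrite trmx_mul trmxK h trmx0.
Qed.

Lemma borel_hyperplane (c : V) (b : R) : borel_rV [set x | (x *m c^T) ord0 ord0 = b].
Proof.
have := @measurable_rVM R _ _ _ _ _ c^T (@measurable_rV_id R n) ord0.
move=> /(_ measurableT [set b] (measurable_set1 b)); rewrite setTI.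
by [].
Qed.

(** In orthonormal coordinates along [c] and its complement, the hyperplane is a one-dimensional box
    of side 0 times the whole complement. *)
Lemma vol_hyperplane (c : V) (b : R) : c != 0 -> vol [set x | (x *m c^T) ord0 ord0 = b] = 0%E.
Proof.
move=> c0; have fc : row_free c by rewrite /row_free rank_rV c0.
have [E1 [E11 /andP[E1c cE1]]] := onb_exists fc.
have [E2 [E22 /andP[E2k _]]] := onb_exists (row_base_free (kermx c^T)).
have E2c : E2 *m c^T = 0.
  by apply/sub_kermxP; rewrite (submx_trans E2k)// eq_row_base.
have E12 : E1 *m E2^T = 0.
  apply: trmx_inj; rewrite trmx0 trmx_mul trmxK.
  by have /submxP[D ->] := E1c; rewrite trmx_mul mulmxA E2c mul0mx.
have dim : (1 + \rank (kermx c^T))%N = n.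
  have n0 : (0 < n)%N by have := rank_leq_col c; rewrite rank_rV c0.
  by rewrite mxrank_ker mxrank_tr rank_rV c0 subnKC.
rewrite (vol_split dim E11 E22 E12 (borel_hyperplane c b)).
pose s := (E1 *m c^T) ord0 ord0.
have s0 : s != 0.
  apply: contra c0 => /eqP s0.
  have E1c0 : E1 *m c^T = 0 by apply/matrixP => i j; rewrite !ord1 [RHS]mxE; exact: s0.
  have /submxP[D cD] := cE1; rewrite cD (_ : D = 0) ?mul0mx//.
  by apply: trmx_inj; rewrite -[D]mulmx1 -E11 mulmxA -cD trmx_mul trmxK E1c0 trmx0.
rewrite (_ : [set p | _] =
  (rv_of_tuple @^-1` [set x : 'rV[R]_1 | forall k, b / s <= x ord0 k <= b / s]) `*` setT).
  rewrite product_measure1E//; last exact: borel_box.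
  rewrite [X in (X * _)%E](_ : _ = 0%E) ?mul0e//.
  by have := @vol_box R 1 (b / s) (b / s) (lexx _); rewrite subrr expr1.
have E t u : ((rv_of_tuple t *m E1 + u *m E2) *m c^T) ord0 ord0 = rv_of_tuple t ord0 ord0 * s.
  by rewrite mulmxDl -!mulmxA E2c mulmx0 addr0 mxE big_ord1.
apply/seteqP; split => -[t u] /=; rewrite E.
  by move=> <-; split => // k; rewrite (ord1 k) mulfK// lexx.
by move=> [/(_ ord0) + _] => /le_anti <-; rewrite divfK.
Qed.

(** Either [vol_closure_fat] applies, or [A] lies in a hyperplane, which is closed and null. *)
Lemma vol_closure_convex A : segment_closed A -> (vol A° < +oo)%E ->
  vol (closure A) = vol A°.
Proof.
move=> cA Aoo; have [[x Ax]|] := pselect (A° !=set0).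
  by apply: vol_closure_fat => //; exists x.
move/set0P/negP; rewrite negbK => /eqP Ai.
have [[x0 Ax0]|] := pselect (A !=set0); last first.
  by move/set0P/negP; rewrite negbK => /eqP ->; rewrite closure0 interior0.
have [c c0 hc] := thin_convex_hyperplane cA Ax0 Ai.
rewrite Ai [RHS](_ : _ = 0%E); last by rewrite /vol preimage_set0 measure0.
apply/eqP; rewrite eq_le measure_ge0 andbT -(vol_hyperplane ((x0 *m c^T) ord0 ord0) c0).
apply: vol_le; [exact: borel_closure|exact: borel_hyperplane|].
move=> y /closure_normP yA /=.
pose S : R := \sum_j \sum_q `|c^T j q|.
have S0 : 0 <= S by apply: sumr_ge0 => j _; rewrite sumr_ge0.
have lin u v : (u *m c^T) ord0 ord0 - (v *m c^T) ord0 ord0 = ((u - v) *m c^T) ord0 ord0.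
  by rewrite mulmxBl !mxE.
apply/eqP; rewrite -subr_eq0 lin -normr_le0 leNgt; apply/negP => d0.
have [z Az yz] := yA _ (divr_gt0 d0 (ltr_wpDr S0 ltr01)).
have : `|((y - x0) *m c^T) ord0 ord0| <= `|y - z| * S.
  rewrite -lin -[X in X - _](subrK ((z *m c^T) ord0 ord0)) -addrA !lin hc// addr0.
  exact: le_trans (coord_le_norm _ _) (norm_mulmx _ _).
move: yz; rewrite ltr_pdivlMr; last by rewrite ltr_wpDr.
by have := normr_ge0 (y - z); nra.
Qed.

Lemma vol_null_thin A : segment_closed A -> A° = set0 -> vol (closure A) = 0%E.
Proof.
by move=> cA Ai; rewrite vol_closure_convex// Ai /vol preimage_set0 measure0.
Qed.

End convex_measure.

(** * Sections and shadows in orthonormal coordinates *)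

Lemma continuous_affine {R : realType} m n (M : 'M[R]_(m, n)) (f : 'rV[R]_m -> 'rV[R]_n) :
  (forall x y, f x - f y = (x - y) *m M) -> continuous f.
Proof.
move=> fM x U /nbhs_ballP[e /= e0 eU].
pose S : R := \sum_j \sum_k `|M j k|.
have S0 : 0 <= S by apply: sumr_ge0 => j _; rewrite sumr_ge0.
have d0 : 0 < 1 + S by rewrite ltr_wpDr.
apply/nbhs_ballP; exists (e / (1 + S)); first by rewrite /= divr_gt0.
move=> y; rewrite -ball_normE /= => xy; apply: eU; rewrite -ball_normE /=.
rewrite fM; apply: le_lt_trans (norm_mulmx _ _) _; rewrite -/S.
rewrite ltr_pdivlMr// in xy.
by apply: le_lt_trans xy; rewrite mulrDr mulr1 lerDr normr_ge0.
Qed.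

Section slices.
Context {R : realType} {i m n : nat}.
Variables (E1 : 'M[R]_(i, n)) (E2 : 'M[R]_(m, n)).
Hypotheses (dim : (i + m)%N = n) (E11 : E1 *m E1^T = 1%:M) (E22 : E2 *m E2^T = 1%:M)
  (E12 : E1 *m E2^T = 0).
Local Notation mR := (measurableTypeR R).

(* When the rows of [E1] and [E2] are orthonormal bases of H and its complement,
   these are the section of [K] over [x] and the projection of [K] onto H. *)
Definition fiber (K : set 'rV[R]_n) (x : 'rV[R]_i) : set 'rV[R]_m :=
  [set u | K (x *m E1 + u *m E2)].
Definition shadow (K : set 'rV[R]_n) : set 'rV[R]_i := [set x | fiber K x !=set0].

Lemma E21 : E2 *m E1^T = 0.
Proof. by apply: trmx_inj; rewrite trmx_mul trmxK E12 trmx0. Qed.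

Lemma proj1K x u : (x *m E1 + u *m E2) *m E1^T = x :> 'rV_i.
Proof. by rewrite mulmxDl -!mulmxA E11 E21 mulmx1 mulmx0 addr0. Qed.

Lemma proj2K x u : (x *m E1 + u *m E2) *m E2^T = u :> 'rV_m.
Proof. by rewrite mulmxDl -!mulmxA E22 E12 mulmx1 mulmx0 add0r. Qed.

Lemma split_rV (z : 'rV[R]_n) : z = (z *m E1^T) *m E1 + (z *m E2^T) *m E2.
Proof.
move: E11 E22 E12 E21; case: n / dim E1 E2 z => F1 F2 z F11 F22 F12 F21.
have CC : col_mx F1 F2 *m (col_mx F1 F2)^T = 1%:M.
  by rewrite tr_col_mx mul_col_row F11 F22 F12 F21 -scalar_mx_block.
rewrite -mul_row_col -mul_mx_row -tr_col_mx -mulmxA (mulmx1C CC) mulmx1 //.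
Qed.

Variable K : set 'rV[R]_n.

Lemma borel_slice x : borel_rV K -> borel_rV (fiber K x).
Proof.
apply: borel_preimage; apply: measurable_rVD; first exact: measurable_rV_cst.
by apply: measurable_rVM; exact: measurable_rV_id.
Qed.

Lemma closed_slice x : closed K -> closed (fiber K x).
Proof.
move=> cK; have := @preimage_closed 'rV[R]_m 'rV[R]_n (fun u => x *m E1 + u *m E2) K.
apply => // u _; apply: (continuous_affine (M := E2)) => y z.
by rewrite opprD addrACA subrr add0r mulmxBl.
Qed.

Lemma segment_closed_slice x : segment_closed K -> segment_closed (fiber K x).
Proof.
move=> cK u v l l01 Ku Kv; have := cK _ _ _ l01 Ku Kv.
rewrite /fiber /=; congr K.
by rewrite mulmxDl -!scalemxAl !scalerDr addrACA -scalerDl subrK scale1r.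
Qed.

Lemma slice_segment x y u v l : segment_closed K -> 0 <= l <= 1 -> fiber K x u -> fiber K y v ->
  fiber K ((1 - l) *: x + l *: y) ((1 - l) *: u + l *: v).
Proof.
move=> cK l01 Ku Kv; have := cK _ _ _ l01 Ku Kv.
rewrite /fiber /=; congr K.
by rewrite !scalerDr addrACA !scalemxAl -!mulmxDl.
Qed.

Lemma segment_closed_shadow : segment_closed K -> segment_closed (shadow K).
Proof.
move=> cK x y l l01 [u Ku] [v Kv]; exists ((1 - l) *: u + l *: v).
exact: slice_segment.
Qed.

Lemma shadowE : shadow K = [set z *m E1^T | z in K].
Proof.
apply/seteqP; split => x.
  by move=> [u Ku]; exists (x *m E1 + u *m E2); rewrite ?proj1K.
move=> [z Kz <-]; exists (z *m E2^T).
by rewrite /fiber /= -split_rV.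
Qed.

Lemma compact_shadow : compact K -> compact (shadow K).
Proof.
move=> cK; rewrite shadowE; apply: continuous_compact => //.
by apply: continuous_subspaceT; apply: (continuous_affine (M := E1^T)) => y z; rewrite mulmxBl.
Qed.

Lemma vol_slices : borel_rV K ->
  vol K = (\int[lebesgue_tuple i]_t vol (fiber K (rv_of_tuple t)))%E.
Proof.
move=> mK; rewrite (vol_split dim E11 E22 E12 mK); apply: eq_integral => t _ /=.
by congr (lebesgue_tuple m _); apply/seteqP; split => u; rewrite /xsection /= inE.
Qed.

Lemma measurable_vol_slice : borel_rV K ->
  measurable_fun setT (fun t : i.-tuple mR => vol (fiber K (rv_of_tuple t))).
Proof.
move=> mK; pose S := [set p : i.-tuple mR * m.-tuple mR |
  K (rv_of_tuple p.1 *m E1 + rv_of_tuple p.2 *m E2)].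
have mS : measurable S.
  by apply: (measurable_rV_preimage _ mK); exact: measurable_rV_pair.
have := measurable_fun_xsection (lebesgue_tuple m) mS.
rewrite (_ : _ \o _ = fun t => vol (fiber K (rv_of_tuple t)))//.
apply/funext => t /=; congr (lebesgue_tuple m _).
by apply/seteqP; split => u; rewrite /xsection /= inE.
Qed.

(** Any point [w] of the slice over [c] serves: by convexity the slice on the right contains the
    slice over [z] scaled by [1 - th] and translated by [th *: w]. *)
Lemma vol_slice_scale z c th : borel_rV K -> segment_closed K -> 0 <= th < 1 -> shadow K c ->
  (((1 - th) ^+ m)%:E * vol (fiber K z) <= vol (fiber K ((1 - th) *: z + th *: c)))%E.
Proof.
move=> mK cK /andP[th0 th1] [w Kw].
have h0 : 0 < 1 - th by lra.
have m0 : borel_rV [set u | fiber K z ((1 - th)^-1 *: u)].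
  by apply: borel_scale; exact: borel_slice.
rewrite -vol_scale//; last exact: borel_slice.
rewrite -(@vol_translate _ _ (- (th *: w))) //.
apply: vol_le; [exact: borel_translate|exact: borel_slice|].
move=> u /= Ku.
have th01 : 0 <= th <= 1 by rewrite th0 ltW.
have := slice_segment cK th01 Ku Kw.
rewrite [X in fiber _ _ X -> _](_ : _ = u)//.
by apply/rowP => k; rewrite !mxE; field; lra.
Qed.

End slices.

(** The projection of a closed set need not be closed, but it is the countable union of the
    projections of its compact truncations. *)
Lemma borel_shadow {R : realType} i m n (E1 : 'M[R]_(i, n)) (E2 : 'M[R]_(m, n)) (K : set 'rV[R]_n) :
  (i + m)%N = n -> E1 *m E1^T = 1%:M -> E2 *m E2^T = 1%:M -> E1 *m E2^T = 0 ->
  closed K -> borel_rV (shadow E1 E2 K).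
Proof.
move=> dim E11 E22 E12 cK.
rewrite (_ : shadow E1 E2 K = \bigcup_k shadow E1 E2 (K `&` [set z | `|z| <= k%:R])).
  rewrite /borel_rV preimage_bigcup; apply: bigcup_measurable => k _.
  apply: borel_closed; apply: compact_closed; first exact: norm_hausdorff.
  apply: compact_shadow => //; apply: bounded_closed_compact.
    by exists k%:R; split; [exact: num_real|move=> M kM z [_ /= zk]; rewrite (le_trans zk)// ltW].
  apply: closedI => //.
  rewrite (_ : [set z | _] = (fun z : 'rV[R]_n => `|z|) @^-1` [set x | x <= k%:R])//.
  apply: closed_comp; last exact: closed_le.
  by move=> z _; exact: norm_continuous.
apply/seteqP; split => [x [u Ku]|x [k _ [u [Ku _]]]]; last by exists u.
exists (Num.truncn `|x *m E1 + u *m E2|).+1 => //; exists u; split => //=.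
by apply/ltW; rewrite truncnS_gt.
Qed.

(** * The volume profile of a cone *)

Section cone_weight.
Context {R : realType}.
Local Notation mR := (measurableTypeR R).
Local Notation leb := (@lebesgue_measure R).

(* The density on [0, 1] whose tail on [t, 1] is [(1 - t) ^+ m]; integrated over
   the [th] with [x \in th *: L], it gives the volume profile of a cone. *)
Definition cone_weight m (th : R) : R := m%:R * (1 - th) ^+ m.-1.

Lemma cone_weight_ge0 m th : th <= 1 -> 0 <= cone_weight m th.
Proof. by move=> t1; rewrite mulr_ge0// exprn_ge0//; lra. Qed.

Lemma measurable_cone_weight m D : measurable_fun D (cone_weight m : mR -> mR).
Proof.
apply: measurable_funM => //; apply: measurable_funX.
by apply: measurable_funB.
Qed.

Lemma measurable_inv : measurable_fun setT (GRing.inv : mR -> mR).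
Proof.
have -> : [set: mR] = [set~ (0 : R)] `|` [set (0 : R)] by rewrite setUC setUv.
apply/measurable_funU; [exact: measurableC|by []|split; last exact: measurable_fun_set1].
apply: open_continuous_measurable_fun; first exact/closed_openC/closed_eq.
by move=> x; rewrite inE /= => /eqP x0; exact: inv_continuous.
Qed.

Lemma cone_weight_tail m (t0 : R) : (0 < m)%N -> t0 <= 1 ->
  (\int[leb]_(th in `[t0, 1%R]) (cone_weight m th)%:E = ((1 - t0) ^+ m)%:E)%E.
Proof.
case: m => // m _.
rewrite le_eqVlt => /predU1P[->|t1].
  by rewrite set_itv1 integral_set1 subrr expr0n.
rewrite (@continuous_FTC2 _ _ (fun th => onem th ^+ m.+1 * -1))//.
- by rewrite -EFinB onem1 expr0n/= /onem; congr EFin; ring.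
- apply: continuous_in_subspaceT => x _; apply: cvgM; first exact: cvg_cst.
  exact: continuous_onemXn.
- have cF x : {for x, continuous (fun th : R => onem th ^+ m.+1 * -1)}.
    by apply: cvgM; [exact: continuous_onemXn|exact: cvg_cst].
  split.
  + by move=> y _; apply: derivableM => //; exact: onemXn_derivable.
  + exact/cvg_at_right_filter/cF.
  + exact/cvg_at_left_filter/cF.
- move=> x _; rewrite derive1Mr; last exact: onemXn_derivable.
  by rewrite derive_onemXn mulrN1 mulNr opprK.
Qed.

(** The quotient of factorials is the beta integral of th^i (1 - th)^m; the binomial coefficient of
    the theorem originates here. *)
Lemma bin_beta i m : m.+1%:R * ((i`! * m`!)%:R / (i + m).+1`!%:R) = ('C(i + m.+1, i)%:R)^-1 :> R.
Proof.
have := bin_fact (leq_addr m.+1 i); rewrite addKn => e.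
have : 'C(i + m.+1, i)%:R * (i`! * m.+1`!)%:R = (i + m.+1)`!%:R :> R by rewrite -natrM e.
rewrite factS addnS !natrM => {}e.
have i0 : i`!%:R != 0 :> R by rewrite pnatr_eq0 -lt0n fact_gt0.
have m0 : m`!%:R != 0 :> R by rewrite pnatr_eq0 -lt0n fact_gt0.
have m1 : m.+1%:R != 0 :> R by rewrite pnatr_eq0.
have C0 : 'C(i + m.+1, i)%:R != 0 :> R.
  by rewrite pnatr_eq0 -lt0n bin_gt0 leq_addr.
move: e C0; rewrite addnS => <- C0.
move: ('C(_, _)%:R) (i`!%:R) (m`!%:R) (m.+1%:R) C0 i0 m0 m1 => a b c d a0 b0 c0 d0.
by field; rewrite a0 b0 c0 d0.
Qed.

Lemma cone_weight_moment i m : (0 < m)%N ->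
  (\int[leb]_(th in `]0%R, 1%R[) (th ^+ i * cone_weight m th)%:E =
   (('C(i + m, i)%:R)^-1)%:E)%E.
Proof.
case: m => // m _.
rewrite -bin_beta -beta_fun_fact EFinM EFin_beta_fun.
rewrite -(@integral_itv_bndoo _ _ _ _ true false); last first.
  apply/measurable_EFinP; apply: measurable_funM; first exact: measurable_funX.
  exact: measurable_cone_weight.
rewrite -ge0_integralZl//; last 2 first.
- apply/measurable_EFinP; apply/measurable_restrict => //.
  by rewrite setTI; exact: measurable_XMonemX.
- move=> x _; rewrite lee_fin patchE; case: ifPn => // x01.
  by apply: XMonemX_ge0; rewrite inE in x01.
rewrite [LHS]integral_mkcond; apply: eq_integral => x _; rewrite !patchE -EFinM.
case: ifPn => _; last by rewrite mulr0.
by congr (_%:E); rewrite /XMonemX /cone_weight /= /onem; ring.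
Qed.

(** For [L] star-shaped about 0 and [x] of gauge g at most 1, this is (1 - g)^m. Writing it as an
    integral over [th] lets Tonelli yield its measurability and its total integral without handling
    the gauge as a function of [x]. *)
Definition cone_integral i m (L : set 'rV[R]_i) (x : 'rV[R]_i) : \bar R :=
  (\int[leb]_(th in `]0%R, 1%R[) (cone_weight m th * \1_L (th^-1 *: x))%:E)%E.

Section cone_integral.
Variables (i m : nat) (L : set 'rV[R]_i).
Hypothesis bL : borel_rV L.

Let f (p : i.-tuple mR * mR) : \bar R :=
  (cone_weight m p.2 * \1_L (p.2^-1 *: rv_of_tuple p.1) * \1_(`]0%R, 1%R[%classic) p.2)%:E.

Let f_ge0 p : (0 <= f p)%E.
Proof.
rewrite /f lee_fin [X in _ * X]indicE; case: (boolP (_ \in _)); last by rewrite mulr0.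
rewrite inE /= in_itv /= => /andP[t0 t1].
by rewrite mulr1 mulr_ge0// cone_weight_ge0// ltW.
Qed.

Let mf : measurable_fun setT f.
Proof.
apply/measurable_EFinP; apply: measurable_funM; first apply: measurable_funM.
- apply: (@measurableT_comp _ _ _ _ _ _ (cone_weight m : mR -> mR)) => //.
  exact: measurable_cone_weight.
- rewrite (_ : (fun p => _) = \1_[set p : i.-tuple mR * mR | L (p.2^-1 *: rv_of_tuple p.1)]).
    apply: measurable_indic; apply: (measurable_rV_preimage _ bL).
    apply: measurable_rVZ; last by apply: measurable_rV_tuple; exact: measurable_fst.
    apply: (@measurableT_comp _ _ _ _ _ _ (GRing.inv : mR -> mR)) => //.
    exact: measurable_inv.
  by apply/funext => p; rewrite !indicE; congr (_%:R); apply/idP/idP; rewrite !inE.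
- by apply: (@measurableT_comp _ _ _ _ _ _ (\1_(`]0%R, 1%R[%classic) : mR -> mR)).
Qed.

Let cone_integralE t : cone_integral m L (rv_of_tuple t) = (\int[leb]_th f (t, th))%E.
Proof.
rewrite /cone_integral integral_mkcond; apply: eq_integral => th _.
rewrite /f patchE /= [X in _ = (_ * X)%:E]indicE.
by case: ifPn => _; rewrite ?mulr1 ?mulr0.
Qed.

Lemma measurable_cone_integral :
  measurable_fun setT (fun t => cone_integral m L (rv_of_tuple t)).
Proof.
rewrite (_ : (fun t => _) = fubini_F leb f); last by apply/funext => t; rewrite cone_integralE.
exact: measurable_fun_fubini_tonelli_F.
Qed.

(** In the other order of integration, the integral over [x] is [th ^+ i] times the volume of [L],
    which leaves the moment of [cone_weight]. *)
Lemma cone_integral_total : (0 < m)%N ->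
  (\int[lebesgue_tuple i]_t cone_integral m L (rv_of_tuple t) =
   (('C(i + m, i)%:R)^-1)%:E * vol L)%E.
Proof.
move=> m0; under eq_integral do rewrite cone_integralE.
rewrite (fubini_tonelli (m1 := lebesgue_tuple i) (m2 := leb) f)//.
rewrite -cone_weight_moment// muleC -ge0_integralZl//; first last.
- move=> th /=; rewrite in_itv /= => /andP[t0 t1].
  rewrite lee_fin mulr_ge0//; first by rewrite exprn_ge0// ltW.
  by rewrite cone_weight_ge0// ltW.
- apply/measurable_EFinP; apply: measurable_funM; first exact: measurable_funX.
  exact: measurable_cone_weight.
rewrite [RHS]integral_mkcond; apply: eq_integral => th _; rewrite patchE.
case: ifPn => [|nt]; last first.
  by rewrite integral0_eq// => t _; rewrite /f /= [X in (_ * X)%:E]indicE (negbTE nt) mulr0.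
rewrite inE /= in_itv /= => /andP[t0 t1].
transitivity (\int[lebesgue_tuple i]_t ((cone_weight m th)%:E *
   (\1_(rv_of_tuple @^-1` [set x | L (th^-1 *: x)]) t)%:E))%E.
  apply: eq_integral => t _; rewrite /f /= -EFinM; congr (_%:E).
  rewrite [X in _ * _ * X]indicE mem_set ?mulr1; last by rewrite /= in_itv /= t0.
  by congr (_ * _); rewrite !indicE; congr (_%:R); apply/idP/idP; rewrite !inE.
have mS : measurable (@rv_of_tuple R i @^-1` [set x | L (th^-1 *: x)]) by exact: borel_scale.
rewrite ge0_integralZl//; [|exact/measurable_EFinP|by rewrite lee_fin cone_weight_ge0// ltW].
rewrite integral_indic// setIT [X in (_ * X)%E](_ : _ = vol [set x | L (th^-1 *: x)])// vol_scale//.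
by rewrite muleA -EFinM muleC mulrC.
Qed.

End cone_integral.

Lemma measurable_cone_integrand i m (L : set 'rV[R]_i) x D : borel_rV L ->
  measurable_fun D (fun th => (cone_weight m th * \1_L (th^-1 *: x))%:E : \bar R).
Proof.
move=> bL; apply: measurable_funTS; apply/measurable_EFinP; apply: measurable_funM.
  exact: measurable_cone_weight.
rewrite (_ : (fun th => _) = \1_[set th | L (th^-1 *: x)]).
  apply: measurable_indic; apply: (measurable_rV_preimage _ bL).
  by apply: measurable_rVZ; [exact: measurable_inv|exact: measurable_rV_cst].
by apply/funext => th; rewrite !indicE; congr (_%:R); apply/idP/idP; rewrite !inE.
Qed.

Lemma cone_integral_le i m (L : set 'rV[R]_i) x t0 : (0 < m)%N -> borel_rV L -> 0 <= t0 <= 1 ->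
  (forall th, 0 < th < 1 -> L (th^-1 *: x) -> t0 <= th) ->
  (cone_integral m L x <= ((1 - t0) ^+ m)%:E)%E.
Proof.
move=> m0 bL /andP[t00 t01] h; rewrite -cone_weight_tail// /cone_integral.
rewrite integral_mkcond [leRHS]integral_mkcond.
apply: ge0_le_integral => //.
- move=> th _; rewrite patchE; case: ifPn => //; rewrite inE /= in_itv /= => /andP[_ /ltW th1].
  by rewrite lee_fin mulr_ge0// cone_weight_ge0.
- by apply/(measurable_restrictT _ _).1 => //; exact: measurable_cone_integrand.
- by apply/(measurable_restrictT _ _).1 => //; apply/measurable_EFinP; exact: measurable_cone_weight.
- move=> th _; rewrite !patchE !mem_setE !in_itv /=.
  have [/andP[th0 th1]|_] := boolP (0 < th < 1); last first.
    case: ifPn => // /andP[_ th1]; by rewrite lee_fin cone_weight_ge0.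
  have w0 : 0 <= cone_weight m th by rewrite cone_weight_ge0// ltW.
  rewrite indicE; have [Lx|Lx] := pselect (L (th^-1 *: x)).
    by rewrite mem_set// mulr1 (ltW th1) h// th0 th1.
  by rewrite memNset// mulr0; case: ifPn => // _; rewrite lee_fin.
Qed.

Lemma cone_integral_ge i m (L : set 'rV[R]_i) x t0 : (0 < m)%N -> borel_rV L -> 0 <= t0 <= 1 ->
  (forall th, t0 < th < 1 -> L (th^-1 *: x)) ->
  (((1 - t0) ^+ m)%:E <= cone_integral m L x)%E.
Proof.
move=> m0 bL /andP[t00 t01] h; rewrite -cone_weight_tail// /cone_integral.
rewrite (@integral_itv_bndoo _ _ _ _ true false); last first.
  by apply/measurable_EFinP; exact: measurable_cone_weight.
rewrite integral_mkcond [leRHS]integral_mkcond.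
apply: ge0_le_integral => //.
- move=> th _; rewrite patchE; case: ifPn => //; rewrite inE /= in_itv /= => /andP[_ /ltW th1].
  by rewrite lee_fin cone_weight_ge0.
- by apply/(measurable_restrictT _ _).1 => //; apply/measurable_EFinP; exact: measurable_cone_weight.
- by apply/(measurable_restrictT _ _).1 => //; exact: measurable_cone_integrand.
- move=> th _; rewrite !patchE !mem_setE !in_itv /=.
  have [/andP[th0 th1]|_] := boolP (t0 < th < 1).
    rewrite th1 (le_lt_trans t00 th0) /=.
    by rewrite indicE mem_set ?mulr1//=; apply: h; rewrite th0.
  case: ifPn => // /andP[_ /ltW th1].
  by rewrite lee_fin mulr_ge0// cone_weight_ge0.
Qed.

Lemma cone_integral_ge0 i m (L : set 'rV[R]_i) x : (0 <= cone_integral m L x)%E.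
Proof.
apply: integral_ge0 => th /=; rewrite in_itv /= => /andP[_ /ltW th1].
by rewrite lee_fin mulr_ge0// cone_weight_ge0.
Qed.

End cone_weight.

(** * The inequality for a closed convex set *)

Section cone_inequality.
Context {R : realType} {i m n : nat}.
Variables (E1 : 'M[R]_(i, n)) (E2 : 'M[R]_(m, n)).
Hypotheses (dim : (i + m)%N = n) (E11 : E1 *m E1^T = 1%:M) (E22 : E2 *m E2^T = 1%:M)
  (E12 : E1 *m E2^T = 0).
Variable K : set 'rV[R]_n.
Hypotheses (clK : closed K) (cK : segment_closed K).
Local Notation mR := (measurableTypeR R).
Local Notation slice := (fiber E1 E2 K).
Local Notation L := (shadow E1 E2 K).

Let bK : borel_rV K. Proof. exact: borel_closed. Qed.
Let bL : borel_rV L. Proof. exact: borel_shadow. Qed.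
Let cL : segment_closed L. Proof. exact: segment_closed_shadow. Qed.

Lemma shadow0_star x (t t' : R) : L 0 -> 0 < t -> t <= t' -> L (t^-1 *: x) -> L (t'^-1 *: x).
Proof.
move=> L0 t0 tt' Lx; have t'0 : 0 < t' by exact: lt_le_trans tt'.
have l01 : 0 <= t / t' <= 1 by rewrite divr_ge0 ?(ltW t0) ?(ltW t'0)//= ler_pdivrMr// mul1r.
have := cL l01 L0 Lx; rewrite scaler0 add0r scalerA.
by rewrite (_ : t / t' / t = t'^-1)//; field; rewrite !gt_eqF.
Qed.

Lemma vol_slice0_gt0 : (0 < vol (slice 0))%E -> L 0.
Proof.
move=> b0; apply: contrapT => L0; move: b0.
rewrite (_ : slice 0 = set0) ?/vol ?preimage_set0 ?measure0 ?ltxx//.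
by apply/seteqP; split => // u Ku; apply: L0; exists u.
Qed.

Lemma vol_slice_ge_cone x : (0 < m)%N ->
  (vol (slice 0) * cone_integral m L x <= vol (slice x))%E.
Proof.
move=> mp.
have : (0 <= vol (slice 0))%E by exact: measure_ge0.
rewrite le_eqVlt => /predU1P[<-|b0].
  by rewrite mul0e measure_ge0.
have L0 := vol_slice0_gt0 b0.
have [Foo|] := ltP (vol (slice x)) +oo%E; last first.
  by rewrite leye_eq => /eqP ->; rewrite leey.
pose T := [set t : R | 0 < t < 1 /\ L (t^-1 *: x)].
have [[t1 Tt1]|T0] := pselect (T !=set0); last first.
  rewrite (_ : cone_integral m L x = 0%E) ?mule0 ?measure_ge0//.
  apply/eqP; rewrite eq_le cone_integral_ge0 andbT.
  have := @cone_integral_le R i m L x 1 mp bL; rewrite subrr expr0n gtn_eqF//=; apply; first lra.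
  by move=> th th01 Lx; exfalso; apply: T0; exists th.
have Tlb : lbound T 0 by move=> t [/andP[/ltW t0 _] _].
have hT : has_inf T by split; [exists t1|exists 0].
have t00 : 0 <= inf T by apply: lb_le_inf => //; exists t1.
have t01 : inf T < 1.
  by apply: (@le_lt_trans _ _ t1); [apply: ge_inf => //; exists 0|case: Tt1 => /andP[]].
apply: (@le_trans _ _ (vol (slice 0) * ((1 - inf T) ^+ m)%:E)%E).
  apply: lee_wpmul2l; first exact: measure_ge0.
  apply: cone_integral_le => //; first by rewrite t00 ltW.
  by move=> th th01 Lx; apply: ge_inf; [exists 0|split].
apply: (@le_of_exprn_le R m) => //.
  by apply: mule_ge0 => //; rewrite ?lee_fin ?exprn_ge0 ?subr_ge0 ?(ltW t01)// measure_ge0.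
move=> t /andP[tp tl1].
(* The gauge [inf T] may fail to be attained, because the shadow need not be closed. This [th] lies
   strictly above it and tends to it as [t] tends to 1. *)
pose th := 1 - t * (1 - inf T).
have i0 : 0 < 1 - inf T by rewrite subr_gt0.
have th1 : th < 1 by rewrite /th ltrBlDr ltrDl mulr_gt0.
have thinf : inf T < th by rewrite /th; nra.
have th0 : 0 < th by exact: le_lt_trans thinf.
have [t2 [/andP[t20 t21] Lt2] t2th] := inf_lt (ex_intro _ t1 Tt1) thinf.
have Lth : L (th^-1 *: x) by apply: shadow0_star Lt2 => //; exact: ltW.
have th01 : 0 <= th < 1 by rewrite ltW.
have := vol_slice_scale 0 bK cK th01 Lth.
rewrite scaler0 add0r scalerA divff ?gt_eqF// scale1r; apply: le_trans.
have -> : 1 - th = t * (1 - inf T) by rewrite /th; ring.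
by rewrite exprMn EFinM -muleA [X in (_ * X <= _)%E]muleC.
Qed.

Lemma vol_slice_rank0 x : m = 0%N -> L x -> vol (slice x) = 1%E.
Proof.
move=> m0 [u Ku]; case: m / (esym m0) E2 u Ku => F2 u Ku.
rewrite vol0E indicE mem_set// /fiber /=.
by move: Ku; rewrite /fiber /=; congr (K (_ + _ *m _)); apply/rowP => -[].
Qed.

Lemma vol_slice_le1 x : m = 0%N -> (vol (slice x) <= 1)%E.
Proof.
move=> m0; case: m / (esym m0) E2 => F2.
by rewrite vol0E indicE lee_fin; case: (_ \in _).
Qed.

Lemma vol_rank0 : m = 0%N -> vol K = vol L.
Proof.
move=> m0; rewrite (vol_slices dim E11 E22 E12 bK) /vol -[RHS]mul1e -integral_cst//.
rewrite [RHS]integral_mkcond; apply: eq_integral => t _; rewrite patchE.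
case: ifPn; rewrite ?inE /= => Lt; first exact: vol_slice_rank0.
rewrite (_ : fiber _ _ _ _ = set0) ?/vol ?preimage_set0 ?measure0//.
apply/seteqP; split => // u Ku; move: Lt; rewrite notin_setE; apply; by exists u.
Qed.

Lemma cone_volume_cone : (0 < m)%N -> (vol (slice 0) * (('C(n, i)%:R^-1)%:E * vol L) <= vol K)%E.
Proof.
move=> mp; rewrite (vol_slices dim E11 E22 E12 bK).
have := cone_integral_total bL mp; rewrite dim => <-.
rewrite -ge0_integralZl//; [|exact: measurable_cone_integral|by move=> t _; exact: cone_integral_ge0].
apply: ge0_le_integral => //.
- by move=> t _; apply: mule_ge0; [exact: measure_ge0|exact: cone_integral_ge0].
- by apply: emeasurable_funM => //; exact: measurable_cone_integral.
- exact: measurable_vol_slice.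
- by move=> t _; exact: vol_slice_ge_cone.
Qed.

Lemma cone_volume : (vol L * vol (slice 0) <= 'C(n, i)%:R%:E * vol K)%E.
Proof.
have C0 : 0 < 'C(n, i)%:R :> R by rewrite ltr0n bin_gt0 -dim leq_addr.
(* For [m = 0] the weight vanishes and the comparison with the cone is empty; slices are then points
   or empty, and the volume of [K] is that of its shadow. *)
case: (posnP m) => [m0|mp].
  have -> : 'C(n, i) = 1%N by rewrite -dim m0 addn0 binn.
  rewrite (vol_rank0 m0) mul1e -[leRHS]mule1.
  by apply: lee_wpmul2l; [exact: measure_ge0|exact: vol_slice_le1].
have := cone_volume_cone mp; rewrite -(@lee_pmul2l _ 'C(n, i)%:R%:E)//.
apply: le_trans; rewrite muleCA (muleA 'C(n, i)%:R%:E) -EFinM divff ?gt_eqF// mul1e.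
by rewrite muleC.
Qed.

End cone_inequality.

(** * Extremal bodies *)

Section extremal_bodies.
Context {R : realType} {i m n : nat}.
Variables (E1 : 'M[R]_(i, n)) (E2 : 'M[R]_(m, n)).
Hypotheses (dim : (i + m)%N = n) (E11 : E1 *m E1^T = 1%:M) (E22 : E2 *m E2^T = 1%:M)
  (E12 : E1 *m E2^T = 0).
Variable K : set 'rV[R]_n.
Hypotheses (ctK : compact K) (cK : segment_closed K) (K0 : K° !=set0).
Local Notation mR := (measurableTypeR R).
Local Notation slice := (fiber E1 E2 K).
Local Notation L := (shadow E1 E2 K).

Let clK : closed K. Proof. by apply: compact_closed => //; exact: norm_hausdorff. Qed.
Let bK : borel_rV K. Proof. exact: borel_closed. Qed.
Let bL : borel_rV L. Proof. exact: borel_shadow. Qed.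
Let cL : segment_closed L. Proof. exact: segment_closed_shadow. Qed.
Let ctL : compact L. Proof. exact: compact_shadow. Qed.
Let clL : closed L. Proof. by apply: compact_closed => //; exact: norm_hausdorff. Qed.

(* In coordinates: the slices over the ray spanned by [x] are those of the cone
   with base [slice 0] and apex [(sg *: x, w)]. *)
Definition conical_along (x : 'rV[R]_i) := exists (sg : R) (w : 'rV[R]_m),
  [/\ 0 <= sg, slice (sg *: x) w & forall s u, 0 <= s -> slice (s *: x) u ->
    exists th k, [/\ 0 <= th <= 1, s *: x = (th * sg) *: x, slice 0 k &
      u = (1 - th) *: k + th *: w]].

Lemma compact_norm_bounded p (A : set 'rV[R]_p) : compact A ->
  exists2 M : R, 0 < M & forall x, A x -> `|x| <= M.
Proof.
move=> /compact_bounded[M0 [_ hM]]; exists (`|M0| + 1).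
  by rewrite ltr_wpDl.
by move=> x Ax; apply: (hM _ _ x) => //; rewrite (le_lt_trans (ler_norm M0))// ltrDl.
Qed.

Lemma vol_compact_lty p (A : set 'rV[R]_p) : compact A -> (vol A < +oo)%E.
Proof.
move=> ctA; have [M M0 hM] := compact_norm_bounded ctA.
apply: (@le_lt_trans _ _ (((M - - M) ^+ p)%:E)); last by rewrite ltry.
rewrite -vol_box; last lra.
apply: vol_le; last by move=> x /hM xM k; rewrite -ler_norml (le_trans (coord_le_norm _ _)).
  by apply: borel_closed; apply: compact_closed => //; exact: norm_hausdorff.
exact: borel_box.
Qed.

Lemma vol_body_gt0 : (0 < vol K)%E.
Proof.
apply: lt_le_trans (vol_open_gt0 (open_interior K) K0) _.
by apply: vol_le => //; [exact: borel_interior|exact: interior_subset].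
Qed.

Lemma compact_slice x : compact (slice x).
Proof.
have [M M0 hM] := compact_norm_bounded ctK.
apply: bounded_closed_compact; last exact: closed_slice.
have : compact [set z *m E2^T | z in K].
  apply: continuous_compact => //; apply: continuous_subspaceT.
  by apply: (continuous_affine (M := E2^T)) => y z; rewrite mulmxBl.
move=> /compact_norm_bounded[N N0 hN]; exists N; split; first exact: num_real.
move=> N' NN' u Ku /=; apply: le_trans (ltW NN'); apply: hN.
by exists (x *m E1 + u *m E2) => //; rewrite proj2K.
Qed.

Lemma interior_of_vol_gt0 p (A : set 'rV[R]_p) : segment_closed A -> closed A ->
  (0 < vol A)%E -> A° !=set0.
Proof.
move=> cA clA A0; apply/set0P; apply: contraTneq A0 => Ai.
by have := vol_null_thin cA Ai; rewrite -(closure_id A).1// => ->; rewrite ltxx.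
Qed.

Lemma shadow0_star1 x (t : R) : L 0 -> 0 <= t <= 1 -> L x -> L (t *: x).
Proof. by move=> L0 t01 Lx; have := cL t01 L0 Lx; rewrite scaler0 add0r. Qed.

Section equality.
Hypothesis extremal : (vol L * vol (slice 0) = 'C(n, i)%:R%:E * vol K)%E.

Let C0 : 0 < 'C(n, i)%:R :> R.
Proof. by rewrite ltr0n bin_gt0 -dim leq_addr. Qed.

Let ab_gt0 : (0 < vol L * vol (slice 0))%E.
Proof. by rewrite extremal mule_gt0// vol_body_gt0. Qed.

Let a0 : (0 < vol L)%E.
Proof.
rewrite lt_def measure_ge0 andbT; apply: contraTN ab_gt0 => /eqP ->.
by rewrite mul0e ltxx.
Qed.

Let b0 : (0 < vol (slice 0))%E.
Proof.
rewrite lt_def measure_ge0 andbT; apply: contraTN ab_gt0 => /eqP ->.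
by rewrite mule0 ltxx.
Qed.

Let L0 : L 0. Proof. exact: vol_slice0_gt0 b0. Qed.

Lemma extremal_interior_shadow : L° !=set0.
Proof. exact: interior_of_vol_gt0. Qed.

Lemma extremal_interior_slice0 : (slice 0)° !=set0.
Proof. by apply: interior_of_vol_gt0 => //; [exact: segment_closed_slice|exact: closed_slice]. Qed.

Let vol_fin p (A : set 'rV[R]_p) : compact A -> vol A \is a fin_num.
Proof. by move=> ctA; rewrite ge0_fin_numE ?vol_compact_lty// measure_ge0. Qed.

(* Equality makes [vol (slice y)] equal to the cone profile for almost every [y];
   an excess at one point [z] would spread to an open set of points
   [(1 - tau) z + tau c] by convexity. *)
Lemma extremal_slice_le z t0 : L z -> 0 <= t0 <= 1 -> (t0 = 0 \/ ~ L (t0^-1 *: z)) ->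
  (vol (slice z) <= ((1 - t0) ^+ m)%:E * vol (slice 0))%E.
Proof.
move=> Lz t001 Lt0.
case: (posnP m) => [m0|mp].
  rewrite [X in (_ ^+ X)%:E](_ : _ = 0%N)// expr0 mul1e.
  by rewrite (vol_slice_rank0 m0 L0)// (vol_slice_rank0 m0 Lz).
rewrite leNgt; apply/negP => excess.
have [b bE] : exists b : R, vol (slice 0) = b%:E.
  by exists (fine (vol (slice 0))); rewrite fineK// vol_fin//; exact: compact_slice.
have [c cE] : exists c : R, vol (slice z) = c%:E.
  by exists (fine (vol (slice z))); rewrite fineK// vol_fin//; exact: compact_slice.
have bp : 0 < b by move: b0; rewrite bE lte_fin.
pose c2 := (1 - t0) ^+ m * b.
have c2c : c2 < c by move: excess; rewrite bE cE -EFinM lte_fin.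
have c20 : 0 <= c2.
  by apply: mulr_ge0; [apply: exprn_ge0; lra|exact: ltW].
pose c' := (c2 + c) / 2.
have c'c : c' < c by rewrite /c'; lra.
have cp : 0 < c by exact: le_lt_trans c2c.
have [t1 /andP[t10 t11] ht1] := exprn_near1 m cp c'c.
have [M M0 hM] := compact_norm_bounded ctL.
(* The shadow is closed, so the assumption that [t0] does not exceed the gauge persists near [z]. *)
have [r r0 hr] : exists2 r, 0 < r & forall y, `|z - y| < r -> t0 = 0 \/ ~ L (t0^-1 *: y).
  case: Lt0 => [->|nL]; first by exists 1 => // y _; left.
  have [->|t0n] := eqVneq t0 0; first by exists 1 => // y _; left.
  have [r r0 hr] : exists2 r, 0 < r & forall y, `|t0^-1 *: z - y| < r -> ~ L y.
    have /interior_normP : (~` L)° (t0^-1 *: z).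
      by apply: open_nbhs_nbhs; split => //; exact: closed_openC.
    by [].
  have t00 : 0 < t0 by rewrite lt_neqAle eq_sym t0n; case/andP: t001.
  exists (r * t0); first by rewrite mulr_gt0.
  move=> y yz; right; apply: hr; rewrite -scalerBr normrZ gtr0_norm ?invr_gt0//.
  by rewrite mulrC ltr_pdivrMr.
(* The first bound makes the excess survive the loss [(1 - tau) ^+ m]; the second keeps
   [(1 - tau) *: z + tau *: x] within [r / 2] of [z] for every [x] in the shadow. *)
pose tau := Num.min (t1 / 2) (r / (2 * (M + `|z|))).
have Mz : 0 < M + `|z| by rewrite ltr_pwDl.
have tau0 : 0 < tau by rewrite lt_min !divr_gt0// mulr_gt0.
have tau_t1 : tau < t1 by rewrite gt_min; apply/orP; left; lra.
have tau1 : tau < 1 by exact: lt_le_trans t11.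
pose U : set 'rV[R]_i := [set y | L° (tau^-1 *: (y + - ((1 - tau) *: z)))].
have oU : open U.
  have := @open_comp 'rV[R]_i 'rV[R]_i (fun y => tau^-1 *: (y + - ((1 - tau) *: z))) L°.
  apply; last exact: open_interior.
  move=> y _; apply: (continuous_affine (M := (tau^-1)%:M)) => y1 y2.
  by rewrite -scalerBr opprD addrACA subrr addr0 mul_mx_scalar.
have U0 : U !=set0.
  have [c0 Lc0] := extremal_interior_shadow; exists ((1 - tau) *: z + tau *: c0).
  by rewrite /U /= addrAC subrr add0r scalerA mulVf ?gt_eqF// scale1r.
have Uy y : U y -> (c'%:E <= vol (slice y))%E /\ (cone_integral m L y <= ((1 - t0) ^+ m)%:E)%E.
  move=> /interior_subset Lc.
  set x := tau^-1 *: _ in Lc.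
  have yE : y = (1 - tau) *: z + tau *: x.
    by rewrite /x scalerA mulfV ?gt_eqF// scale1r addrCA subrr addr0.
  split.
    have t01 : 0 <= tau < 1 by rewrite ltW.
    have := vol_slice_scale z bK cK t01 Lc; rewrite -yE; apply: le_trans.
    by rewrite cE -EFinM lee_fin ltW// ht1// ltW.
  have zy : `|z - y| < r.
    rewrite yE (_ : z - _ = tau *: (z - x)); last by apply/rowP => q; rewrite !mxE; ring.
    rewrite normrZ gtr0_norm//.
    apply: (@le_lt_trans _ _ (r / (2 * (M + `|z|)) * (M + `|z|))).
      apply: ler_pM => //; [exact: ltW|by rewrite ge_min lexx orbT|].
      by rewrite (le_trans (ler_normB _ _))// addrC lerD2r hM.
    rewrite (_ : _ * _ = r / 2); last by field; rewrite gt_eqF.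
    lra.
  apply: cone_integral_le => // th /andP[th0 th1] Lth.
  have [->|nL] := hr _ zy; first exact: ltW.
  rewrite leNgt; apply/negP => tht0; apply: nL.
  apply: shadow0_star (ltW tht0) Lth => //.
pose d := c' - c2.
have d0 : 0 < d by rewrite /d /c'; lra.
have volKE : (vol (slice 0) * (('C(n, i)%:R^-1)%:E * vol L) = vol K)%E.
  by rewrite muleCA (muleC (vol (slice 0))) extremal muleA -EFinM mulVf ?gt_eqF// mul1e.
have mU : measurable (@rv_of_tuple R i @^-1` U) by exact: borel_open.
(* The slices dominate the cone profile everywhere and exceed it by [d] on the open set [U], whereas
   the profile alone already integrates to the volume of [K]. *)
suff : (vol K + d%:E * vol U <= vol K)%E.
  rewrite -[leRHS]adde0 leeD2lE ?vol_fin// leNgt mule_gt0//.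
  exact: vol_open_gt0.
rewrite -{1}volKE.
have := cone_integral_total bL mp; rewrite dim => <-.
rewrite -ge0_integralZl//; [|exact: measurable_cone_integral|by move=> t _; exact: cone_integral_ge0].
have mG : measurable_fun setT (fun t : i.-tuple mR => (vol (slice 0) * cone_integral m L (rv_of_tuple t))%E).
  by apply: emeasurable_funM => //; exact: measurable_cone_integral.
have mI : measurable_fun setT (fun t : i.-tuple mR => (d * \1_(@rv_of_tuple R i @^-1` U) t)%:E).
  by apply/measurable_EFinP; apply: measurable_funM.
have -> : (d%:E * vol U = \int[lebesgue_tuple i]_t (d * \1_(@rv_of_tuple R i @^-1` U) t)%:E)%E.
  under eq_integral do rewrite EFinM.
  rewrite ge0_integralZl//; [|exact/measurable_EFinP|by rewrite lee_fin ltW].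
  by rewrite integral_indic// setIT.
have G0 t : (0 <= vol (slice 0) * cone_integral m L (rv_of_tuple t))%E.
  by apply: mule_ge0; [exact: measure_ge0|exact: cone_integral_ge0].
have I0 t : (0 <= (d * \1_(@rv_of_tuple R i @^-1` U) t)%:E)%E.
  by rewrite lee_fin mulr_ge0// ltW.
rewrite -ge0_integralD// (vol_slices dim E11 E22 E12 bK).
apply: ge0_le_integral => //.
- by move=> t _; exact: adde_ge0.
- exact: emeasurable_funD.
- exact: measurable_vol_slice.
move=> t _; rewrite indicE; have [Ut|Ut] := pselect (U (rv_of_tuple t)); last first.
  by rewrite memNset// mulr0 adde0; exact: vol_slice_ge_cone.
rewrite mem_set// mulr1; have [h1 h2] := Uy _ Ut.
apply: le_trans h1; rewrite (_ : c' = c2 + d); last by rewrite /d; ring.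
rewrite (_ : (c2 + d)%:E = (c2%:E + d%:E)%E)//; apply: leeD2r.
rewrite bE /c2 mulrC EFinM.
by apply: lee_wpmul2l => //; rewrite lee_fin ltW.
Qed.

(** The gauge of this point is [th] itself, but [extremal_slice_le] wants a [t0] strictly below it,
    or 0. Take [t0] with [1 - th = t * (1 - t0)] and let [t] tend to 1. *)
Lemma extremal_slice_ray x sg th : 0 < sg -> L (sg *: x) ->
  (forall s, 0 <= s -> L (s *: x) -> s <= sg) -> 0 <= th < 1 ->
  (vol (slice (th *: (sg *: x))) <= ((1 - th) ^+ m)%:E * vol (slice 0))%E.
Proof.
move=> sg0 Lsg Smax /andP[th0 th1].
have h0 : 0 < 1 - th by rewrite subr_gt0.
have Lz : L (th *: (sg *: x)) by apply: shadow0_star1 => //; rewrite th0 ltW.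
apply: (@le_of_exprn_le R m); first exact: measure_ge0.
  rewrite lte_mul_pinfty//; first by rewrite lee_fin exprn_ge0// ltW.
  by rewrite vol_compact_lty//; exact: compact_slice.
move=> t /andP[tp t1].
have [tle|tgt] := leP t (1 - th).
  apply: (@le_trans _ _ ((t ^+ m)%:E * vol (slice 0))%E).
    apply: lee_wpmul2l; first by rewrite lee_fin exprn_ge0// ltW.
    have := @extremal_slice_le _ 0 Lz; rewrite subr0 expr1n mul1e; apply; last by left.
    by rewrite lexx ler01.
  apply: lee_wpmul2r; first exact: measure_ge0.
  by rewrite lee_fin lerXn2r// nnegrE ltW.
pose t0 := 1 - (1 - th) / t.
have t0E : 1 - th = t * (1 - t0) by rewrite /t0; field; rewrite gt_eqF.
have t00 : 0 < t0 by rewrite /t0 subr_gt0 ltr_pdivrMr// mul1r.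
have t0th : t0 < th by rewrite -subr_gt0; rewrite (_ : th - t0 = (1 - t) * (1 - t0)); [apply: mulr_gt0; nra|lra].
rewrite t0E exprMn EFinM -muleA; apply: lee_wpmul2l; first by rewrite lee_fin exprn_ge0// ltW.
apply: extremal_slice_le => //; first by rewrite ltW//= ltW// (lt_trans t0th).
right; rewrite !scalerA => Lt.
have h : 0 <= t0^-1 * th * sg by rewrite !mulr_ge0// ?invr_ge0 ltW.
have := Smax _ h; rewrite -mulrA => /(_ Lt); rewrite leNgt => /negP; apply.
by rewrite mulrA ltr_pMl// mulrC ltr_pdivlMr// mul1r.
Qed.

(** The apex is any [w] over the last point [sg *: x] of the shadow on the ray. That the slice over
    this end point contains nothing but [w] is proved last. *)
Lemma extremal_conical x : conical_along x.
Proof.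
have [k0 Kk0] := L0.
(* A ray that meets the shadow only at 0: any point of the central slice is an apex, at height
   [sg = 0]. *)
have triv : (forall s, 0 <= s -> L (s *: x) -> s *: x = 0) -> conical_along x.
  move=> h; exists 0, k0; split => //; first by rewrite scale0r.
  move=> s u s0 Ku; exists 0, u.
  have sx : s *: x = 0 by apply: h => //; exists u.
  rewrite !subr0 mul0r !scale0r scale1r addr0 lexx ler01; split => //.
  by rewrite sx in Ku.
have [x0|x0] := eqVneq x 0; first by apply: triv => s _ _; rewrite x0 scaler0.
pose S := [set s : R | 0 <= s /\ L (s *: x)].
have S0 : S 0 by split => //; rewrite scale0r.
have [M M0 hM] := compact_norm_bounded ctL.
have nx : 0 < `|x| by rewrite normr_gt0.
have Sub : ubound S (M / `|x|).
  move=> s [s0 Ls]; rewrite ler_pdivlMr//.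
  by have := hM _ Ls; rewrite normrZ ger0_norm.
have hS : has_sup S by split; [exists 0|exists (M / `|x|)].
pose sg := sup S.
have sg0 : 0 <= sg by apply: ub_le_sup => //; exists (M / `|x|).
have Ssg : L (sg *: x).
  apply: clL; apply/closure_normP => e e0.
  have [s [s0 Ls] sse] := sup_adherent (divr_gt0 e0 nx) hS.
  exists (s *: x) => //; rewrite -scalerBl normrZ -ltr_pdivlMr// ger0_norm.
    by rewrite ltrBlDl -ltrBlDr.
  by rewrite subr_ge0; apply: ub_le_sup; [exists (M / `|x|)|].
have Smax s : 0 <= s -> L (s *: x) -> s <= sg.
  by move=> s0 Ls; apply: ub_le_sup; [exists (M / `|x|)|].
have [sgE|sgn] := eqVneq sg 0.
  apply: triv => s s0 Ls; have := Smax _ s0 Ls; rewrite sgE => s0'.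
  by rewrite (_ : s = 0) ?scale0r//; apply/eqP; rewrite eq_le s0'.
have sgp : 0 < sg by rewrite lt_neqAle eq_sym sgn.
have [w Kw] := Ssg.
(* Convexity gives one inclusion, [extremal_slice_ray] the reverse inequality of volumes, and
   [eq_closed_convex_vol] then gives equality. *)
have Cth th : 0 <= th < 1 ->
    slice (th *: (sg *: x)) = [set u | slice 0 ((1 - th)^-1 *: (u + - (th *: w)))].
  move=> /andP[th0 th1].
  have h0 : 0 < 1 - th by rewrite subr_gt0.
  apply/esym; apply: eq_closed_convex_vol.
  - have := @preimage_closed 'rV[R]_m 'rV[R]_m (fun u => (1 - th)^-1 *: (u + - (th *: w))) (slice 0).
    apply; last exact: closed_slice.
    move=> u _; apply: (continuous_affine (M := ((1 - th)^-1)%:M)) => y1 y2.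
    by rewrite -scalerBr opprD addrACA subrr addr0 mul_mx_scalar.
  - exact: closed_slice.
  - exact: segment_closed_slice.
  - apply: interior_of_vol_gt0; [exact: segment_closed_slice|exact: closed_slice|].
    have th01 : 0 <= th < 1 by rewrite th0.
    have := vol_slice_scale 0 bK cK th01 Ssg; rewrite scaler0 add0r.
    by apply: lt_le_trans; rewrite mule_gt0// lte_fin exprn_gt0.
  - move=> u /= Ku; have th01 : 0 <= th <= 1 by rewrite th0 ltW.
    have := slice_segment cK th01 Ku Kw; rewrite scaler0 add0r.
    rewrite [X in fiber _ _ _ _ X -> _](_ : _ = u)//.
    by apply/rowP => k; rewrite !mxE; field; rewrite gt_eqF.
  - rewrite (vol_translate _ (A := [set u | slice 0 ((1 - th)^-1 *: u)])).
      rewrite vol_scale//; last exact: borel_slice.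
      by apply: extremal_slice_ray => //; rewrite th0.
    by apply: borel_scale; exact: borel_slice.
  - rewrite (vol_translate _ (A := [set u | slice 0 ((1 - th)^-1 *: u)])).
      rewrite vol_scale//; last exact: borel_slice.
      by rewrite lte_mul_pinfty ?lee_fin ?exprn_ge0 ?ltW// vol_compact_lty//; exact: compact_slice.
    by apply: borel_scale; exact: borel_slice.
exists sg, w; split => // s u s0 Ku.
have ssg : s <= sg by apply: Smax => //; exists u.
have thE : s = s / sg * sg by rewrite divfK.
pose th := s / sg.
have th0 : 0 <= th by rewrite divr_ge0.
have th1 : th <= 1 by rewrite ler_pdivrMr// mul1r.
move: th1; rewrite le_eqVlt => /predU1P[th1|th1].
  exists 1, k0; rewrite ler01 lexx mul1r subrr scale0r add0r scale1r.
  have ssgE : s = sg by rewrite thE -/th th1 mul1r.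
  split => //; first by rewrite ssgE.
  apply/eqP; rewrite -subr_eq0 -normr_le0 leNgt; apply/negP => uw.
  have [N N0 hN] := compact_norm_bounded (@compact_slice 0).
  (* If [u] and [w] both lay over the end point, then for [t] near 0 or 1 alike [u - w] would be
     [(1 - t) / t] times a difference of two points of the central slice. The choice
     [(1 - t) / t = q] makes that at most half the norm of [u - w]. *)
  pose q := `|u - w| / (4 * N).
  pose t := (1 + q)^-1.
  have q0 : 0 < q by rewrite divr_gt0// mulr_gt0.
  have t0 : 0 < t by rewrite invr_gt0 addr_gt0.
  have t1 : t < 1 by rewrite invf_lt1 ?addr_gt0// ltrDl.
  have t01 : 0 <= t <= 1 by rewrite !ltW.
  have := slice_segment cK t01 Kk0 Ku; rewrite ssgE scaler0 add0r.
  rewrite Cth ?(ltW t0)//= => Kk.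
  have kE : u - w = ((1 - t) / t) *: ((1 - t)^-1 *: ((1 - t) *: k0 + t *: u + - (t *: w)) - k0).
    by apply/rowP => q'; rewrite !mxE; field; rewrite !gt_eqF// subr_gt0.
  have tE : (1 - t) / t = q.
    by rewrite /t; field; rewrite gt_eqF// addr_gt0.
  set k := (1 - t)^-1 *: _ in kE Kk.
  have : `|u - w| <= q * (N + N).
    rewrite kE normrZ tE gtr0_norm//; apply: ler_wpM2l; first exact: ltW.
    by rewrite (le_trans (ler_normB _ _))// lerD// hN.
  rewrite leNgt => /negP; apply.
  rewrite (_ : q * (N + N) = `|u - w| / 2); last by rewrite /q; field; rewrite gt_eqF.
  lra.
exists th, ((1 - th)^-1 *: (u + - (th *: w))); split => //.
- by rewrite th0 ltW.
- by rewrite -thE.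
- have := Cth th; rewrite th0 th1 scalerA -thE => /(_ isT) E.
  by rewrite E in Ku.
- by apply/rowP => q; rewrite !mxE; field; rewrite gt_eqF// subr_gt0.
Qed.

End equality.

(** By [cone_volume] only the reverse bound is left. With [th1 = sg^-1], the slice over [x] lies in
    a copy of the central slice scaled by [1 - th1], and the cone profile at [x] is at least
    [(1 - th1) ^+ m]. *)
Lemma conical_extremal : slice 0 !=set0 -> (forall x, conical_along x) ->
  (vol L * vol (slice 0) = 'C(n, i)%:R%:E * vol K)%E.
Proof.
move=> [k0 Kk0] con.
have L0 : L 0 by exists k0.
case: (posnP m) => [m0|mp].
  have -> : 'C(n, i) = 1%N by rewrite -dim m0 addn0 binn.
  by rewrite (vol_rank0 dim E11 E22 E12 clK m0) (vol_slice_rank0 m0 L0) mule1 mul1e.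
have C0 : 0 < 'C(n, i)%:R :> R by rewrite ltr0n bin_gt0 -dim leq_addr.
apply/eqP; rewrite eq_le cone_volume//=.
rewrite (vol_slices dim E11 E22 E12 bK).
have -> : (vol L * vol (slice 0) = 'C(n, i)%:R%:E *
    \int[lebesgue_tuple i]_t (vol (slice 0) * cone_integral m L (rv_of_tuple t)))%E.
  rewrite ge0_integralZl//; [|exact: measurable_cone_integral|by move=> t _; exact: cone_integral_ge0].
  rewrite (cone_integral_total bL mp) dim muleCA (muleA 'C(n, i)%:R%:E) -EFinM divff ?gt_eqF// mul1e.
  by rewrite muleC.
apply: lee_wpmul2l; first by rewrite lee_fin ltW.
apply: ge0_le_integral => //.
- exact: measurable_vol_slice.
- by apply: emeasurable_funM => //; exact: measurable_cone_integral.
move=> t _; set x := rv_of_tuple t.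
have [[u1 Ku1]|Lx] := pselect (L x); last first.
  rewrite (_ : slice x = set0); first by rewrite /vol preimage_set0 measure0 mule_ge0// cone_integral_ge0.
  by apply/seteqP; split => // u Ku; apply: Lx; exists u.
have b0 : (0 <= vol (slice 0))%E by exact: measure_ge0.
have [x0|x0] := eqVneq x 0.
  rewrite x0 -[leLHS]mule1; apply: lee_wpmul2l => //.
  have := @cone_integral_ge R i m L 0 0 mp bL; rewrite subr0 expr1n; apply.
    by rewrite lexx ler01.
  by move=> th _; rewrite scaler0.
have [sg [w [sg0 Kw hw]]] := con x.
have K1 u : slice x u -> exists th k, [/\ 0 <= th <= 1, th * sg = 1, slice 0 k &
      u = (1 - th) *: k + th *: w].
  move=> Ku; have [|th [k [th01 thE Kk uE]]] := hw 1 u ler01; first by rewrite scale1r.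
  exists th, k; split => //; apply/eqP; rewrite -subr_eq0.
  have : (1 - th * sg) *: x == 0 by rewrite scalerBl -thE subrr.
  by rewrite scaler_eq0 (negbTE x0) orbF -opprB oppr_eq0.
have [th1 [k1 [/andP[th10 th11] th1E Kk1 u1E]]] := K1 _ Ku1.
have sgn : sg != 0 by apply: contra_eq_neq th1E => ->; rewrite mulr0 eq_sym oner_eq0.
have sgp : 0 < sg by rewrite lt_neqAle eq_sym sgn.
have thE : th1 = sg^-1 by rewrite -[LHS]mulr1 -(mulfV sgn) mulrA th1E mul1r.
have {}K1 u : slice x u -> exists2 k, slice 0 k & u = (1 - th1) *: k + th1 *: w.
  move=> /K1[th [k [_ thsg Kk uE]]]; exists k => //.
  by rewrite uE (_ : th = th1)// thE -[LHS]mulr1 -(mulfV sgn) mulrA thsg mul1r.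
have th1p : 0 < th1 by rewrite thE invr_gt0.
apply: (@le_trans _ _ (vol (slice 0) * ((1 - th1) ^+ m)%:E)%E); last first.
  apply: lee_wpmul2l => //; apply: cone_integral_ge => //; first by rewrite th10.
  move=> th /andP[thp _].
  have th0 : 0 < th by exact: lt_trans thp.
  rewrite (_ : th^-1 *: x = (th1 / th) *: (sg *: x)).
    apply: shadow0_star1 => //; last by exists w.
    by rewrite divr_ge0 ?(ltW th0)//= ler_pdivrMr// mul1r ltW.
  by rewrite !scalerA; congr (_ *: _); rewrite mulrAC th1E mul1r.
move: th11; rewrite le_eqVlt => /predU1P[e|th1l].
  rewrite e subrr expr0n gtn_eqF// mule0.
  (* For [th1 = 1] the slice is contained in the single point [w], that is, in a translated box of
     side 0. *)
  have bx : borel_rV [set v : 'rV[R]_m | forall q, 0 <= v ord0 q <= 0] by exact: borel_box.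
  apply: (@le_trans _ _ (vol [set u : 'rV[R]_m | [set v | forall q, 0 <= v ord0 q <= 0] (u + - w)])).
    apply: vol_le; [exact: borel_slice|exact: (borel_translate (- w) bx)|].
    move=> u /K1[k' _ ->] q; rewrite e subrr scale0r add0r scale1r subrr mxE lexx.
    by [].
  rewrite (vol_translate (- w) bx).
  by rewrite vol_box// subrr expr0n gtn_eqF.
have h0 : 0 < 1 - th1 by rewrite subr_gt0.
rewrite muleC -vol_scale//; last exact: borel_slice.
have bs := borel_scale (1 - th1)^-1 (@borel_slice R i m n E1 E2 K 0 bK).
rewrite -(vol_translate (- (th1 *: w)) bs).
apply: vol_le; [exact: borel_slice|exact: (borel_translate _ bs)|].
move=> u /K1[k Kk ->] /=; rewrite addrK scalerA mulVf ?gt_eqF// scale1r //.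
Qed.

End extremal_bodies.

(** * Layer cakes and Chebyshev's inequality *)

Import HBNNSimple.

Section layers.
Context {R : realType} d (T : measurableType d) (mu : {sigma_finite_measure set T -> \bar R}).
Local Notation mR := (measurableTypeR R).
Local Notation leb := (@lebesgue_measure R).

(** The superlevel sets of a monotone function on an interval are intervals. *)
Lemma nonincreasing_emeasurable (D : set R) (a : R -> \bar R) : is_interval D ->
  (forall s t, D s -> D t -> s <= t -> (a t <= a s)%E) ->
  measurable_fun (D : set mR) a.
Proof.
move=> iD na mD; apply: (measurability _ (ErealGenOInfty.measurableE R)) => // _ [_ [x ->] <-].
apply: is_interval_measurable => s t/= [Ds sx] [Dt tx] r /andP[sr rt].
have Dr : D r by apply: (iD s t) => //; rewrite sr.
split => //; move: tx; rewrite /= !in_itv/= !andbT => tx; apply: lt_le_trans tx _.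
exact: na.
Qed.

Lemma layer_cake (h : T -> R) : measurable_fun setT (h : T -> mR) -> (forall x, 0 <= h x) ->
  (\int[mu]_x (h x)%:E = \int[leb]_(s in `]0%R, +oo[) mu [set x : T | (s < h x)%R])%E.
Proof.
move=> mh h0.
pose S : set (T * mR) := [set p | 0 < p.2] `&` [set p | p.2 < h p.1].
have mS : measurable S.
  apply: measurableI.
    rewrite (_ : [set p | _] = setT `&` (fun p : T * mR => p.2) @^-1` `]0, +oo[%classic).
      by apply: measurable_snd.
    by rewrite setTI; apply/seteqP; split => p /=; rewrite in_itv/= andbT.
  have mf : measurable_fun setT (fun p : T * mR => p.2 < h p.1).
    apply: measurable_fun_ltr; first exact: measurable_snd.
    by apply: measurableT_comp mh _; exact: measurable_fst.
  have := mf measurableT [set true] I; rewrite setTI.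
  by congr measurable; apply/seteqP; split => p /=.
transitivity ((mu \x leb) S)%E.
  rewrite /product_measure1; apply: eq_integral => x _ /=.
  rewrite (_ : xsection S x = `]0, h x[%classic); last first.
    apply/seteqP; split => s; rewrite /xsection /= inE /S /= in_itv/=.
      by move=> [-> ->].
    by move=> /andP[].
  rewrite lebesgue_measure_itv/= lte_fin; have := h0 x; rewrite le_eqVlt => /predU1P[<-|->].
    by rewrite ltxx.
  by rewrite oppr0 addr0.
rewrite product_measure1_ysection// [RHS]integral_mkcond; apply: eq_integral => s _ /=.
rewrite patchE mem_setE in_itv/= andbT; case: ifPn => s0.
  congr (mu _); apply/seteqP; split => x; rewrite /ysection /= inE /S /=; first by case.
  by [].
rewrite (_ : ysection _ _ = set0) ?measure0//.
by apply/seteqP; split => x; rewrite // /ysection /= inE /S /= (negbTE s0) => -[].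
Qed.

Lemma layer_cake_itv (h : T -> R) c : measurable_fun setT (h : T -> mR) -> (forall x, 0 <= h x <= c) ->
  (\int[mu]_x (h x)%:E = \int[leb]_(s in `]0%R, c[) mu [set x : T | (s < h x)%R])%E.
Proof.
move=> mh hc; rewrite layer_cake//; last by move=> x; case/andP: (hc x).
rewrite [LHS]integral_mkcond [RHS]integral_mkcond; apply: eq_integral => s _ /=.
rewrite !patchE !mem_setE !in_itv/= andbT; case: (ltP 0 s) => //= s0; case: ifPn => // /negbTE sc.
rewrite (_ : [set x | _] = set0) ?measure0//.
apply/seteqP; split => // x /= sx; have /andP[_ hx] := hc x.
by move: sc; rewrite (lt_le_trans sx hx).
Qed.

(** [g] may be non-measurable: the layer-cake formula is applied to each simple minorant, whose
    level sets are contained in the measurable sets [A s]. *)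
Lemma integral_le_layers (g : T -> \bar R) (A : R -> set T) (c : R) :
  (forall x, (0 <= g x <= c%:E)%E) -> (forall s, 0 < s < c -> measurable (A s)) ->
  (forall s x, 0 < s < c -> (s%:E < g x)%E -> A s x) ->
  measurable_fun `]0, c[%classic (fun s => mu (A s)) ->
  (\int[mu]_x g x <= \int[leb]_(s in `]0%R, c[) mu (A s))%E.
Proof.
move=> g0c mA gA mmA.
rewrite ge0_integralTE => [|x]; last by case/andP: (g0c x).
apply: ge_ereal_sup => _ [h /= hg <-].
have hc x : 0 <= h x <= c.
  rewrite fun_ge0/= -lee_fin (le_trans (hg x))//; by case/andP: (g0c x).
rewrite -[sintegral _ _]/(sintegral mu h) (_ : sintegral mu h = \int[mu]_x (h x)%:E)%E; last first.
  by rewrite integral_nnsfun// patch_setT.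
rewrite (layer_cake_itv (c := c))//; last by apply: (@measurable_funPT _ _ _ _ h).
have mh s : measurable [set x | s < h x].
  rewrite (_ : [set x | _] = setT `&` h @^-1` `]s, +oo[%classic).
    by apply: (@measurable_funPT _ _ _ _ h).
  by rewrite setTI; apply/seteqP; split => x /=; rewrite in_itv/= andbT.
apply: ge0_le_integral => //.
  have mono : measurable_fun `]0, c[%classic (fun s : R => mu [set x | s < h x]).
    apply: nonincreasing_emeasurable; first exact: interval_is_interval.
    move=> s t _ _ st; apply: le_measure; rewrite ?inE//.
    by move=> x; exact: le_lt_trans.
  exact: mono.
move=> s; rewrite /= in_itv/= => s0c.
apply: le_measure; rewrite ?inE//; first exact: mA.
by move=> x /= sh; apply: gA => //; apply: lt_le_trans (hg x); rewrite lte_fin.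
Qed.

(** Monotonicity without measurability: every simple minorant of [h] is one of [g]. *)
Lemma ge0_le_integralT (g h : T -> \bar R) : (forall x, 0 <= h x)%E ->
  (forall x, h x <= g x)%E -> (\int[mu]_x h x <= \int[mu]_x g x)%E.
Proof.
move=> h0 hg; rewrite !ge0_integralTE// => [|x]; last exact: le_trans (hg x).
by apply: le_ereal_sup => _ [k /= kh <-]; exists k => // x; exact: le_trans (hg x).
Qed.

(** The set where [g] is positive is covered by the null sets [A k.+1%:R^-1], and [g] is dominated
    by [+oo] on their union. *)
Lemma integral_null_levels (g : T -> \bar R) (A : R -> set T) : (forall x, 0 <= g x)%E ->
  (forall s, 0 < s -> measurable (A s)) -> (forall s, 0 < s -> mu (A s) = 0%E) ->
  (forall s x, 0 < s -> (s%:E < g x)%E -> A s x) -> (\int[mu]_x g x = 0)%E.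
Proof.
move=> g0 mA A0 gA; apply/eqP; rewrite eq_le integral_ge0// andbT.
pose N := \bigcup_(k : nat) A k.+1%:R^-1.
have mN : measurable N by apply: bigcup_measurable => k _; apply: mA; rewrite invr_gt0.
have N0 : mu N = 0%E.
  apply: measure_negligible => //; apply: negligible_bigcup => k.
  by apply/negligibleP; [apply: mA|apply: A0]; rewrite invr_gt0.
have <- : (\int[mu]_(t in N) +oo = 0)%E.
  by rewrite integral_cst// [X in (_ * X)%E](_ : _ = 0%E)// mule0.
rewrite [leRHS]integral_mkcond; apply: ge0_le_integralT => // t.
rewrite patchE; case: ifPn => [_|]; first by rewrite leey.
rewrite notin_setE => Nt; rewrite leNgt; apply/negP => gt0.
have [k kg] : exists k, (k.+1%:R^-1%:E < g t)%E.
  move: gt0; case: (g t) => [r| |]//; last by exists 0%N; rewrite ltry.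
  rewrite lte_fin => r0.
  have := near_infty_natSinv_lt (PosNum r0).
  by case=> k _ /(_ k (leqnn _)) /= ?; exists k.
by apply: Nt; exists k => //; apply: gA => //; rewrite invr_gt0.
Qed.

End layers.

Lemma mule_rearrange {R : realType} (x x' y y' : \bar R) : (0 <= x')%E -> (0 <= y')%E ->
  (x' <= x)%E -> (y' <= y)%E -> (x * y' + x' * y <= x * y + x' * y')%E.
Proof.
move=> x'0 y'0 xx yy.
have x0 := le_trans x'0 xx; have y0 := le_trans y'0 yy.
have [y00|yn] := eqVneq y 0%E.
  have y'00 : y' = 0%E by apply/eqP; rewrite eq_le y'0 -y00 yy.
  by rewrite y00 y'00 !mule0 adde0.
have [x00|xn] := eqVneq x 0%E.
  have x'00 : x' = 0%E by apply/eqP; rewrite eq_le x'0 -x00 xx.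
  by rewrite x00 x'00 !mul0e adde0.
have yp : (0 < y)%E by rewrite lt_def yn.
have xp : (0 < x)%E by rewrite lt_def xn.
have [xoo|xoo] := eqVneq x +oo%E.
  by rewrite [X in (_ <= X * _ + _)%E]xoo gt0_mulye// addye ?leey// -ltNye (lt_le_trans _ (mule_ge0 x'0 y'0)).
have [yoo|yoo] := eqVneq y +oo%E.
  by rewrite [X in (_ <= _ * X + _)%E]yoo gt0_muley// addye ?leey// -ltNye (lt_le_trans _ (mule_ge0 x'0 y'0)).
have xf : x \is a fin_num by rewrite ge0_fin_numE// ltey.
have yf : y \is a fin_num by rewrite ge0_fin_numE// ltey.
have x'f : x' \is a fin_num by rewrite ge0_fin_numE// (le_lt_trans xx)// ltey.
have y'f : y' \is a fin_num by rewrite ge0_fin_numE// (le_lt_trans yy)// ltey.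
move: xx yy; rewrite -(fineK xf) -(fineK yf) -(fineK x'f) -(fineK y'f).
rewrite -!EFinM -!EFinD !lee_fin => xx yy.
rewrite -subr_ge0 (_ : _ - _ = (fine x - fine x') * (fine y - fine y')); last ring.
by rewrite mulr_ge0// subr_ge0.
Qed.

(** * Chebyshev's inequality, with a gap term that serves the equality case *)

Section chebyshev.
Context {R : realType} d (T : measurableType d) (mu : {measure set T -> \bar R}).
Variables (E F1 F2 : set T) (c p q : R) (a b : T -> \bar R).
Hypotheses (mE : measurable E) (mF1 : measurable F1) (mF2 : measurable F2).
Hypotheses (F1E : F1 `<=` E) (F2E : F2 `<=` E).
Hypotheses (Ec : mu E = c%:E) (F1p : mu F1 = p%:E) (F2q : mu F2 = q%:E).
Hypotheses (ma : measurable_fun E a) (mb : measurable_fun E b)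
  (a0 : forall s, (0 <= a s)%E) (b0 : forall s, (0 <= b s)%E).
Local Notation A := (\int[mu]_(s in E) a s)%E.
Local Notation B := (\int[mu]_(s in E) b s)%E.
Local Notation P := (\int[mu]_(s in E) (a s * b s))%E.

Let int_cst (x : \bar R) : (\int[mu]_(s in E) x = c%:E * x)%E.
Proof. by rewrite integral_cst// Ec muleC. Qed.

Let int_step (F : set T) (r k : R) : 0 <= r -> measurable F -> F `<=` E -> mu F = k%:E ->
  (\int[mu]_(s in E) (r * \1_F s)%:E = (r * k)%:E)%E.
Proof.
move=> r0 mF FE Fk.
under eq_integral do rewrite EFinM.
rewrite ge0_integralZl//; last exact/measurable_EFinP.
by rewrite integral_indic// setIidl// Fk.
Qed.

(* Integrate the hypothesis in [s] and in [t]. *)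
Lemma chebyshev_gap (e : R) : 0 <= e ->
  (forall s t, E s -> E t ->
    (a s * b t + a t * b s + (e * \1_F1 s * \1_F2 t)%:E <= a s * b s + a t * b t)%E) ->
  (A * B + A * B + (e * p * q)%:E <= c%:E * P + c%:E * P)%E.
Proof.
move=> e0 h.
have A0 : (0 <= A)%E by apply: integral_ge0.
have B0 : (0 <= B)%E by apply: integral_ge0.
have ab0 s : (0 <= a s * b s)%E by exact: mule_ge0.
have P0 : (0 <= P)%E by apply: integral_ge0.
have mab : measurable_fun E (fun s => a s * b s)%E by exact: emeasurable_funM.
have i0 (F : set T) x : 0 <= \1_F x :> R by rewrite indicE ler0n.
have i10 x : 0 <= e * \1_F1 x by rewrite mulr_ge0.
have p0 : 0 <= p by rewrite -lee_fin -F1p measure_ge0.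
have q0 : 0 <= q by rewrite -lee_fin -F2q measure_ge0.
have c0 : 0 <= c by rewrite -lee_fin -Ec measure_ge0.
have mi (k : R) (F : set T) : measurable F -> measurable_fun E (fun t => (k * \1_F t)%:E).
  by move=> mF; apply/measurable_EFinP; apply: measurable_funM => //; exact: measurable_indic.
have mZ (k : \bar R) (f : T -> \bar R) : measurable_fun E f -> measurable_fun E (fun t => k * f t)%E.
  by move=> mf; apply: emeasurable_funM.
have mZr (k : \bar R) (f : T -> \bar R) : measurable_fun E f -> measurable_fun E (fun t => f t * k)%E.
  by move=> mf; apply: emeasurable_funM.
have step s : E s -> (a s * B + A * b s + (e * q * \1_F1 s)%:E <= c%:E * (a s * b s) + P)%E.
  move=> Es.
  have -> : (a s * B + A * b s + (e * q * \1_F1 s)%:E = \int[mu]_(t in E)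
     (a s * b t + a t * b s + (e * \1_F1 s * \1_F2 t)%:E))%E.
    rewrite ge0_integralD//; first last.
    - exact: mi.
    - by move=> t _; rewrite lee_fin mulr_ge0.
    - by apply: emeasurable_funD; [exact: mZ|exact: mZr].
    - by move=> t _; rewrite adde_ge0// mule_ge0.
    rewrite ge0_integralD//; first last.
    - exact: mZr.
    - by move=> t _; rewrite mule_ge0.
    - exact: mZ.
    - by move=> t _; rewrite mule_ge0.
    by rewrite ge0_integralZl// ge0_integralZr// (int_step _ mF2 F2E F2q)// mulrAC.
  have -> : (c%:E * (a s * b s) + P = \int[mu]_(t in E) (a s * b s + a t * b t))%E.
    by rewrite ge0_integralD// int_cst.
  apply: ge0_le_integral => //.
  - by move=> t _; rewrite !adde_ge0// ?mule_ge0// lee_fin mulr_ge0.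
  - apply: emeasurable_funD; last exact: mi.
    by apply: emeasurable_funD; [exact: mZ|exact: mZr].
  - exact: emeasurable_funD.
  - by move=> t Et; exact: h.
have -> : (A * B + A * B + (e * p * q)%:E =
    \int[mu]_(s in E) (a s * B + A * b s + (e * q * \1_F1 s)%:E))%E.
  rewrite ge0_integralD//; first last.
  - exact: mi.
  - by move=> t _; rewrite lee_fin !mulr_ge0.
  - by apply: emeasurable_funD; [exact: mZr|exact: mZ].
  - by move=> t _; rewrite adde_ge0// mule_ge0.
  rewrite ge0_integralD//; first last.
  - exact: mZ.
  - by move=> t _; rewrite mule_ge0.
  - exact: mZr.
  - by move=> t _; rewrite mule_ge0.
  by rewrite ge0_integralZl// ge0_integralZr// (int_step _ mF1 F1E F1p) ?mulr_ge0// mulrAC.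
have -> : (c%:E * P + c%:E * P = \int[mu]_(s in E) (c%:E * (a s * b s) + P))%E.
  rewrite ge0_integralD//; last 2 first.
  - by move=> t _; rewrite mule_ge0.
  - exact: mZ.
  by rewrite ge0_integralZl// int_cst.
apply: ge0_le_integral => //.
- by move=> t _; rewrite !adde_ge0// ?mule_ge0// lee_fin !mulr_ge0.
- apply: emeasurable_funD; last exact: mi.
  by apply: emeasurable_funD; [exact: mZr|exact: mZ].
- by apply: emeasurable_funD => //; exact: mZ.
Qed.

End chebyshev.

Section chebyshev_monotone.
Context {R : realType}.
Local Notation mR := (measurableTypeR R).
Local Notation leb := (@lebesgue_measure R).
Variables (c : R) (a b : R -> \bar R).
Hypothesis c0 : 0 < c.
Hypotheses (na : forall s t, 0 < s -> s <= t -> t < c -> (a t <= a s)%E)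
  (nb : forall s t, 0 < s -> s <= t -> t < c -> (b t <= b s)%E).
Hypotheses (a0 : forall s, (0 <= a s)%E) (b0 : forall s, (0 <= b s)%E).
Local Notation A := (\int[leb]_(s in `]0%R, c[) a s)%E.
Local Notation B := (\int[leb]_(s in `]0%R, c[) b s)%E.
Local Notation P := (\int[leb]_(s in `]0%R, c[) (a s * b s))%E.

Lemma nonincreasing_itv_measurable (h : R -> \bar R) :
  (forall s t, 0 < s -> s <= t -> t < c -> (h t <= h s)%E) ->
  measurable_fun (`]0, c[%classic : set mR) h.
Proof.
move=> nh; apply: nonincreasing_emeasurable; first exact: interval_is_interval.
by move=> s t; rewrite /= !in_itv/= => /andP[s0 _] /andP[_ tc] st; exact: nh.
Qed.

Let leb_itv (x y : R) : x <= y -> leb (`]x, y[%classic : set mR) = (y - x)%:E.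
Proof.
move=> xy; rewrite lebesgue_measure_itv/= lte_fin; move: xy; rewrite le_eqVlt => /predU1P[->|->//].
by rewrite ltxx subrr.
Qed.

Let leb_itv0 (y : R) : 0 <= y -> leb (`]0, y[%classic : set mR) = y%:E.
Proof. by move=> y0; rewrite leb_itv// subr0. Qed.

Lemma rearrange_monotone s t : 0 < s < c -> 0 < t < c ->
  (a s * b t + a t * b s <= a s * b s + a t * b t)%E.
Proof.
move=> /andP[s0 sc] /andP[t0 tc]; have [st|/ltW ts] := leP s t.
  by apply: mule_rearrange => //; [exact: na|exact: nb].
rewrite addeC [leRHS]addeC.
by apply: mule_rearrange => //; [exact: na|exact: nb].
Qed.

Lemma chebyshev_le : (A * B <= c%:E * P)%E.
Proof.
have := @chebyshev_gap R _ _ leb `]0, c[%classic set0 set0 c 0 0 a b.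
move=> /(_ (measurable_itv _) measurable0 measurable0 (@sub0set _ _) (@sub0set _ _)).
move=> /(_ (leb_itv0 (ltW c0)) (measure0 _) (measure0 _) (nonincreasing_itv_measurable na) (nonincreasing_itv_measurable nb) a0 b0 0 (lexx _)).
have h s t : `]0, c[%classic s -> `]0, c[%classic t ->
    (a s * b t + a t * b s + (0 * \1_set0 s * \1_set0 t)%:E <= a s * b s + a t * b t)%E.
  by rewrite /= !in_itv/= => sc tc; rewrite !mul0r adde0; exact: rearrange_monotone.
move=> /(_ h); rewrite !mul0r adde0 => AB.
have A0 : (0 <= A)%E by apply: integral_ge0.
have B0 : (0 <= B)%E by apply: integral_ge0.
have P0 : (0 <= P)%E by apply: integral_ge0 => s _; exact: mule_ge0.
(* Halving the doubled inequality in extended reals: a failure would make [c%:E * P] finite, and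
   then strict inequalities can be added. *)
rewrite leNgt; apply/negP => PA; move: AB; rewrite leNgt => /negP; apply.
have PAf : (c%:E * P)%E \is a fin_num.
  by rewrite ge0_fin_numE ?mule_ge0// ?lee_fin ?(ltW c0)// (lt_le_trans PA)// leey.
by rewrite lte_leD// ltW.
Qed.

(* A strict decrease of [a] somewhere and of [b] somewhere gives a rectangle
   near the corner (0, c) on which the rearrangement defect is bounded below. *)
Lemma chebyshev_eq s1 s2 t1 t2 : (forall s, 0 < s < c -> a s \is a fin_num) ->
  (forall s, 0 < s < c -> b s \is a fin_num) -> (P < +oo)%E -> (A * B = c%:E * P)%E ->
  0 < s1 -> s1 <= s2 -> s2 < c -> (a s2 < a s1)%E ->
  0 < t1 -> t1 <= t2 -> t2 < c -> (b t2 < b t1)%E -> False.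
Proof.
move=> af bf Poo ABP s10 s12 s2c as12 t10 t12 t2c bt12.
pose p := Num.min s1 t1; pose q := Num.max s2 t2.
have p0 : 0 < p by rewrite lt_min s10.
have qc : q < c by rewrite gt_max s2c.
have ps1 : p <= s1 by rewrite ge_min lexx.
have pt1 : p <= t1 by rewrite ge_min lexx orbT.
have s2q : s2 <= q by rewrite le_max lexx.
have t2q : t2 <= q by rewrite le_max lexx orbT.
have pq : p <= q by rewrite (le_trans ps1)// (le_trans s12).
have s1c : 0 < s1 < c by rewrite s10 (le_lt_trans s12).
have s2c' : 0 < s2 < c by rewrite s2c (lt_le_trans s10).
have t1c : 0 < t1 < c by rewrite t10 (le_lt_trans t12).
have t2c' : 0 < t2 < c by rewrite t2c (lt_le_trans t10).
pose e := (fine (a s1) - fine (a s2)) * (fine (b t1) - fine (b t2)).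
have e0 : 0 < e.
  apply: mulr_gt0; rewrite subr_gt0.
    by rewrite -lte_fin !fineK// af.
  by rewrite -lte_fin !fineK// bf.
have := @chebyshev_gap R _ _ leb `]0, c[%classic `]0, p[%classic `]q, c[%classic c p (c - q) a b.
move=> /(_ (measurable_itv _) (measurable_itv _) (measurable_itv _)).
have F1E : `]0, p[ `<=` `]0, c[%classic.
  by apply: subset_itvl; rewrite bnd_simp (le_trans pq)// ltW.
have F2E : `]q, c[ `<=` `]0, c[%classic.
  by apply: subset_itvr; rewrite bnd_simp (le_trans (ltW p0)).
move=> /(_ F1E F2E).
move=> /(_ (leb_itv0 (ltW c0)) (leb_itv0 (ltW p0)) (leb_itv (ltW qc)) (nonincreasing_itv_measurable na) (nonincreasing_itv_measurable nb) a0 b0 e (ltW e0)).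
have h s t : `]0, c[%classic s -> `]0, c[%classic t ->
    (a s * b t + a t * b s + (e * \1_`]0, p[%classic s * \1_`]q, c[%classic t)%:E <= a s * b s + a t * b t)%E.
  rewrite /= !in_itv/= => sc tc; rewrite !indicE !mem_setE !in_itv/=.
  have [sp|sp] := ltP s p; last by rewrite andbF mulr0 mul0r adde0; exact: rearrange_monotone.
  have [tq|tq] := ltP q t; last by rewrite /= mulr0 adde0; exact: rearrange_monotone.
  have /andP[s0 _] := sc; have /andP[_ tc'] := tc.
  rewrite s0 tc' !mulr1.
  move: (na s0 (le_trans (ltW sp) ps1) (proj2 (andP s1c))).
  move: (nb s0 (le_trans (ltW sp) pt1) (proj2 (andP t1c))).
  move: (na (proj1 (andP s2c')) (le_trans s2q (ltW tq)) tc').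
  move: (nb (proj1 (andP t2c')) (le_trans t2q (ltW tq)) tc').
  rewrite -(fineK (af _ sc)) -(fineK (bf _ sc)) -(fineK (af _ tc)) -(fineK (bf _ tc)).
  rewrite -(fineK (af _ s1c)) -(fineK (af _ s2c')) -(fineK (bf _ t1c)) -(fineK (bf _ t2c')).
  rewrite -!EFinM -!EFinD !lee_fin => h1 h2 h3 h4.
  rewrite -lerBrDl (_ : _ - _ = (fine (a s) - fine (a t)) * (fine (b s) - fine (b t))); last ring.
  have as12' : fine (a s2) < fine (a s1) by rewrite -lte_fin !fineK// af.
  have bt12' : fine (b t2) < fine (b t1) by rewrite -lte_fin !fineK// bf.
  by apply: ler_pM; rewrite ?subr_ge0 ?(ltW as12') ?(ltW bt12')// lerB.
move=> /(_ h); rewrite ABP leNgt => /negP; apply.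
have P0 : (0 <= P)%E by apply: integral_ge0 => s _; exact: mule_ge0.
have PAf : (c%:E * P + c%:E * P)%E \is a fin_num.
  by rewrite fin_numD fin_numM// ge0_fin_numE.
have : (0 < (e * p * (c - q))%:E)%E by rewrite lte_fin mulr_gt0// ?subr_gt0// mulr_gt0.
by rewrite -(lteDl _ PAf).
Qed.

End chebyshev_monotone.

(** * Log-concave functions *)

Definition uplevel {R : realType} {n : nat} (f : 'rV[R]_n -> R) (s : R) : set 'rV[R]_n :=
  [set z | s < f z].

Lemma rv_preimageD {R : realType} n (A B : set 'rV[R]_n) :
  @rv_of_tuple R n @^-1` (A `\` B) = @rv_of_tuple R n @^-1` A `\` @rv_of_tuple R n @^-1` B.
Proof. by []. Qed.

Section level_sets.
Context {R : realType} {n : nat}.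
Local Notation mR := (measurableTypeR R).
Local Notation leb := (@lebesgue_measure R).
Implicit Types (f : 'rV[R]_n -> R) (s : R).

(** The inequality for bounded [f] rests on this alone; log-concavity proper is used for boundedness
    and for the equality case. *)
Definition quasi_concave f := forall s, 0 <= s -> segment_closed (uplevel f s).

Lemma log_concave_quasi f : log_concave f -> quasi_concave f.
Proof.
move=> lcf s s0 x y l l01 sx sy; apply: lt_le_trans (lcf x y l l01).
pose m := Num.min (f x) (f y).
have sm : s < m by rewrite lt_min; apply/andP.
have m0 : 0 < m by exact: le_lt_trans sm.
have mx : m <= f x by rewrite ge_min lexx.
have my : m <= f y by rewrite ge_min lexx orbT.
have /andP[l0 l1] := l01.
apply: lt_le_trans sm _.
have -> : m = m `^ (1 - l) * m `^ l.
  by rewrite -powRD ?subrK ?powRr1 ?(ltW m0)// gt_eqF// implybT.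
apply: ler_pM; rewrite ?powR_ge0//; apply: ge0_ler_powR; rewrite ?nnegrE ?subr_ge0//.
- exact: ltW.
- by rewrite (le_trans (ltW m0)).
- exact: ltW.
- by rewrite (le_trans (ltW m0)).
Qed.

Variable f : 'rV[R]_n -> R.
Hypotheses (f0 : forall z, 0 <= f z) (qf : quasi_concave f).
Local Notation U := (uplevel f).
Local Notation K s := (closure (uplevel f s)).

Lemma uplevelS s t : s <= t -> U t `<=` U s.
Proof. by move=> st z; exact: le_lt_trans. Qed.

Lemma closure_uplevelS s t : s <= t -> K t `<=` K s.
Proof. by move=> st; apply: closureS; exact: uplevelS. Qed.

Lemma segment_closed_uplevel s : 0 <= s -> segment_closed (K s).
Proof. by move=> s0; apply: segment_closed_closure; exact: qf. Qed.

Local Notation If := (integral_rV (EFin \o f)).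

(** Markov's inequality, stated for the interior because the level set itself need not be Borel. *)
Lemma vol_interior_uplevel s : 0 < s -> (s%:E * vol (U s)° <= If)%E.
Proof.
move=> s0; have mI : measurable (@rv_of_tuple R n @^-1` (U s)°) by exact: borel_interior.
rewrite /integral_rV.
apply: (@le_trans _ _ (\int[lebesgue_tuple n]_t (s * \1_(@rv_of_tuple R n @^-1` (U s)°) t)%:E)%E).
  under eq_integral do rewrite EFinM.
  rewrite ge0_integralZl//; first by rewrite integral_indic// setIT.
    by apply/measurable_EFinP; exact: measurable_indic.
  by rewrite lee_fin ltW.
apply: ge0_le_integralT => t; first by rewrite lee_fin mulr_ge0 ?indicE// ltW.
rewrite lee_fin indicE; have [h|h] := pselect ((U s)° (rv_of_tuple t)); last first.
  by rewrite memNset// mulr0.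
by rewrite mem_set// mulr1 ltW//; exact: (interior_subset h).
Qed.

Hypothesis foo : (If < +oo)%E.

Lemma vol_interior_uplevel_lty s : 0 < s -> (vol (U s)° < +oo)%E.
Proof.
move=> s0; rewrite ltey; apply/eqP => e.
by have := vol_interior_uplevel s0; rewrite e gt0_muley ?lte_fin// leNgt foo.
Qed.

Lemma vol_closure_uplevel s : 0 < s -> vol (K s) = vol (U s)°.
Proof.
move=> s0; apply: vol_closure_convex; last exact: vol_interior_uplevel_lty.
by apply: qf; exact: ltW.
Qed.

Lemma vol_boundary_uplevel s : 0 < s -> vol (K s `\` (U s)°) = 0%E.
Proof.
move=> s0; have mI : measurable (@rv_of_tuple R n @^-1` (U s)°) by exact: borel_interior.
have mK : measurable (@rv_of_tuple R n @^-1` K s) by exact: borel_closure.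
transitivity (vol (K s) - vol (U s)°)%E.
  rewrite /vol rv_preimageD measureD//; last first.
    by have := vol_interior_uplevel_lty s0; rewrite -vol_closure_uplevel.
  congr (_ - lebesgue_tuple n _)%E; apply/setIidPr.
  by move=> t; apply: (subset_trans (@interior_subset _ _) (@subset_closure _ _)).
rewrite vol_closure_uplevel// subee//.
by rewrite ge0_fin_numE ?measure_ge0//; exact: vol_interior_uplevel_lty.
Qed.

Let q (k : nat) : R := ratr (odflt 0 (unpickle k : option rat)).

Let q_dense s t : s < t -> exists k, s < q k < t.
Proof.
move=> /rat_in_itvoo[r]; rewrite in_itv/= => srt; exists (pickle r).
by rewrite /q pickleK.
Qed.

(** The boundaries of the positive rational levels, [q] being an enumeration of the rationals. Off
    [N], [f z] exceeds [s >= 0] exactly when [z] is in some [K (q k)] with [q k > s], so the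
    function [g] below, [f] cut to 0 on [N], is Borel. *)
Let N : set 'rV[R]_n := \bigcup_(k in [set k | 0 < q k]) (K (q k) `\` (U (q k))°).

Let mN : measurable (@rv_of_tuple R n @^-1` N).
Proof.
rewrite preimage_bigcup; apply: bigcup_measurable => k _; rewrite rv_preimageD.
by apply: measurableD; [exact: borel_closure|exact: borel_interior].
Qed.

Let N0 : vol N = 0%E.
Proof.
apply/eqP; rewrite eq_le measure_ge0 andbT.
rewrite /vol preimage_bigcup bigcup_mkcond.
have mF k : measurable (if k \in [set k | 0 < q k] then @rv_of_tuple R n @^-1` (K (q k) `\` (U (q k))°) else set0).
  case: ifPn => // _; rewrite rv_preimageD.
  by apply: measurableD; [exact: borel_closure|exact: borel_interior].
apply: (@le_trans _ _ (\sum_(0 <= k <oo) lebesgue_tuple n (if k \in [set k | (0 < q k)%R]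
    then @rv_of_tuple R n @^-1` (K (q k) `\` (U (q k))°) else set0))%E).
  by apply: measure_sigma_subadditive => //; exact: bigcup_measurable.
rewrite eseries0// => k _ _; case: ifPn => [|_]; last by rewrite measure0.
by rewrite inE => /= k0; exact: vol_boundary_uplevel.
Qed.

Let g (z : 'rV[R]_n) : R := if z \in N then 0 else f z.

Let g_uplevel s : 0 <= s -> uplevel g s = U s `\` N.
Proof.
move=> s0; apply/seteqP; split => z; rewrite /uplevel /g /=.
  by case: ifPn; rewrite ?notin_setE ?ltNge ?s0// => Nz sz; split.
by move=> [sz Nz]; rewrite memNset.
Qed.

Let mg : measurable_fun setT (fun t => g (rv_of_tuple t) : mR).
Proof.
apply: (measurability _ (@RGenOInfty.measurableE R)) => // _ [_ [s ->] <-]; rewrite setTI.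
have [s0|s0] := ltP s 0.
  rewrite (_ : _ @^-1` _ = setT)//; apply/seteqP; split => // t _ /=.
  by rewrite in_itv/= andbT /g; case: ifPn => // _; rewrite (lt_le_trans s0).
rewrite (_ : _ @^-1` _ = @rv_of_tuple R n @^-1` uplevel g s); last first.
  by apply/seteqP; split => t /=; rewrite in_itv/= andbT.
rewrite g_uplevel//.
rewrite (_ : U s `\` N = (\bigcup_(k in [set k | s < q k]) K (q k)) `\` N).
  rewrite rv_preimageD preimage_bigcup; apply: measurableD => //.
  by apply: bigcup_measurable => k _; exact: borel_closure.
apply/seteqP; split => z [h Nz]; split => //.
  have [k /andP[sk kz]] := q_dense h.
  by exists k => //; apply: subset_closure.
case: h => k /= sk Kz.
have [Uz|nUz] := pselect ((U (q k))° z).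
  by apply: (uplevelS (ltW sk)); exact: (interior_subset Uz).
by exfalso; apply: Nz; exists k => //=; exact: le_lt_trans sk.
Qed.

(** A lower bound on the integral of [f] calls for a measurable minorant: the layer-cake formula is
    applied to [g], whose levels, together with the null set [N], cover the interiors of those of
    [f]. *)
Lemma integral_layers (c : R) : (forall z, f z <= c) ->
  (\int[leb]_(s in `]0%R, c[) vol (K s) <= If)%E.
Proof.
move=> fc.
have c0 : 0 <= c by exact: le_trans (f0 0) (fc 0).
apply: (@le_trans _ _ (integral_rV (EFin \o g))); last first.
  apply: ge0_le_integralT => t /=; rewrite lee_fin /g; case: ifPn => //.
rewrite /integral_rV (@layer_cake_itv _ _ _ (lebesgue_tuple n) (fun t => g (rv_of_tuple t)) c)//; last first.
  by move=> t; rewrite /g; case: ifPn => //; rewrite ?lexx ?c0 ?f0 ?fc.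
apply: ge0_le_integral => //.
- apply: nonincreasing_itv_measurable => s t _ st _.
  by apply: vol_le; [exact: borel_closure|exact: borel_closure|exact: closure_uplevelS].
- apply: nonincreasing_itv_measurable => s t _ st _.
  have mgs (r : R) : measurable [set t | r < g (rv_of_tuple t)].
    rewrite -[X in measurable X]setTI.
    rewrite (_ : [set t | _] = (fun t => g (rv_of_tuple t)) @^-1` `]r, +oo[%classic); first exact: mg.
    by apply/seteqP; split => u /=; rewrite in_itv/= andbT.
  apply: le_measure; rewrite ?inE//.
  by move=> x; exact: le_lt_trans.
move=> s; rewrite /= in_itv/= => /andP[s0 _]; rewrite vol_closure_uplevel//.
rewrite -[[set x | _]]/(@rv_of_tuple R n @^-1` uplevel g s) g_uplevel ?(ltW s0)//.
have mI : measurable (@rv_of_tuple R n @^-1` (U s)°) by exact: borel_interior.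
have mgs : measurable (@rv_of_tuple R n @^-1` (U s `\` N)).
  rewrite -g_uplevel ?(ltW s0)// -[X in measurable X]setTI.
  rewrite (_ : _ @^-1` _ = (fun t => g (rv_of_tuple t)) @^-1` `]s, +oo[%classic); first exact: mg.
  by apply/seteqP; split => u /=; rewrite in_itv/= andbT.
apply: (@le_trans _ _ (lebesgue_tuple n (@rv_of_tuple R n @^-1` (U s `\` N) `|` @rv_of_tuple R n @^-1` N))).
  apply: le_measure; rewrite ?inE//; first exact: measurableU.
  move=> t Ut; have [Nt|Nt] := pselect (N (rv_of_tuple t)); [by right|left; split => //].
  exact: (interior_subset Ut).
have N0' : lebesgue_tuple n (@rv_of_tuple R n @^-1` N) = 0%E by exact: N0.
by rewrite measureU0.
Qed.

End level_sets.

(** The nonnegative difference [h - g] has integral 0, so it vanishes almost everywhere and in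
    particular somewhere on [F]. *)
Lemma ge0_integral_eq_pt {R : realType} d (T : measurableType d) (mu : {measure set T -> \bar R})
    (E F : set T) (g h : T -> \bar R) : measurable E -> measurable F -> F `<=` E ->
  (0 < mu F)%E -> measurable_fun E g -> measurable_fun E h ->
  (forall x, E x -> (0 <= g x <= h x)%E) -> (forall x, E x -> g x \is a fin_num) ->
  (\int[mu]_(x in E) g x < +oo)%E ->
  (\int[mu]_(x in E) h x <= \int[mu]_(x in E) g x)%E -> exists2 x, F x & g x = h x.
Proof.
move=> mE mF FE F0 mg mh gh gf goo hg.
have k0 x : E x -> (0 <= h x - g x)%E.
  by move=> Ex; rewrite sube_ge0 ?gf//; have /andP[] := gh _ Ex.
have mk : measurable_fun E (fun x => h x - g x)%E.
  by apply: emeasurable_funB.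
have : (\int[mu]_(x in E) `|h x - g x| = 0)%E.
  have -> : (\int[mu]_(x in E) `|h x - g x| = \int[mu]_(x in E) (h x - g x))%E.
    by apply: eq_integral => x; rewrite inE => Ex; rewrite gee0_abs// k0.
  apply/eqP; rewrite eq_le integral_ge0// andbT.
  have g0 : (0 <= \int[mu]_(x in E) g x)%E by apply: integral_ge0 => x /gh /andP[].
  have gfin : (\int[mu]_(x in E) g x)%E \is a fin_num by rewrite ge0_fin_numE.
  rewrite -(@leeD2lE _ (\int[mu]_(x in E) g x)%E)// adde0 -ge0_integralD//; last first.
    by move=> x /gh /andP[].
  apply: le_trans hg; rewrite le_eqVlt; apply/orP; left; apply/eqP; apply: eq_integral => x.
  by rewrite inE => Ex; rewrite addeC subeK// gf.
move=> /ae_eq_integral_abs[]// N [mN N0 sN].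
apply: contrapT => nF; move: F0; apply/negP; rewrite -leNgt -N0.
apply: le_measure; rewrite ?inE// => x Fx; apply: sN => /= /(_ (FE _ Fx)) e.
apply: nF; exists x => //.
by rewrite -[RHS](@subeK _ _ (g x)) ?gf ?e ?add0e//; exact: FE.
Qed.

(** * The inequality for bounded functions *)

Section bounded_functions.
Context {R : realType} {i m n : nat}.
Variables (E1 : 'M[R]_(i, n)) (E2 : 'M[R]_(m, n)).
Hypotheses (dim : (i + m)%N = n) (E11 : E1 *m E1^T = 1%:M) (E22 : E2 *m E2^T = 1%:M)
  (E12 : E1 *m E2^T = 0).
Variables (f : 'rV[R]_n -> R) (c : R).
Hypotheses (f0 : forall z, 0 <= f z) (qf : quasi_concave f) (c0 : 0 < c) (fc : forall z, f z <= c).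
Local Notation mR := (measurableTypeR R).
Local Notation leb := (@lebesgue_measure R).
Local Notation K s := (closure (uplevel f s)).
Local Notation a s := (vol (shadow E1 E2 (K s))).
Local Notation b s := (vol (fiber E1 E2 (K s) 0)).
Local Notation If := (integral_rV (EFin \o f)).
Hypothesis foo : (If < +oo)%E.

Definition shadow_fun (x : 'rV[R]_i) : \bar R :=
  ereal_sup [set (f (x *m E1 + u *m E2))%:E | u in [set: 'rV[R]_m]].

Definition central_fun (u : 'rV[R]_m) : \bar R := (f (u *m E2))%:E.

Lemma shadowS (A B : set 'rV[R]_n) : A `<=` B -> shadow E1 E2 A `<=` shadow E1 E2 B.
Proof. by move=> AB x [u Au]; exists u; exact: AB. Qed.

Lemma level_shadow_noninc s t : 0 < s -> s <= t -> t < c -> (a t <= a s)%E.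
Proof.
move=> _ st _; apply: vol_le; [| |by apply: shadowS; exact: closure_uplevelS].
- by apply: borel_shadow => //; exact: closed_closure.
- by apply: borel_shadow => //; exact: closed_closure.
Qed.

Lemma level_slice_noninc s t : 0 < s -> s <= t -> t < c -> (b t <= b s)%E.
Proof.
move=> _ st _; apply: vol_le; [| |by move=> u; exact: closure_uplevelS].
- by apply: borel_slice; exact: borel_closure.
- by apply: borel_slice; exact: borel_closure.
Qed.

Lemma level_vol_noninc s t : 0 < s -> s <= t -> t < c -> (vol (K t) <= vol (K s))%E.
Proof.
by move=> _ st _; apply: vol_le; [exact: borel_closure|exact: borel_closure|exact: closure_uplevelS].
Qed.

Lemma integral_shadow_le : (integral_rV shadow_fun <= \int[leb]_(s in `]0%R, c[) a s)%E.
Proof.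
apply: (@integral_le_layers _ _ _ (lebesgue_tuple i) (fun t => shadow_fun (rv_of_tuple t))
  (fun s => @rv_of_tuple R i @^-1` shadow E1 E2 (K s)) c).
- move=> t; apply/andP; split.
    apply: (@le_trans _ _ (f (rv_of_tuple t *m E1 + 0 *m E2))%:E); first by rewrite lee_fin.
    by apply: ereal_sup_ubound; exists 0.
  by apply: ge_ereal_sup => _ [u _ <-]; rewrite lee_fin.
- by move=> s _; apply: borel_shadow => //; exact: closed_closure.
- move=> s t _ /ereal_sup_gt[_ [u _ <-]]; rewrite lte_fin => su.
  by exists u; apply: subset_closure.
- exact: (nonincreasing_itv_measurable level_shadow_noninc).
Qed.

Lemma integral_slice_le : (integral_rV central_fun <= \int[leb]_(s in `]0%R, c[) b s)%E.
Proof.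
apply: (@integral_le_layers _ _ _ (lebesgue_tuple m) (fun t => central_fun (rv_of_tuple t))
  (fun s => @rv_of_tuple R m @^-1` fiber E1 E2 (K s) 0) c).
- by move=> t; rewrite !lee_fin f0 fc.
- by move=> s _; apply: borel_slice; exact: borel_closure.
- move=> s t _; rewrite lte_fin => st; apply: subset_closure.
  by rewrite /uplevel /= mul0mx add0r.
- exact: (nonincreasing_itv_measurable level_slice_noninc).
Qed.

Lemma level_cone_volume s : 0 < s -> (a s * b s <= 'C(n, i)%:R%:E * vol (K s))%E.
Proof.
move=> s0; apply: cone_volume => //; first exact: closed_closure.
by apply: segment_closed_uplevel => //; exact: ltW.
Qed.

Let ma := nonincreasing_itv_measurable level_shadow_noninc.
Let mb := nonincreasing_itv_measurable level_slice_noninc.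
Let mv := nonincreasing_itv_measurable level_vol_noninc.

Let mCv : measurable_fun (`]0, c[%classic : set mR) (fun s => 'C(n, i)%:R%:E * vol (K s))%E.
Proof. exact: measurable_funeM. Qed.

Let mab : measurable_fun (`]0, c[%classic : set mR) (fun s => a s * b s)%E.
Proof. exact: emeasurable_funM. Qed.

Lemma integral_level_product_le : (\int[leb]_(s in `]0%R, c[) (a s * b s) <=
  \int[leb]_(s in `]0%R, c[) ('C(n, i)%:R%:E * vol (K s)))%E.
Proof.
apply: ge0_le_integral => //.
- by move=> s _; apply: mule_ge0; exact: measure_ge0.
- by move=> s; rewrite /= in_itv/= => /andP[s0 _]; exact: level_cone_volume.
Qed.

Lemma integral_level_vol_le : (\int[leb]_(s in `]0%R, c[) ('C(n, i)%:R%:E * vol (K s)) <=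
  'C(n, i)%:R%:E * If)%E.
Proof.
rewrite ge0_integralZl//.
by apply: lee_wpmul2l; [rewrite lee_fin|exact: integral_layers].
Qed.

Lemma chebyshev_levels : (\int[leb]_(s in `]0%R, c[) a s * \int[leb]_(s in `]0%R, c[) b s <=
  c%:E * \int[leb]_(s in `]0%R, c[) (a s * b s))%E.
Proof.
apply: chebyshev_le => //.
- exact: level_shadow_noninc.
- exact: level_slice_noninc.
Qed.

Lemma shadow_fun_ge0 x : (0 <= shadow_fun x)%E.
Proof.
apply: (@le_trans _ _ (f (x *m E1 + 0 *m E2))%:E); first by rewrite lee_fin.
by apply: ereal_sup_ubound; exists 0.
Qed.

Lemma integral_shadow_slice : (integral_rV shadow_fun * integral_rV central_fun <=
  \int[leb]_(s in `]0%R, c[) a s * \int[leb]_(s in `]0%R, c[) b s)%E.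
Proof.
apply: lee_pmul.
- by apply: integral_ge0 => t _; exact: shadow_fun_ge0.
- by apply: integral_ge0 => t _; rewrite lee_fin.
- exact: integral_shadow_le.
- exact: integral_slice_le.
Qed.

Lemma bounded_projection_ineq : (integral_rV shadow_fun * integral_rV central_fun <=
  c%:E * ('C(n, i)%:R%:E * If))%E.
Proof.
apply: le_trans integral_shadow_slice _; apply: le_trans chebyshev_levels _.
apply: lee_wpmul2l; first by rewrite lee_fin ltW.
exact: le_trans integral_level_product_le integral_level_vol_le.
Qed.

End bounded_functions.

Lemma powR_mean_between {R : realType} (s r t : R) : 0 < s -> s < r < t ->
  exists2 l, 0 < l < 1 & s `^ (1 - l) * t `^ l = r.
Proof.
move=> s0 /andP[sr rt].
have r0 : 0 < r by exact: lt_trans sr.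
have t0 : 0 < t by exact: lt_trans rt.
have lsr : ln s < ln r by rewrite ltr_ln ?posrE.
have lrt : ln r < ln t by rewrite ltr_ln ?posrE.
have d0 : 0 < ln t - ln s by rewrite subr_gt0 (lt_trans lsr).
exists ((ln r - ln s) / (ln t - ln s)).
  by apply/andP; split; [rewrite divr_gt0// subr_gt0|rewrite ltr_pdivrMr// mul1r; lra].
rewrite /powR !gt_eqF// -expRD -[RHS]lnK ?posrE//; congr expR.
by field; rewrite gt_eqF.
Qed.

Lemma closure_combine {R : realType} n (A B C : set 'rV[R]_n) l : 0 <= l <= 1 ->
  (forall x y, A x -> B y -> C ((1 - l) *: x + l *: y)) ->
  forall x y, closure A x -> closure B y -> closure C ((1 - l) *: x + l *: y).
Proof.
move=> /andP[l0 l1] ABC x y /closure_normP Ax /closure_normP By.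
apply/closure_normP => e e0.
have [x' Ax' xx'] := Ax _ e0; have [y' By' yy'] := By _ e0.
exists ((1 - l) *: x' + l *: y'); first exact: ABC.
rewrite opprD addrACA -!scalerBr (le_lt_trans (ler_normD _ _))//.
rewrite !normrZ ger0_norm ?subr_ge0// ger0_norm//.
rewrite (_ : e = (1 - l) * e + l * e); last ring.
have [->|l'0] := eqVneq l 0; first by rewrite subr0 !mul1r !mul0r !addr0.
apply: ler_ltD; last by rewrite ltr_pM2l// lt_neqAle eq_sym l'0.
by apply: ler_wpM2l; [lra|exact: ltW].
Qed.

(** * Level sets of log-concave functions, and boundedness *)

Section log_concave_levels.
Context {R : realType} {n : nat}.
Variable f : 'rV[R]_n -> R.
Hypotheses (f0 : forall z, 0 <= f z) (lcf : log_concave f).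
Local Notation mR := (measurableTypeR R).
Local Notation leb := (@lebesgue_measure R).
Local Notation U := (uplevel f).
Local Notation K s := (closure (uplevel f s)).
Local Notation If := (integral_rV (EFin \o f)).
Hypotheses (foo : (If < +oo)%E) (fpos : (0 < If)%E).

Let qf : quasi_concave f. Proof. exact: log_concave_quasi. Qed.

(** Since [1 - l] is positive, strictness at [x] is enough; at [y] one may take [t = f y], as in
    [fat_level] and [log_concave_bounded]. *)
Lemma uplevel_combine s t l x y : 0 < s -> 0 < t -> 0 < l < 1 -> s < f x -> t <= f y ->
  s `^ (1 - l) * t `^ l < f ((1 - l) *: x + l *: y).
Proof.
move=> s0 t0 /andP[l0 l1] sx ty.
have l01 : 0 <= l <= 1 by rewrite !ltW.
apply: lt_le_trans (lcf x y l01).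
apply: (@lt_le_trans _ _ (f x `^ (1 - l) * t `^ l)).
  rewrite ltr_pM2r ?powR_gt0//; apply: gt0_ltr_powR; rewrite ?nnegrE ?subr_gt0// ltW//.
by apply: ler_wpM2l; rewrite ?powR_ge0//; apply: ge0_ler_powR; rewrite ?nnegrE ?(ltW l0) ?(ltW t0).
Qed.

Lemma closure_uplevel_combine s t l x y : 0 < s -> 0 < t -> 0 < l < 1 -> K s x -> K t y ->
  K (s `^ (1 - l) * t `^ l) ((1 - l) *: x + l *: y).
Proof.
move=> s0 t0 l01; apply: closure_combine.
  by have /andP[h1 h2] := l01; rewrite !ltW.
by move=> x' y' sx ty; apply: uplevel_combine => //; exact: ltW.
Qed.

(** If no positive level had interior points, all their closures would be null and the integral of
    [f] would vanish. *)
Lemma some_fat_level : exists2 s, 0 < s & (U s)° !=set0.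
Proof.
apply: contrapT => h; move: fpos; apply/negP; rewrite -leNgt.
have Ks s : 0 < s -> vol (K s) = 0%E.
  move=> s0; apply: vol_null_thin; first by apply: qf; exact: ltW.
  by apply/eqP/negPn/negP => /set0P Us; apply: h; exists s.
rewrite /integral_rV (@integral_null_levels _ _ _ (lebesgue_tuple n) _ (fun s => @rv_of_tuple R n @^-1` K s))//.
- by move=> t; rewrite lee_fin.
- by move=> s _; exact: borel_closure.
- by move=> s t _; rewrite lte_fin => st; apply: subset_closure.
Qed.

(** Shrink a ball contained in the level [s] towards [z], with the weight for which the geometric
    mean of [s] and [f z] is [c]; the shrunken ball lies in the level [c]. *)
Lemma fat_level s c z : 0 < c -> (U s)° !=set0 -> 0 < s -> c < f z -> (U c)° !=set0.
Proof.
move=> c0 [x Ux] s0 cz.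
have [cs|sc] := leP c s.
  by exists x; apply: (interiorS (@uplevelS _ _ f c s cs)).
have [|l l01 lE] := @powR_mean_between _ s c (f z) s0; first by rewrite sc.
have /andP[l0 l1] := l01.
exists ((1 - l) *: x + l *: z); move: Ux => /interior_normP[r r0 rU].
have h0 : 0 < 1 - l by rewrite subr_gt0.
apply/interior_normP; exists ((1 - l) * r); first by rewrite mulr_gt0.
move=> y yxz; rewrite /uplevel /= -lE.
rewrite (_ : y = (1 - l) *: ((1 - l)^-1 *: (y - l *: z)) + l *: z); last first.
  by rewrite scalerA mulfV ?gt_eqF// scale1r subrK.
apply: uplevel_combine => //; first exact: lt_trans cz.
apply: rU; rewrite (_ : x - _ = (1 - l)^-1 *: ((1 - l) *: x + l *: z - y)); last first.
  by apply/rowP => k; rewrite !mxE; field; rewrite gt_eqF.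
by rewrite normrZ gtr0_norm ?invr_gt0// ltr_pdivrMl.
Qed.

(** The midpoints of [z] and the interior of the level [s] form a set of volume [d] on which [f]
    exceeds the square root of [s * f z]. That root times [d] is at most the integral, and the bound
    on [f z] results; the maximum with 1 makes [f z] positive. *)
Lemma log_concave_bounded : exists c : R, forall z, f z <= c.
Proof.
have [s s0 Us] := some_fat_level.
have Up := vol_open_gt0 (open_interior (U s)) Us.
have Uoo : (vol (U s)° < +oo)%E by apply: vol_interior_uplevel_lty.
have h0 : 0 < (2^-1 : R) by rewrite invr_gt0.
pose v := fine (vol (U s)°); pose I := fine If.
have vE : vol (U s)° = v%:E by rewrite fineK// ge0_fin_numE ?measure_ge0.
have IE : If = I%:E by rewrite fineK// ge0_fin_numE// ltW.
have v0 : 0 < v by move: Up; rewrite vE lte_fin.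
have I0 : 0 < I by move: fpos; rewrite IE lte_fin.
pose d := 2^-1 ^+ n * v.
have d0 : 0 < d by rewrite mulr_gt0// exprn_gt0.
exists (Num.max 1 ((I / d) ^+ 2 / s)) => z; rewrite leNgt; apply/negP.
rewrite gt_max => /andP[fz1 fz].
have fzp : 0 < f z by exact: lt_trans fz1.
have half : 0 < (2^-1 : R) < 1 by rewrite h0/= invf_lt1// ltr1n.
have half2 : 1 - 2^-1 = 2^-1 :> R by lra.
pose r := s `^ (1 - 2^-1) * f z `^ 2^-1.
have rp : 0 < r by rewrite mulr_gt0// powR_gt0.
have rE : r ^+ 2 = s * f z.
  rewrite /r half2.
  by rewrite exprMn -!powR_mulrn ?powR_ge0// -!powRrM mulVf ?pnatr_eq0// !powRr1// ltW.
have Ir : I / d < r.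
  have Id : 0 <= I / d by rewrite divr_ge0// ltW.
  by rewrite -(ltr_pXn2r (isT : (0 < 2)%N)) ?nnegrE ?(ltW rp)// rE [s * _]mulrC -ltr_pdivrMr.
have bs := borel_scale ((2^-1)^-1) (borel_interior (U s)).
pose W := [set y | [set x | (U s)° ((2^-1)^-1 *: x)] (y + - (2^-1 *: z))].
have bW : borel_rV W by exact: (borel_translate _ bs).
have volW : vol W = d%:E.
  transitivity (vol [set x | (U s)° ((2^-1)^-1 *: x)]); first exact: (vol_translate _ bs).
  by rewrite (vol_scale h0 (borel_interior (U s))) vE.
have oW : open W.
  have := @open_comp 'rV[R]_n 'rV[R]_n (fun y => (2^-1)^-1 *: (y + - (2^-1 *: z))) (U s)°.
  apply; last exact: open_interior.
  move=> y _; apply: (continuous_affine (M := ((2^-1)^-1)%:M)) => y1 y2.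
  by rewrite -scalerBr opprD addrACA subrr addr0 mul_mx_scalar.
have WU : W `<=` U r.
  move=> y /interior_subset Uy; rewrite /uplevel /=.
  rewrite [X in f X](_ : y = (1 - 2^-1) *: ((2^-1)^-1 *: (y + - (2^-1 *: z))) + 2^-1 *: z).
    exact: uplevel_combine.
  by rewrite half2 scalerA mulfV ?gt_eqF// scale1r subrK.
have : (r%:E * d%:E <= I%:E)%E.
  rewrite -IE; apply: le_trans (vol_interior_uplevel f0 rp).
  apply: lee_wpmul2l; first by rewrite lee_fin ltW.
  rewrite -volW; apply: vol_le => //; first exact: borel_interior.
  by move=> y Wy; apply: (interiorS WU); move: Wy; rewrite -{1}(interior_id W).1.
by rewrite -EFinM lee_fin leNgt -ltr_pdivrMr// Ir.
Qed.

End log_concave_levels.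

Lemma interior_two_points {R : realType} p (A : set 'rV[R]_p) : (0 < p)%N -> A° !=set0 ->
  exists x y, [/\ A x, A y & x != y].
Proof.
move=> p0 [x /interior_normP[r r0 rA]].
exists x, (x + const_mx (r / 2)); split.
- by apply: rA; rewrite subrr normr0.
- apply: rA; rewrite opprD addrA subrr add0r normrN.
  apply: (@le_lt_trans _ _ (r / 2)); last lra.
  apply: rV_norm_le => [|k]; first by rewrite divr_ge0// ltW.
  by rewrite mxE ger0_norm// divr_ge0// ltW.
- apply/eqP => /rowP/(_ (Ordinal p0)); rewrite !mxE => e; lra.
Qed.

Lemma scaler_eq_coef {R : realType} p (x : 'rV[R]_p) (s t : R) : x != 0 ->
  s *: x = t *: x -> s = t.
Proof.
move=> x0 e; apply/eqP; rewrite -subr_eq0.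
have : (s - t) *: x == 0 by rewrite scalerBl e subrr.
by rewrite scaler_eq0 (negbTE x0) orbF.
Qed.

(** * Necessity in the equality case *)

Section function_equality.
Context {R : realType} {i m n : nat}.
Variables (E1 : 'M[R]_(i, n)) (E2 : 'M[R]_(m, n)).
Hypotheses (dim : (i + m)%N = n) (E11 : E1 *m E1^T = 1%:M) (E22 : E2 *m E2^T = 1%:M)
  (E12 : E1 *m E2^T = 0).
Variables (f : 'rV[R]_n -> R) (c : R).
Hypotheses (f0 : forall z, 0 <= f z) (lcf : log_concave f) (c0 : 0 < c) (fc : forall z, f z <= c)
  (supf : forall s, s < c -> exists z, s < f z).
(** For [i = 0] both sides agree for every [f], and for [m = 0] whenever [f] attains its supremum at
    0, so indicators are characteristic only in between. The proof uses these bounds to find two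
    distinct points in a shadow and in a central slice. *)
Hypotheses (i0 : (0 < i)%N) (m0 : (0 < m)%N).
Local Notation mR := (measurableTypeR R).
Local Notation leb := (@lebesgue_measure R).
Local Notation U s := (uplevel f s).
Local Notation K s := (closure (uplevel f s)).
Local Notation L s := (shadow E1 E2 (K s)).
Local Notation S s := (fiber E1 E2 (K s) 0).
Local Notation a s := (vol (L s)).
Local Notation b s := (vol (S s)).
Local Notation If := (integral_rV (EFin \o f)).
Hypotheses (foo : (If < +oo)%E) (fpos : (0 < If)%E).
Hypothesis eqf : (integral_rV (shadow_fun E1 E2 f) * integral_rV (central_fun E2 f) =
  c%:E * ('C(n, i)%:R%:E * If))%E.

Let qf : quasi_concave f. Proof. exact: log_concave_quasi. Qed.

Let fat s : 0 < s < c -> (U s)° !=set0.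
Proof.
move=> /andP[s0 sc]; have [t t0 Ut] := some_fat_level f0 lcf fpos.
have [z sz] := supf sc; exact: (fat_level f0 lcf s0 Ut t0 sz).
Qed.

Let clK s : closed (K s). Proof. exact: closed_closure. Qed.

Let fatK s : 0 < s < c -> (K s)° !=set0.
Proof.
move=> /fat[x Ux]; exists x; apply: (interiorS _ Ux); exact: subset_closure.
Qed.

Let cK s : 0 < s < c -> segment_closed (K s).
Proof. by move=> /andP[s0 _]; apply: segment_closed_uplevel => //; exact: ltW. Qed.

Let ctK s : 0 < s < c -> compact (K s).
Proof.
move=> sc; apply: bounded_closed_compact => //.
have [||||M hM] := @segment_closed_bounded _ _ (K s).
- exact: borel_closure.
- exact: cK.
- exact: fatK.
- have /andP[s0 _] := sc.
  by rewrite (vol_closure_uplevel f0 qf foo s0); exact: vol_interior_uplevel_lty.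
exists M; split; first exact: num_real.
by move=> N MN x Kx /=; apply: le_trans (ltW MN); exact: hM.
Qed.

Let clL s : 0 < s < c -> closed (L s).
Proof.
by move=> sc; apply: compact_closed; [exact: norm_hausdorff|apply: compact_shadow => //; exact: ctK].
Qed.

Let clS s : closed (S s). Proof. exact: closed_slice. Qed.

Let vol_fin p (A : set 'rV[R]_p) : compact A -> vol A \is a fin_num.
Proof. by move=> ctA; rewrite ge0_fin_numE ?vol_compact_lty// measure_ge0. Qed.

Let af s : 0 < s < c -> a s \is a fin_num.
Proof. by move=> sc; apply: vol_fin; apply: compact_shadow => //; exact: ctK. Qed.

Let bf s : 0 < s < c -> b s \is a fin_num.
Proof. by move=> sc; apply: vol_fin; apply: (compact_slice E22 E12) => //; exact: ctK. Qed.

Let vf s : 0 < s < c -> vol (K s) \is a fin_num.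
Proof. by move=> sc; apply: vol_fin; exact: ctK. Qed.

Let C0 : 0 < 'C(n, i)%:R :> R.
Proof. by rewrite ltr0n bin_gt0 -dim leq_addr. Qed.

Let X := (c%:E * ('C(n, i)%:R%:E * If))%E.

Let P := (\int[leb]_(s in `]0%R, c[) (a s * b s))%E.
Let V := (\int[leb]_(s in `]0%R, c[) ('C(n, i)%:R%:E * vol (K s)))%E.

Let PV : (P <= V)%E.
Proof. exact: integral_level_product_le. Qed.

Let VI : (V <= 'C(n, i)%:R%:E * If)%E.
Proof. exact: integral_level_vol_le. Qed.

Let CIoo : ('C(n, i)%:R%:E * If < +oo)%E.
Proof. by rewrite lte_mul_pinfty ?lee_fin ?(ltW C0). Qed.

Let Poo : (P < +oo)%E. Proof. exact: le_lt_trans (le_trans PV VI) CIoo. Qed.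

Let cancel_c (x y : \bar R) : (c%:E * x <= c%:E * y)%E -> (x <= y)%E.
Proof. by rewrite lee_pmul2l// lte_fin. Qed.

(** Equality squeezes the chain behind the inequality. Finiteness of the right end makes the squeeze
    usable: with [VP] below, both the Chebyshev step and the integrated cone inequality become
    equalities. *)
Let ABP : (\int[leb]_(s in `]0%R, c[) a s * \int[leb]_(s in `]0%R, c[) b s = c%:E * P)%E.
Proof.
apply/eqP; rewrite eq_le; apply/andP; split; first exact: chebyshev_levels.
apply: le_trans (integral_shadow_slice dim E11 E22 E12 f0 fc).
rewrite eqf; apply: lee_wpmul2l; first by rewrite lee_fin ltW.
exact: le_trans PV VI.
Qed.

Let VP : (V <= P)%E.
Proof.
apply: cancel_c.
have H := integral_shadow_slice dim E11 E22 E12 f0 fc.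
rewrite ABP eqf in H; apply: le_trans H.
by apply: lee_wpmul2l; rewrite ?lee_fin ?(ltW c0).
Qed.

Let na := @level_shadow_noninc _ _ _ _ E1 E2 dim E11 E22 E12 f c.
Let nb := @level_slice_noninc _ _ _ _ E1 E2 f c.
Let nv := @level_vol_noninc _ _ f c.

Lemma extremal_level p q : 0 <= p -> p < q -> q <= c ->
  exists r, [/\ 0 < r < c, p < r < q & (a r * b r = 'C(n, i)%:R%:E * vol (K r))%E].
Proof.
move=> p0 pq qc.
have pqE : `]p, q[%classic `<=` (`]0, c[%classic : set mR).
  by move=> s; rewrite /= !in_itv/= => /andP[ps sq]; rewrite (le_lt_trans p0)//= (lt_le_trans sq).
have pqp : (0 < leb (`]p, q[%classic : set mR))%E.
  by rewrite lebesgue_measure_itv/= lte_fin pq lte_fin subr_gt0.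
have := @ge0_integral_eq_pt _ _ _ leb `]0, c[%classic `]p, q[%classic
  (fun s => a s * b s)%E (fun s => 'C(n, i)%:R%:E * vol (K s))%E
  (measurable_itv _) (measurable_itv _) pqE.
case.
- exact: pqp.
- by apply: emeasurable_funM; [exact: (nonincreasing_itv_measurable na)|exact: (nonincreasing_itv_measurable nb)].
- by apply: measurable_funeM; exact: (nonincreasing_itv_measurable nv).
- move=> s; rewrite /= in_itv/= => /andP[s0 _].
  by rewrite mule_ge0 ?measure_ge0//=; exact: level_cone_volume.
- by move=> s; rewrite /= in_itv/= => sc; rewrite fin_numM ?af ?bf.
- exact: Poo.
- exact: VP.
move=> r; rewrite /= in_itv/= => prq e; exists r; split => //.
by move: (pqE r); rewrite /= !in_itv/=; apply.
Qed.

Let const_or s1 s2 t1 t2 : 0 < s1 -> s1 <= s2 -> s2 < c -> (a s2 < a s1)%E ->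
  0 < t1 -> t1 <= t2 -> t2 < c -> (b t2 < b t1)%E -> False.
Proof.
exact: (chebyshev_eq c0 na nb _ _ af bf Poo ABP).
Qed.

Lemma constant_levels : (forall s t, 0 < s < c -> 0 < t < c -> a s = a t) \/
  (forall s t, 0 < s < c -> 0 < t < c -> b s = b t).
Proof.
have [|nab] := pselect (exists s1 s2, [/\ 0 < s1, s1 <= s2, s2 < c & (a s2 < a s1)%E]).
  move=> [s1 [s2 [s10 s12 s2c as12]]]; right.
  have bt s t : 0 < s -> s <= t -> t < c -> b s = b t.
    move=> s0 st tc; apply/eqP; rewrite eq_le; apply/andP; split; last exact: nb.
    rewrite leNgt; apply/negP => bts.
    exact: (const_or s10 s12 s2c as12 s0 st tc bts).
  move=> s t /andP[s0 sc] /andP[t0 tc]; have [st|/ltW ts] := leP s t; first exact: bt.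
  by apply/esym; exact: bt.
left.
have bt s t : 0 < s -> s <= t -> t < c -> a s = a t.
  move=> s0 st tc; apply/eqP; rewrite eq_le; apply/andP; split; last exact: na.
    rewrite leNgt; apply/negP => bts.
  by apply: nab; exists s, t.
move=> s t /andP[s0 sc] /andP[t0 tc]; have [st|/ltW ts] := leP s t; first exact: bt.
by apply/esym; exact: bt.
Qed.

Let S0S s t : s <= t -> S t `<=` S s.
Proof. by move=> st u; exact: closure_uplevelS. Qed.

Let LS s t : s <= t -> L t `<=` L s.
Proof. by move=> st; apply: shadowS; exact: closure_uplevelS. Qed.

Section extremal_one.
Variable r : R.
Hypotheses (rc : 0 < r < c) (er : (a r * b r = 'C(n, i)%:R%:E * vol (K r))%E).

Lemma extremal_level_conical x : conical_along E1 E2 (K r) x.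
Proof.
apply: (extremal_conical dim E11 E22 E12) => //; [exact: ctK|exact: cK|exact: fatK].
Qed.

Lemma extremal_level_interiors : (L r)° !=set0 /\ (S r)° !=set0.
Proof.
split.
  by apply: (extremal_interior_shadow dim E11 E22 E12) => //; [exact: ctK|exact: cK|exact: fatK].
by apply: (extremal_interior_slice0 dim) => //; [exact: ctK|exact: cK|exact: fatK].
Qed.

End extremal_one.

Lemma shadows_eq : (forall s t, 0 < s < c -> 0 < t < c -> a s = a t) ->
  forall s t, 0 < s < c -> 0 < t < c -> L s = L t.
Proof.
move=> ea.
have le s t : 0 < s -> s <= t -> t < c -> L t = L s.
  move=> s0 st tc.
  have sc : 0 < s < c by rewrite s0 (le_lt_trans st).
  have tc' : 0 < t < c by rewrite tc (lt_le_trans s0).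
  have [|r [rc /andP[tr _] er]] := extremal_level (ltW (lt_le_trans s0 st)) tc; first by [].
  apply: eq_closed_convex_vol; first exact: clL.
  - exact: clL.
  - by apply: segment_closed_shadow; exact: cK.
  - have [[x Lx] _] := extremal_level_interiors rc er.
    by exists x; apply: (interiorS _ Lx); apply: LS; rewrite (le_trans st)// ltW.
  - exact: LS.
  - by rewrite (ea s t).
  - by rewrite -ge0_fin_numE ?measure_ge0//; exact: af.
move=> s t /andP[s0 sc] /andP[t0 tc]; have [st|/ltW ts] := leP s t; last exact: le.
by apply/esym; exact: le.
Qed.

(** Nested closed convex sets of equal finite volume coincide once the larger has interior points. A
    level with interior may have a thin central slice, so the interior is borrowed from an extremal
    level above [t]. *)
Lemma slices_eq : (forall s t, 0 < s < c -> 0 < t < c -> b s = b t) ->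
  forall s t, 0 < s < c -> 0 < t < c -> S s = S t.
Proof.
move=> eb.
have le s t : 0 < s -> s <= t -> t < c -> S t = S s.
  move=> s0 st tc.
  have sc : 0 < s < c by rewrite s0 (le_lt_trans st).
  have tc' : 0 < t < c by rewrite tc (lt_le_trans s0).
  have [|r [rc /andP[tr _] er]] := extremal_level (ltW (lt_le_trans s0 st)) tc; first by [].
  apply: eq_closed_convex_vol; first exact: clS.
  - exact: clS.
  - by apply: segment_closed_slice; exact: cK.
  - have [_ [x Sx]] := extremal_level_interiors rc er.
    by exists x; apply: (interiorS _ Sx); apply: S0S; rewrite (le_trans st)// ltW.
  - exact: S0S.
  - by rewrite (eb s t).
  - by rewrite -ge0_fin_numE ?measure_ge0//; exact: bf.
move=> s t /andP[s0 sc] /andP[t0 tc]; have [st|/ltW ts] := leP s t; last exact: le.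
by apply/esym; exact: le.
Qed.

Let slice_combine s t l x y u v : 0 < s -> 0 < t -> 0 < l < 1 ->
  fiber E1 E2 (K s) x u -> fiber E1 E2 (K t) y v ->
  fiber E1 E2 (K (s `^ (1 - l) * t `^ l)) ((1 - l) *: x + l *: y) ((1 - l) *: u + l *: v).
Proof.
move=> s0 t0 l01 Ku Kv; have := closure_uplevel_combine f0 lcf s0 t0 l01 Ku Kv.
rewrite /fiber /=; congr (closure _ _).
by rewrite !mulmxDl -!scalemxAl !scalerDr addrACA.
Qed.

(* If the shadows agree, the apex over a boundary point of the common shadow lies
   in every level set; joining it to the central slice of [K t] gives a segment in
   [K r], and the cone [K r] then contains the base point of that segment. *)
Lemma slices_of_shadows : (forall s t, 0 < s < c -> 0 < t < c -> L s = L t) ->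
  forall s t, 0 < s < c -> 0 < t < c -> S s = S t.
Proof.
move=> eL.
have claim r t : 0 < r < c -> (a r * b r = 'C(n, i)%:R%:E * vol (K r))%E ->
    0 < t -> t <= r -> S t `<=` S r.
  move=> rc er t0; rewrite le_eqVlt => /predU1P[->//|tr] y Ky.
  have /andP[r0 r1] := rc.
  have [Li _] := extremal_level_interiors rc er.
  have [x Lx x0] : exists2 x, L r x & x != 0.
    have [x [y' [Lx Ly xy]]] := interior_two_points i0 Li.
    have [xE|x0] := eqVneq x 0; last by exists x.
    by exists y' => //; rewrite eq_sym -xE.
  have [sg [w [sg0 Kw hw]]] := extremal_level_conical rc er x.
  have sgn : sg != 0.
    have [u Ku] := Lx; have [|th [k [_ e _ _]]] := hw 1 u ler01; first by rewrite scale1r.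
    have := scaler_eq_coef x0 e; apply: contra_eq_neq => ->.
    by rewrite mulr0 oner_eq0.
  pose s := (r + c) / 2.
  have rs : r < s by rewrite /s; lra.
  have sc : 0 < s < c by rewrite (lt_trans r0)//= /s; lra.
  have Le : L r (sg *: x) by exists w.
  rewrite -(eL s r sc rc) in Le; have [p Kp] := Le.
  (* [K s] is contained in the cone [K r], whose only point over [sg *: x] is the apex. *)
  have pw : p = w.
    have [|th [k [_ e _ ->]]] := hw sg p sg0; first by apply: (closure_uplevelS (ltW rs)).
    have th1 : th = 1.
      by apply: (mulIf sgn); rewrite mul1r -(scaler_eq_coef x0 e).
    by rewrite th1 subrr scale0r add0r scale1r.
  have [|l l01 lE] := @powR_mean_between _ t r s t0; first by rewrite tr.
  have /andP[l0 l1] := l01; have /andP[s0 _] := sc.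
  have := slice_combine t0 s0 l01 Ky Kp.
  rewrite lE scaler0 add0r pw scalerA => Kl.
  have [|th [k [_ e Kk kE]]] := hw (l * sg) _ _ Kl; first by rewrite mulr_ge0// ltW.
  have thl : th = l by apply: (mulIf sgn); rewrite -(scaler_eq_coef x0 e).
  move: kE; rewrite thl => /addIr /(scalerI (_ : 1 - l != 0)) -> //.
  by rewrite gt_eqF// subr_gt0.
have le s t : 0 < s -> s <= t -> t < c -> S s = S t.
  move=> s0 st tc.
  have [|r [rc /andP[tr _] er]] := extremal_level (ltW (lt_le_trans s0 st)) tc; first by [].
  apply/seteqP; split; last exact: S0S.
  by apply: subset_trans (S0S (ltW tr)); apply: claim => //; rewrite (le_trans st)// ltW.
move=> s t /andP[s0 sc] /andP[t0 tc]; have [st|/ltW ts] := leP s t; first exact: le.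
by apply/esym; exact: le.
Qed.

(* If the central slices agree (with [M], say), a point of [K t] over [x] produces a
   translate of [l *: M] in a slice of the cone [K r]; comparing diameters, the apex
   of that cone lies beyond [x]. *)
Lemma shadows_of_slices : (forall s t, 0 < s < c -> 0 < t < c -> S s = S t) ->
  forall s t, 0 < s < c -> 0 < t < c -> L s = L t.
Proof.
move=> eS.
have claim r t : 0 < r < c -> (a r * b r = 'C(n, i)%:R%:E * vol (K r))%E ->
    0 < t -> t <= r -> L t `<=` L r.
  move=> rc er t0; rewrite le_eqVlt => /predU1P[->//|tr] x [z Kz].
  have /andP[r0 r1] := rc.
  have [_ Si] := extremal_level_interiors rc er.
  have [k1 [k2 [Kk1 Kk2 k12]]] := interior_two_points m0 Si.
  have L0 : L r 0 by exists k1.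
  have [->//|x0] := eqVneq x 0.
  have [sg [w [sg0 Kw hw]]] := extremal_level_conical rc er x.
  pose s := (r + c) / 2.
  have rs : r < s by rewrite /s; lra.
  have sc : 0 < s < c by rewrite (lt_trans r0)//= /s; lra.
  have [|l l01 lE] := @powR_mean_between _ t r s t0; first by rewrite tr.
  have /andP[l0 l1] := l01; have /andP[s0 _] := sc.
  have h0 : 0 < 1 - l by rewrite subr_gt0.
  have step k : S r k -> exists th k', [/\ 0 <= th <= 1, th * sg = 1 - l, S r k' &
      (1 - l) *: z + l *: k = (1 - th) *: k' + th *: w].
    move=> Kk; rewrite -(eS s r)// in Kk.
    have := slice_combine t0 s0 l01 Kz Kk; rewrite lE scaler0 addr0 => Kl.
    have [|th [k' [th01 e Kk' kE]]] := hw (1 - l) _ _ Kl; first exact: ltW.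
    by exists th, k'; split => //; rewrite -(scaler_eq_coef x0 e).
  have [th [_ [/andP[th0 th1] thE _ _]]] := step _ Kk1.
  have sgn : sg != 0.
    by apply: contra_eq_neq thE => ->; rewrite mulr0 eq_sym gt_eqF.
  have sgp : 0 < sg by rewrite lt_neqAle eq_sym sgn.
  have {}step k : S r k -> exists2 k', S r k' & (1 - l) *: z + l *: k = (1 - th) *: k' + th *: w.
    move=> /step[th' [k' [_ th'E Kk' kE]]]; exists k' => //.
    by rewrite kE (_ : th' = th)//; apply: (mulIf sgn); rewrite th'E.
  have [sg1|sg1] := leP 1 sg.
    have l1' : 0 <= sg^-1 <= 1 by rewrite invr_ge0 sg0 invf_le1.
    have Lsg : L r (sg *: x) by exists w.
    have xE : (1 - sg^-1) *: 0 + sg^-1 *: (sg *: x) = x.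
      by rewrite scaler0 add0r scalerA mulVf// scale1r.
    by have := segment_closed_shadow (cK rc) l1' L0 Lsg; rewrite xE.
  (* With the apex short of [x], that is [sg < 1], the relation [th * sg = 1 - l] forces
     [th > 1 - l]. A translate of the central slice scaled by [l] then sits in one scaled by the
     smaller [1 - th], against the positive finite diameter [D] below. *)
  have thl : 1 - th < l.
    have : 1 - l < th; last lra.
    by rewrite -thE gtr_pMr//; rewrite lt_neqAle eq_sym th0 andbT; apply: contra_eq_neq thE => ->;
      rewrite mul0r eq_sym gt_eqF.
  pose T := [set d : R | exists k k', [/\ S r k, S r k' & d = `|k - k'|]].
  have [M M0 hM] := compact_norm_bounded (compact_slice E22 E12 (ctK rc) (x := 0)).
  have Tub : ubound T (M + M).
    by move=> _ [k [k' [Kk Kk' ->]]]; rewrite (le_trans (ler_normB _ _))// lerD// hM.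
  have Tne : T !=set0 by exists `|k1 - k2|, k1, k2.
  pose D := sup T.
  have TD d : T d -> d <= D by move=> Td; apply: ub_le_sup => //; exists (M + M).
  have D0 : 0 < D.
    by apply: (@lt_le_trans _ _ `|k1 - k2|); [rewrite normr_gt0 subr_eq0|apply: TD; exists k1, k2].
  have : D <= (1 - th) / l * D.
    apply: ge_sup => // _ [k [k' [Kk Kk' ->]]].
    have [q Kq qE] := step _ Kk; have [q' Kq' qE'] := step _ Kk'.
    have E : l *: (k - k') = (1 - th) *: (q - q').
      transitivity (((1 - l) *: z + l *: k) - ((1 - l) *: z + l *: k')).
        by apply/rowP => j; rewrite !mxE; ring.
      by rewrite qE qE'; apply/rowP => j; rewrite !mxE; ring.
    rewrite mulrAC ler_pdivlMr// mulrC.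
    rewrite -[l in l * _]gtr0_norm// -normrZ E normrZ ger0_norm ?subr_ge0//.
    by apply: ler_wpM2l; [rewrite subr_ge0|apply: TD; exists q, q'].
  move=> DD; exfalso; move: DD; apply/negP; rewrite -ltNge gtr_pMl//.
  by rewrite ltr_pdivrMr// mul1r thl.
have le s t : 0 < s -> s <= t -> t < c -> L s = L t.
  move=> s0 st tc.
  have [|r [rc /andP[tr _] er]] := extremal_level (ltW (lt_le_trans s0 st)) tc; first by [].
  apply/seteqP; split; last exact: LS.
  by apply: subset_trans (LS (ltW tr)); apply: claim => //; rewrite (le_trans st)// ltW.
move=> s t /andP[s0 sc] /andP[t0 tc]; have [st|/ltW ts] := leP s t; first exact: le.
by apply/esym; exact: le.
Qed.

(** With shadows and central slices constant, all extremal levels have the same volume; one below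
    [s] and one above [t] enclose [K s] and [K t]. *)
Lemma levels_constant : exists K0 : set 'rV[R]_n, forall s, 0 < s < c -> K s = K0.
Proof.
have [eL eS] : (forall s t, 0 < s < c -> 0 < t < c -> L s = L t) /\
    (forall s t, 0 < s < c -> 0 < t < c -> S s = S t).
  have [ea|eb] := constant_levels.
    by have eL := shadows_eq ea; split => //; exact: slices_of_shadows.
  by have eS := slices_eq eb; split => //; exact: shadows_of_slices.
have ev s t : 0 < s -> s <= t -> t < c -> (vol (K s) <= vol (K t))%E.
  move=> s0 st tc.
  have [|r [rc /andP[_ rs] er]] := @extremal_level 0 s (lexx _) s0; first by rewrite ltW// (le_lt_trans st).
  have [|q [qc /andP[tq _] eq]] := @extremal_level t c _ tc (lexx _); first by rewrite ltW// (lt_le_trans s0).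
  have /andP[r0 _] := rc; have /andP[_ q1] := qc.
  apply: (@le_trans _ _ (vol (K r))); first exact: nv (ltW rs) (le_lt_trans st tc).
  apply: (@le_trans _ _ (vol (K q))); last exact: nv (lt_le_trans s0 st) (ltW tq) q1.
  rewrite -(@lee_pmul2l _ ('C(n, i)%:R%:E))// ?lte_fin//.
  by rewrite -er -eq (eL r q rc qc) (eS r q rc qc).
have le s t : 0 < s -> s <= t -> t < c -> K t = K s.
  move=> s0 st tc; apply: eq_closed_convex_vol.
  - exact: clK.
  - exact: clK.
  - by apply: cK; rewrite s0 (le_lt_trans st).
  - by apply: fatK; rewrite s0 (le_lt_trans st).
  - exact: closure_uplevelS.
  - exact: ev.
  - by rewrite -ge0_fin_numE ?measure_ge0//; apply: vf; rewrite tc (lt_le_trans s0).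
exists (K (c / 2)) => s /andP[s0 sc].
have [h|/ltW h] := leP s (c / 2); last by apply: le => //; rewrite divr_gt0.
by apply/esym; apply: le => //; lra.
Qed.

(** For [z] in the interior of [K0], equality of the closed levels puts [z] inside every level below
    [c]; outside [K0], no positive level contains it. The boundary escapes this argument but is
    null. *)
Lemma equality_indicator : exists K0 : set 'rV[R]_n, [/\ [/\ compact K0, segment_closed K0 & K0° !=set0],
  (vol (shadow E1 E2 K0) * vol (fiber E1 E2 K0 0) = 'C(n, i)%:R%:E * vol K0)%E,
  vol (K0 `\` K0°) = 0%E, (forall z, K0° z -> f z = c) & (forall z, ~ K0 z -> f z = 0)].
Proof.
have [K0 hK] := levels_constant.
have c2 : 0 < c / 2 < c by rewrite divr_gt0//= ltr_pdivrMr// ltr_pMr// ltr1n.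
have /andP[c20 _] := c2.
exists K0; rewrite -(hK _ c2); split.
- by split; [exact: ctK|exact: cK|exact: fatK].
- have [r [rc _ er]] := extremal_level (lexx 0) c0 (lexx _).
  by rewrite (hK _ c2) -(hK _ rc).
- have := vol_boundary_uplevel f0 qf foo c20.
  by rewrite (interior_closure_convex (qf (ltW c20)) (fat c2)).
- move=> z Kz.
  apply/eqP; rewrite eq_le fc/= leNgt; apply/negP => zc.
  pose s := Num.max (f z) (c / 2).
  have sc : 0 < s < c by rewrite lt_max c20 orbT gt_max zc; case/andP: c2.
  have /andP[s0 _] := sc.
  rewrite (hK _ c2) -(hK _ sc) (interior_closure_convex (qf (ltW s0)) (fat sc)) in Kz.
  by have := interior_subset Kz; rewrite /uplevel /= gt_max ltxx.
move=> z Kz; apply/eqP; rewrite eq_le f0 andbT leNgt; apply/negP => fz; apply: Kz.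
pose s := Num.min (f z) c / 2.
have m0' : 0 < Num.min (f z) c by rewrite lt_min fz.
have mc : Num.min (f z) c <= c by rewrite ge_min lexx orbT.
have mz : Num.min (f z) c <= f z by rewrite ge_min lexx.
have sc : 0 < s < c by rewrite /s divr_gt0//=; lra.
rewrite (hK _ c2) -(hK _ sc); apply: subset_closure; rewrite /uplevel /= /s; lra.
Qed.

End function_equality.

(** * Subspaces *)

Section orthonormal_coordinates.
Context {R : realType} {n : nat}.
Variable H : 'M[R]_n.
Local Notation E1 := (onb H).
Local Notation E2 := (onb (orthc H)).

Lemma onb_dim : (\rank H + \rank (orthc H))%N = n.
Proof. by rewrite rank_orthc subnKC// rank_leq_row. Qed.

Lemma onb_mul (G : 'M[R]_n) : onb G *m (onb G)^T = 1%:M.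
Proof. by case: (onbP G). Qed.

Lemma onb_orth : E1 *m E2^T = 0.
Proof.
have [_ /andP[/submxP[A AE] _]] := onbP H.
have [_ /andP[/sub_kermxP E2H _]] := onbP (orthc H).
by rewrite AE -mulmxA -[H *m _]trmxK trmx_mul trmxK E2H trmx0 mulmx0.
Qed.

Lemma subspace_setP (G : 'M[R]_n) x : subspace_set G x <-> exists t, x = t *m onb G.
Proof.
have [_ /andP[EG GE]] := onbP G; rewrite /subspace_set /=; split.
  by move=> xG; apply/submxP; exact: submx_trans GE.
by move=> [t ->]; apply: submx_trans EG; exact: submxMl.
Qed.

Lemma proj_funE (f : 'rV[R]_n -> R) t : proj_fun H f (t *m E1) = shadow_fun E1 E2 f t.
Proof.
congr ereal_sup; apply/seteqP; split => [y [w /subspace_setP[u ->] <-]|y [w _ <-]].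
  by exists u.
by exists (w *m E2) => //; apply/subspace_setP; exists w.
Qed.

Lemma subspace_integral_proj (f : 'rV[R]_n -> R) :
  subspace_integral H (proj_fun H f) = integral_rV (shadow_fun E1 E2 f).
Proof. by apply: eq_integral => t _; exact: proj_funE. Qed.

Lemma subspace_integral_orthc (f : 'rV[R]_n -> R) :
  subspace_integral (orthc H) (EFin \o f) = integral_rV (central_fun E2 f).
Proof. by []. Qed.

Lemma subspace_vol_proj K : subspace_vol H (proj_set H K) = vol (shadow E1 E2 K).
Proof.
rewrite /subspace_vol; congr vol; apply/seteqP; split => t /=.
  by move=> [_ [w /subspace_setP[u ->] Kw]]; exists u.
move=> [u Ku]; split; first by apply/subspace_setP; exists t.
by exists (u *m E2) => //; apply/subspace_setP; exists u.
Qed.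

Lemma orthc_sectionP K z : (K `&` subspace_set (orthc H)) z <->
  exists2 u, fiber E1 E2 K 0 u & z = u *m E2.
Proof.
split; first by move=> [Kz /subspace_setP[u zE]]; exists u => //; rewrite /fiber /= mul0mx add0r -zE.
by move=> [u]; rewrite /fiber /= mul0mx add0r => Ku ->; split => //; apply/subspace_setP; exists u.
Qed.

Lemma subspace_vol_orthc K :
  subspace_vol (orthc H) (K `&` subspace_set (orthc H)) = vol (fiber E1 E2 K 0).
Proof.
rewrite /subspace_vol; congr vol; apply/seteqP; split => t; rewrite /fiber /= mul0mx add0r.
  by case.
by move=> Kt; split => //; apply/subspace_setP; exists t.
Qed.

Lemma extremal_bodyE K : extremal_body (\rank H) H K <->
  (vol (shadow E1 E2 K) * vol (fiber E1 E2 K 0) = 'C(n, \rank H)%:R%:E * vol K)%E.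
Proof. by rewrite /extremal_body subspace_vol_proj subspace_vol_orthc. Qed.

Lemma halfspaceP x z : halfspace_along H (x *m E1) z <->
  exists s u, 0 <= s /\ z = (s *: x) *m E1 + u *m E2.
Proof.
split.
  move=> [_ [s [/subspace_setP[u ->] s0 ->]]]; exists s, u; split => //.
  by rewrite -scalemxAl addrC.
move=> [s [u [s0 ->]]]; exists (u *m E2), s; split => //.
  by apply/subspace_setP; exists u.
by rewrite -scalemxAl addrC.
Qed.

Lemma segment_closed_halfspace v : segment_closed (halfspace_along H v).
Proof.
move=> _ _ l /andP[l0 l1] [w [s [ww s0 ->]]] [w' [s' [ww' s0' ->]]].
exists ((1 - l) *: w + l *: w'), ((1 - l) * s + l * s'); split.
- move: ww ww' => /subspace_setP[u ->] /subspace_setP[u' ->].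
  by apply/subspace_setP; exists ((1 - l) *: u + l *: u'); rewrite mulmxDl -!scalemxAl.
- by rewrite addr_ge0// mulr_ge0// subr_ge0.
- by apply/rowP => j; rewrite !mxE; ring.
Qed.

Lemma convex_hullP (A : set 'rV[R]_n) z : convex_hull A z <->
  forall B, segment_closed B -> A `<=` B -> B z.
Proof.
split=> [Az B cB AB|h]; first by apply: Az; split => //; exact/convex_setP.
by move=> B [/convex_setP cB AB]; exact: h.
Qed.

(** Bounds the convex hull of [M] and [p] from above, so that each point of the hull acquires a
    weight on [p] and a base point in [M]. A combination puts weight [T] on [p] and mixes [k] and
    [k'] in the proportion [q : q']. *)
Lemma segment_closed_cone (M : set 'rV[R]_n) p : segment_closed M ->
  segment_closed [set z | exists th k, [/\ 0 <= th <= 1, M k & z = (1 - th) *: k + th *: p]].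
Proof.
move=> cM _ _ l /andP[l0 l1] [th [k [/andP[th0 th1] Mk ->]]] [th' [k' [/andP[th0' th1'] Mk' ->]]].
pose T := (1 - l) * th + l * th'.
pose q := (1 - l) * (1 - th); pose q' := l * (1 - th').
have q0 : 0 <= q by rewrite mulr_ge0// subr_ge0.
have q0' : 0 <= q' by rewrite mulr_ge0// subr_ge0.
have TE : 1 - T = q + q' by rewrite /T /q /q'; ring.
have T0 : 0 <= T by rewrite addr_ge0// mulr_ge0// subr_ge0.
have T1 : T <= 1 by rewrite -subr_ge0 TE addr_ge0.
(* All the weight is on [p], and any base point serves. *)
have [q00|qn] := eqVneq (q + q') 0.
  have qz : q = 0 by lra.
  have qz' : q' = 0 by lra.
  exists T, k; split => //; first by rewrite T0.
  transitivity (q *: k + q' *: k' + T *: p).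
    by apply/rowP => j; rewrite !mxE /q /q' /T; ring.
  by rewrite TE q00 qz qz' !scale0r !add0r.
have qp : 0 < q + q' by rewrite lt_neqAle eq_sym qn addr_ge0.
exists T, ((1 - q' / (q + q')) *: k + (q' / (q + q')) *: k'); split; first by rewrite T0.
  by apply: cM => //; rewrite divr_ge0 ?(ltW qp)//= ler_pdivrMr// mul1r lerDr.
have h : (q + q') * (1 - q' / (q + q')) = q by field.
have h' : (q + q') * (q' / (q + q')) = q' by field.
transitivity (q *: k + q' *: k' + T *: p).
  by apply/rowP => j; rewrite !mxE /q /q' /T; ring.
by rewrite TE scalerDr !scalerA h h'.
Qed.

Lemma extremal_conical_sections K : convex_body K ->
  (extremal_body (\rank H) H K <-> conical_sections H K).
Proof.
move=> [ctK /convex_setP cK K0].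
have sE := onb_mul H; have sE' := onb_mul (orthc H).
split.
  move=> /extremal_bodyE ex v /subspace_setP[x ->].
  have [sg [w [sg0 Kw hw]]] := extremal_conical onb_dim sE sE' onb_orth ctK cK K0 ex x.
  exists ((sg *: x) *m E1 + w *m E2); apply/seteqP; split => z.
    move=> [Kz /halfspaceP[s [u [s0 zE]]]]; apply/convex_hullP => B cB AB.
    have [|th [k [th01 e Kk kE]]] := hw s u s0; first by rewrite /fiber /= -zE.
    rewrite zE e kE.
    rewrite (_ : _ + _ = (1 - th) *: (k *m E2) + th *: ((sg *: x) *m E1 + w *m E2)).
      apply: cB => //; apply: AB; [left|by right].
      by apply/orthc_sectionP; exists k.
    by rewrite mulmxDl -!scalemxAl scalerDr !scalerA addrCA.
  move=> /convex_hullP; apply.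
    by apply: segment_closedI => //; exact: segment_closed_halfspace.
  move=> y [[Ky yH]|->].
    by split => //; exists y, 0; split => //; rewrite scale0r addr0.
  by split => //; apply/halfspaceP; exists sg, w.
move=> con; apply/extremal_bodyE.
have M0 x p : K `&` halfspace_along H (x *m E1) =
    convex_hull (K `&` subspace_set (orthc H) `|` [set p]) ->
    (K `&` halfspace_along H (x *m E1)) p.
  by move=> ->; apply/convex_hullP => B _ h; apply: h; right.
(* For [v = 0] the half-space is the complement itself, so the given [p] is a point of the central
   section. *)
have [k0 Kk0] : fiber E1 E2 K 0 !=set0.
  have [|p e] := con (0 *m E1); first by apply/subspace_setP; exists 0.
  have [Kp /halfspaceP[s [u [_ pE]]]] := M0 _ _ e.
  by exists u; rewrite /fiber /= mul0mx add0r; rewrite scaler0 mul0mx add0r in pE; rewrite -pE.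
apply: (conical_extremal onb_dim sE sE' onb_orth) => //; first by exists k0.
move=> x; have [|p e] := con (x *m E1); first by apply/subspace_setP; exists x.
have [Kp /halfspaceP[sg [w [sg0 pE]]]] := M0 _ _ e.
exists sg, w; split => //; first by rewrite /fiber /= -pE.
move=> s u s0 Ku.
have : convex_hull (K `&` subspace_set (orthc H) `|` [set p]) ((s *: x) *m E1 + u *m E2).
  by rewrite -e; split => //; apply/halfspaceP; exists s, u.
move=> /convex_hullP/(_ _ (segment_closed_cone (M := K `&` subspace_set (orthc H)) (p := p) _)).
have cM : segment_closed (K `&` subspace_set (orthc H)).
  apply: segment_closedI => // y z l _ /subspace_setP[a ->] /subspace_setP[b ->].
  by apply/subspace_setP; exists ((1 - l) *: a + l *: b); rewrite mulmxDl -!scalemxAl.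
have Mk0 : (K `&` subspace_set (orthc H)) (k0 *m E2) by apply/orthc_sectionP; exists k0.
case/(_ cM).
  move=> y [My|->].
    by exists 0, y; rewrite lexx ler01 subr0 scale1r scale0r addr0; split.
  by exists 1, (k0 *m E2); rewrite lexx ler01 subrr scale0r scale1r add0r; split.
move=> th [_ [th01 /orthc_sectionP[k Kk ->] zE]]; exists th, k.
have zE' : (s *: x) *m E1 + u *m E2 = ((th * sg) *: x) *m E1 + ((1 - th) *: k + th *: w) *m E2.
  by rewrite zE pE mulmxDl -!scalemxAl scalerDr !scalerA addrCA.
split => //.
  by have := congr1 (mulmx^~ E1^T) zE'; rewrite !(proj1K sE onb_orth).
by have := congr1 (mulmx^~ E2^T) zE'; rewrite !(proj2K sE' onb_orth).
Qed.

End orthonormal_coordinates.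

Section degenerate.
Context {R : realType} {i m n : nat}.
Variables (E1 : 'M[R]_(i, n)) (E2 : 'M[R]_(m, n)).
Hypotheses (dim : (i + m)%N = n) (E11 : E1 *m E1^T = 1%:M) (E22 : E2 *m E2^T = 1%:M)
  (E12 : E1 *m E2^T = 0).
Variable f : 'rV[R]_n -> R.
Hypotheses (f0 : forall z, 0 <= f z) (qf : quasi_concave f).
Local Notation K s := (closure (uplevel f s)).
Hypothesis fnull : integral_rV (EFin \o f) = 0%E.

(** A null [f] may be unbounded, so the bounded inequality is not at hand. At each level the shadow
    or the central slice is null; if the shadow at [s] is not, then neither is the one at the
    minimum of [s] and [t], and monotonicity makes the slice null at every [t]. *)
Lemma null_projection : (integral_rV (shadow_fun E1 E2 f) * integral_rV (central_fun E2 f) = 0)%E.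
Proof.
have foo : (integral_rV (EFin \o f) < +oo)%E by rewrite fnull.
have vK s : 0 < s -> vol (K s) = 0%E.
  move=> s0; rewrite (vol_closure_uplevel f0 qf foo s0); apply/eqP; rewrite eq_le measure_ge0 andbT.
  have := vol_interior_uplevel f0 s0; rewrite fnull => h.
  by rewrite leNgt; apply: contraTN h => h; rewrite -ltNge mule_gt0// lte_fin.
have bL s : borel_rV (shadow E1 E2 (K s)) by apply: borel_shadow => //; exact: closed_closure.
have bS s : borel_rV (fiber E1 E2 (K s) 0) by apply: borel_slice; exact: borel_closure.
have ab s : 0 < s -> vol (shadow E1 E2 (K s)) = 0%E \/ vol (fiber E1 E2 (K s) 0) = 0%E.
  move=> s0; have := level_cone_volume dim E11 E22 E12 qf s0; rewrite vK// mule0 => h.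
  have /eqP : (vol (shadow E1 E2 (K s)) * vol (fiber E1 E2 (K s) 0) = 0)%E.
    by apply/eqP; rewrite eq_le h mule_ge0// measure_ge0.
  by rewrite mule_eq0 => /orP[/eqP ->|/eqP ->]; [left|right].
have [a0|/existsNP[s /not_implyP[s0 /eqP as0]]] :=
    pselect (forall s, 0 < s -> vol (shadow E1 E2 (K s)) = 0%E).
  rewrite [X in (X * _)%E](_ : _ = 0%E) ?mul0e//.
  apply: (@integral_null_levels _ _ _ (lebesgue_tuple i) _ (fun s => @rv_of_tuple R i @^-1` shadow E1 E2 (K s))).
  - by move=> t; apply: shadow_fun_ge0.
  - by move=> s _; exact: bL.
  - exact: a0.
  - move=> s t _ /ereal_sup_gt[_ [u _ <-]]; rewrite lte_fin => su.
    by exists u; apply: subset_closure.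
rewrite [X in (_ * X)%E](_ : _ = 0%E) ?mule0//.
apply: (@integral_null_levels _ _ _ (lebesgue_tuple m) _ (fun s => @rv_of_tuple R m @^-1` fiber E1 E2 (K s) 0)).
- by move=> t; rewrite lee_fin.
- by move=> t _; exact: bS.
- move=> t t0; apply/eqP; rewrite eq_le measure_ge0 andbT.
  pose r := Num.min s t.
  have r0 : 0 < r by rewrite lt_min s0.
  have [ar|br] := ab r r0.
    exfalso; move: as0; apply/negP; rewrite negbK eq_le measure_ge0 andbT -ar.
    by apply: vol_le => //; apply: shadowS; apply: closure_uplevelS; rewrite ge_min lexx.
  rewrite -br; apply: vol_le => // u; apply: closure_uplevelS.
  by rewrite ge_min lexx orbT.
- move=> t u _; rewrite lte_fin => tu; apply: subset_closure.
  by rewrite /uplevel /= mul0mx add0r.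
Qed.

End degenerate.

(** * Integrals of multiples of indicators, for sufficiency in the equality case *)

Section indicators.
Context {R : realType} {i m n : nat}.
Variables (E1 : 'M[R]_(i, n)) (E2 : 'M[R]_(m, n)).
Hypotheses (dim : (i + m)%N = n) (E11 : E1 *m E1^T = 1%:M) (E22 : E2 *m E2^T = 1%:M)
  (E12 : E1 *m E2^T = 0).
Variables (f : 'rV[R]_n -> R) (c : R) (K : set 'rV[R]_n).
Hypotheses (c0 : 0 < c) (clK : closed K) (fK : forall z, f z = c * \1_K z).

Let integral_cindic p (A : set 'rV[R]_p) (g : 'rV[R]_p -> \bar R) : borel_rV A ->
  (forall x, g x = (c * \1_A x)%:E) -> integral_rV g = (c%:E * vol A)%E.
Proof.
move=> bA gA; rewrite /integral_rV.
transitivity (\int[lebesgue_tuple p]_t (c%:E * (\1_(@rv_of_tuple R p @^-1` A) t)%:E))%E.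
  by apply: eq_integral => t _; rewrite gA EFinM.
rewrite ge0_integralZl//; first by rewrite integral_indic// setIT.
  by apply/measurable_EFinP; exact: measurable_indic.
by rewrite lee_fin ltW.
Qed.

Lemma integral_indicator : integral_rV (EFin \o f) = (c%:E * vol K)%E.
Proof. by apply: integral_cindic => [|x]; [exact: borel_closed|rewrite /= fK]. Qed.

Lemma integral_shadow_indicator : integral_rV (shadow_fun E1 E2 f) = (c%:E * vol (shadow E1 E2 K))%E.
Proof.
apply: integral_cindic => [|x]; first exact: borel_shadow.
have [[u Ku]|Lx] := pselect (shadow E1 E2 K x).
  rewrite indicE mem_set; last by exists u.
  apply/eqP; rewrite eq_le; apply/andP; split.
    apply: ge_ereal_sup => _ [v _ <-]; rewrite lee_fin fK ler_wpM2l ?(ltW c0)//.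
    by rewrite indicE; case: (_ \in _).
  apply: ereal_sup_ubound; exists u => //; rewrite fK indicE mem_set//.
rewrite indicE memNset// mulr0; apply/eqP; rewrite eq_le; apply/andP; split.
  apply: ge_ereal_sup => _ [v _ <-]; rewrite lee_fin fK indicE memNset ?mulr0// => Kv.
  by apply: Lx; exists v.
apply: ereal_sup_ubound; exists 0 => //; rewrite fK indicE memNset ?mulr0// => Kv.
by apply: Lx; exists 0.
Qed.

Lemma integral_central_indicator : integral_rV (central_fun E2 f) = (c%:E * vol (fiber E1 E2 K 0))%E.
Proof.
apply: integral_cindic => [|u]; first by apply: borel_slice; exact: borel_closed.
rewrite /central_fun fK !indicE; congr (c * _%:R)%:E; congr nat_of_bool.
by apply/idP/idP; rewrite !inE /fiber /= mul0mx add0r.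
Qed.

End indicators.

Section supnorm.
Context {R : realType} {n : nat}.
Variable f : 'rV[R]_n -> R.
Hypothesis f0 : forall z, 0 <= f z.

Lemma supnorm_ge0 : (0 <= supnorm f)%E.
Proof.
apply: (@le_trans _ _ (f 0)%:E); first by rewrite lee_fin.
by apply: ereal_sup_ubound; exists 0.
Qed.

Lemma supnorm_finP : (integral_rV (EFin \o f) < +oo)%E -> (0 < integral_rV (EFin \o f))%E ->
  log_concave f -> exists c, [/\ 0 < c, supnorm f = c%:E, forall z, f z <= c &
    forall s, s < c -> exists z, s < f z].
Proof.
move=> foo fpos lcf; have [b fb] := log_concave_bounded f0 lcf foo fpos.
have Mb : (supnorm f <= b%:E)%E by apply: ge_ereal_sup => _ [z _ <-]; rewrite lee_fin.
have Mf : supnorm f \is a fin_num.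
  by rewrite ge0_fin_numE ?supnorm_ge0// (le_lt_trans Mb)// ltry.
exists (fine (supnorm f)); split; rewrite ?fineK//.
- rewrite -lte_fin fineK// lt_def supnorm_ge0 andbT; apply: contraTneq fpos => M0.
  rewrite -leNgt /integral_rV integral0_eq// => t _ /=; congr (_%:E).
  apply/eqP; rewrite eq_le f0 andbT -lee_fin -M0.
  by apply: ereal_sup_ubound; exists (rv_of_tuple t).
- by move=> z; rewrite -lee_fin fineK//; apply: ereal_sup_ubound; exists z.
move=> s; rewrite -lte_fin fineK// => /ereal_sup_gt[_ [z _ <-]].
by rewrite lte_fin => sz; exists z.
Qed.

End supnorm.

Theorem theorem1p1 (R : realType) (n i : nat) (H : 'M[R]_n)
    (hH : \rank H = i) (f : 'rV[R]_n -> R) (hf : int_log_concave f) :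
  let lhs := (subspace_integral H (proj_fun H f) *
              subspace_integral (orthc H) (EFin \o f))%E in
  let rhs := ('C(n, i)%:R%:E * supnorm f * integral_rV (EFin \o f))%E in
  [/\ (* the inequality *)
      (lhs <= rhs)%E,
      (* sufficiency in the equality case *)
      (exists K : set 'rV[R]_n,
        [/\ convex_body K,
            forall z, f z / fine (supnorm f) = \1_K z
          & extremal_body i H K]) ->
      lhs = rhs,
      (* necessity in the equality case; f is determined by the integrals only
         up to a null set, and everywhere if it is upper semicontinuous *)
      (0 < i < n)%N -> (0 < integral_rV (EFin \o f))%E -> lhs = rhs ->
      exists K : set 'rV[R]_n,
        [/\ convex_body K,
            {ae lebesgue_tuple n, forall t,
              f (rv_of_tuple t) / fine (supnorm f) = \1_K (rv_of_tuple t)},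
            upper_semicontinuous f ->
              forall z, f z / fine (supnorm f) = \1_K z
          & extremal_body i H K]
    & (* the geometric description of the extremal bodies *)
      forall K : set 'rV[R]_n, convex_body K ->
        (extremal_body i H K <-> conical_sections H K)].
Proof.
subst i => lhs rhs.
have [f0 lcf foo] := hf.
have qf := log_concave_quasi lcf.
have dim := onb_dim H; have sE := onb_mul H; have sE' := onb_mul (orthc H).
have oE := onb_orth H.
set If := integral_rV (EFin \o f) in foo rhs *.
have lhsE : lhs = (integral_rV (shadow_fun (onb H) (onb (orthc H)) f) *
    integral_rV (central_fun (onb (orthc H)) f))%E.
  by rewrite /lhs subspace_integral_proj subspace_integral_orthc.
have rhsE : rhs = (supnorm f * ('C(n, \rank H)%:R%:E * If))%E.
  by rewrite /rhs muleAC muleC.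
have If0 : (0 <= If)%E by apply: integral_ge0 => t _; rewrite lee_fin.
split.
- move: If0; rewrite le_eqVlt => /predU1P[Ifz|Ifp].
    by rewrite lhsE rhsE -Ifz !mule0 (null_projection dim sE sE' oE f0 qf (esym Ifz)).
  have [c [c0 cE fc _]] := supnorm_finP f0 foo Ifp lcf.
  by rewrite lhsE rhsE cE; exact: (bounded_projection_ineq dim sE sE' oE f0 qf c0 fc foo).
- move=> [K [[ctK _ [z0 /interior_subset Kz0]] fK /extremal_bodyE ex]].
  have clK : closed K by apply: compact_closed => //; exact: norm_hausdorff.
  pose c := fine (supnorm f).
  (* [fine] sends [+oo] to 0 and a quotient by 0 is 0, so the value 1 at [z0] excludes both a zero
     and an infinite supremum. *)
  have cn : c != 0.
    apply/eqP => c0; have := fK z0; rewrite -/c c0 invr0 mulr0 indicE mem_set// => /eqP.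
    by rewrite eq_sym oner_eq0.
  have cp : 0 < c by rewrite lt_def cn fine_ge0// supnorm_ge0.
  have cE : supnorm f = c%:E.
    by move: cn; rewrite /c; case: (supnorm f) => //=; rewrite eqxx.
  have fcK z : f z = c * \1_K z by rewrite -fK mulrC divfK.
  rewrite lhsE rhsE cE /If (integral_indicator cp clK fcK).
  rewrite (integral_shadow_indicator dim sE sE' oE cp clK fcK).
  rewrite (integral_central_indicator (onb H) _ cp clK fcK).
  by rewrite muleACA ex -muleA; congr (_ * _)%E; exact: muleCA.
- move=> /andP[i0 im] Ifp.
  have [c [c0 cE fc fsup]] := supnorm_finP f0 foo Ifp lcf.
  have m0 : (0 < \rank (orthc H))%N by rewrite rank_orthc subn_gt0.
  rewrite lhsE rhsE cE => eqf.
  have [K [[ctK cK Ki] ex dK fK fnK]] :=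
    equality_indicator dim sE sE' oE f0 lcf c0 fc fsup i0 m0 foo Ifp eqf.
  have off z : ~ (K `\` K°) z -> f z / c = \1_K z.
    move=> nz; have [Kz|Kz] := pselect (K z); last by rewrite fnK// mul0r indicE memNset.
    rewrite fK ?indicE ?mem_set ?divff ?gt_eqF//.
    by apply: contrapT => h; apply: nz.
  exists K; split.
  + by split => //; exact/convex_setP.
  + exists (@rv_of_tuple R n @^-1` (K `\` K°)); split => //.
      rewrite rv_preimageD; apply: measurableD; last exact: borel_interior.
      by apply: borel_closed; apply: compact_closed => //; exact: norm_hausdorff.
    by move=> t /= h; apply: contrapT => nt; apply: h; exact: off.
  + move=> usc z /=; have [Kz|Kz] := pselect (K z); last first.
      by apply: off => -[].
    rewrite indicE mem_set// (_ : f z = c) ?divff ?gt_eqF//.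
    apply/eqP; rewrite eq_le fc/= leNgt; apply/negP => fz.
    have [|V nV hV] := usc z (- c); first by rewrite lte_fin ltrN2.
    (* A neighbourhood of [z] on which [f] stays below [c] would meet the interior of [K], where [f]
       equals [c]. *)
    have : closure K° z by rewrite -(closure_interior_convex cK Ki); apply: subset_closure.
    move=> /(_ _ nV)[y [Ky Vy]].
    by have := hV _ Vy; rewrite lte_fin ltrN2 fK// ltxx.
  + by apply/extremal_bodyE.
- by move=> K; exact: extremal_conical_sections.
Qed.
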